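(* Let $\mathcal{S}_{b,c}$ ($b>0$, $c\in\mathbb{R}$) denote the $2$-parameter family of smoothly-closing $\mathrm{SU}(3)$-invariant steady gradient Laplacian solitons. Among the $1$-parameter family $\mathcal{S}_{1,c}$, the subfamily with $c^2\le\frac92$ consists of complete solitons, all defined on $\Lambda^2_-\mathbb{CP}^2$, while the subfamily with $c^2>\frac92$ consists entirely of incomplete solitons: each of the latter has a finite maximal forward existence time $t_*$, and as $t\to t_*$ its smallest variable $f_k\to0$ with $f_k=O(\sqrt{t_*-t})$. Moreover: (i) Any complete $\mathrm{SU}(3)$-invariant steady Laplacian soliton with principal orbit $\mathrm{SU}(3)/T^2$ belongs to this family (up to scaling and discrete symmetries). (ii) $\mathcal{S}_{1,0}$ is the trivial steady soliton on the Bryant--Salamon $G_2$-holonomy metric on $\Lambda^2_-\mathbb{CP}^2$. It is asymptotic with rate $-4$ to the cone $C_{\mathrm{tf}}$, the unique $\mathrm{SU}(3)$-invariant torsion-free $G_2$-cone over $\mathrm{SU}(3)/T^2$. (iii) For $0<c^2<\frac92$, $\mathcal{S}_{1,c}$ is a nontrivial steady soliton on $\Lambda^2_-\mathbb{CP}^2$ asymptotic with rate $-1$ to the cone $C_{\mathrm{tf}}$. (iv) For $c^2=\frac92$, $\mathcal{S}_{1,c}$ is a complete nontrivial steady soliton on $\Lambda^2_-\mathbb{CP}^2$ with exponential volume growth and asymptotically constant negative scalar curvature; it exists for all $t\ge 0$, and as $t\to\infty$ one variable $f_k$ has a finite positive limit while the other two grow exponentially with ratio tending to $1$.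
   Context: An $\mathrm{SU}(3)$-invariant steady Laplacian soliton on $I\times \mathrm{SU}(3)/T^2$ is (up to discrete symmetries) given by functions $f_1,f_2,f_3:I\to(0,\infty)$, $u:I\to\mathbb{R}$ satisfying $2(f_1f_2f_3)'=\sum_i f_i^2$, $\;(\tau_i-uf_i^2)'=0$ for $i=1,2,3$, and $\sum_i\tau_i=u\sum_i f_i^2$, where $\tau_i:=(f_i^2)'+\frac{f_i^2}{f_1f_2f_3}\bigl(2f_i^2-\sum_jf_j^2\bigr)$. It corresponds to a closed invariant $G_2$-structure $\varphi$ with metric $g_\varphi=dt^2+\sum f_i^2g_i$ ($g_i$ the invariant metrics on the irreducible summands of the isotropy representation, normalised to be round of curvature 1 on the corresponding $2$-sphere fibres), torsion $\tau$ with $|\tau|^2=\sum\tau_i^2f_i^{-4}$, scalar curvature $-\frac12|\tau|^2$, and $X=u\,\partial_t$ with $\Delta_\varphi\varphi=\mathcal{L}_X\varphi$. The soliton extends smoothly over the zero section $\mathbb{CP}^2\subset\Lambda^2_-\mathbb{CP}^2$ at $t=0$ (is ''smoothly-closing'') iff $f_1$ is odd in $t$ with $f_1'(0)=1$, $f_2^2(t)=f_3^2(-t)$, $f_2(0)=f_3(0)>0$, and $u$ is odd. For each $b>0$, $c\in\mathbb{R}$, $\mathcal{S}_{b,c}$ is the unique smoothly-closing steady soliton (real analytic on $[0,\epsilon)$, then extended maximally forward in $t$) with $f_2(0)=f_3(0)=b$, $\tau_1(0)=0$, $\tau_2(0)=c$, $\tau_3(0)=-c$; in particular $f_1=t+O(t^3)$,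 $f_2=b+\frac{c}{6b}t+O(t^2)$, $f_3=b-\frac{c}{6b}t+O(t^2)$. It is complete iff the solution exists for all $t\ge0$. The scaling $(t,f_i,u,\tau_i)\mapsto(\mu t,\mu f_i,\mu^{-1}u,\mu\tau_i)$ maps $\mathcal{S}_{b,c}$ to $\mathcal{S}_{\mu b,\mu c}$. The discrete symmetries are permutations of $(f_1,f_2,f_3)$ (the Weyl group $S_3$ of $\mathrm{SU}(3)$) and the Klein four-group action on $\mathrm{SU}(3)$-structures $(\omega,\Omega)$ on $\mathrm{SU}(3)/T^2$ generated by $(\omega,\Omega)\mapsto(-\omega,\overline\Omega)$ and $(\omega,\Omega)\mapsto(\omega,-\Omega)$, where $\varphi=dt\wedge\omega+\mathrm{Re}\,\Omega$. $C_{\mathrm{tf}}$ is $f_1=f_2=f_3=\frac12t$; being asymptotic to it with rate $\nu<0$ means that, after a translation in $t$, $f_i=\frac12t+O(t^{1+\nu})$ as $t\to\infty$ (with corresponding decay of derivatives). The Bryant--Salamon structure is $f_1=r(r^2+\mu^2)^{-1/4}$, $f_2=f_3=(r^2+\mu^2)^{1/4}$ in the parameter $r=f_1f_3$, for a constant $\mu\ne0$, with $u=0$ and $\tau_i=0$. A steady soliton is trivial if $\tau=0$ and $u=0$. Exponential volume growth: the volume of geodesic balls of radius $r$ grows exponentially in $r$. *)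

(* Defs.v *)
From HB Require Import structures.
From mathcomp Require Import all_boot all_order all_algebra fingroup perm.
From mathcomp Require Import spectral complex.
From mathcomp Require Import all_classical all_reals all_analysis.

Set Implicit Arguments.
Unset Strict Implicit.
Unset Printing Implicit Defensive.
Import Order.TTheory GRing.Theory Num.Theory numFieldNormedType.Exports.

Local Open Scope classical_set_scope.
Local Open Scope ring_scope.

(* An SU(3)-invariant structure on I x SU(3)/T^2 is a triple f : 'I_3 -> R -> R,
   with f_1, f_2, f_3 written f 0, f 1, f 2.  Intervals are open, with extended
   real endpoints; values outside the interval of definition are irrelevant. *)

Definition smooth_on (R : realType) (a b : \bar R) (g : R -> R) : Prop :=
  forall (n : nat) (t : R), (a < t%:E < b)%E -> derivable (g^`(n))%classic t 1.

Definition sumsq (R : realType) (f : 'I_3 -> R -> R) (t : R) : R :=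
  \sum_(i < 3) f i t ^+ 2.

Definition prodf (R : realType) (f : 'I_3 -> R -> R) (t : R) : R :=
  \prod_(i < 3) f i t.

Definition tau (R : realType) (f : 'I_3 -> R -> R) (i : 'I_3) (t : R) : R :=
  derive1 (fun s : R => f i s ^+ 2) t
  + f i t ^+ 2 / prodf f t * (2 * f i t ^+ 2 - sumsq f t).

Definition norm_tau_sq (R : realType) (f : 'I_3 -> R -> R) (t : R) : R :=
  \sum_(i < 3) tau f i t ^+ 2 / f i t ^+ 4.

Definition scalar_curvature (R : realType) (f : 'I_3 -> R -> R) (t : R) : R :=
  - (1 / 2) * norm_tau_sq f t.

Definition closed_G2 (R : realType) (a b : \bar R) (f : 'I_3 -> R -> R) : Prop :=
  [/\ forall i (t : R), (a < t%:E < b)%E -> 0 < f i t,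
      forall i, smooth_on a b (f i) &
      forall t : R, (a < t%:E < b)%E -> 2 * derive1 (prodf f) t = sumsq f t].

Definition torsion_free (R : realType) (a b : \bar R) (f : 'I_3 -> R -> R) : Prop :=
  closed_G2 a b f /\ forall i (t : R), (a < t%:E < b)%E -> tau f i t = 0.

Definition steady_soliton (R : realType) (a b : \bar R)
    (f : 'I_3 -> R -> R) (u : R -> R) : Prop :=
  [/\ closed_G2 a b f,
      smooth_on a b u,
      forall i (t : R), (a < t%:E < b)%E ->
        derive1 (fun s : R => tau f i s - u s * f i s ^+ 2) t = 0 &
      forall t : R, (a < t%:E < b)%E ->
        \sum_(i < 3) tau f i t = u t * sumsq f t].

Definition trivial_soliton (R : realType) (a b : \bar R)
    (f : 'I_3 -> R -> R) (u : R -> R) : Prop :=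
  forall t : R, (a < t%:E < b)%E -> u t = 0 /\ forall i, tau f i t = 0.

(* The data on 0 < t < e extend smoothly over a zero section CP^2 at t = 0, of
   size b.  (F, U) is the extension of (f, u) to ]-e, e[. *)
Definition smoothly_closing (R : realType) (b : R)
    (f : 'I_3 -> R -> R) (u : R -> R) : Prop :=
  0 < b /\
  exists (e : R) (F : 'I_3 -> R -> R) (U : R -> R),
  [/\ 0 < e,
      (forall i, smooth_on (- e)%:E e%:E (F i)) /\ smooth_on (- e)%:E e%:E U,
      forall t : R, 0 < t < e -> (forall i, F i t = f i t) /\ U t = u t,
      forall t : R, - e < t < e ->
        [/\ F 0 (- t) = - F 0 t, F 1 t ^+ 2 = F 2 (- t) ^+ 2 & U (- t) = - U t] &
      [/\ derive1 (F 0) 0 = 1, F 1 0 = b & F 2 0 = b]].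

(* (f, u) on [0, T[ is the soliton S_{b,c}.  Since tau has a removable
   singularity at t = 0, its initial values are limits. *)
Definition S_soliton (R : realType) (b c : R) (T : \bar R)
    (f : 'I_3 -> R -> R) (u : R -> R) : Prop :=
  [/\ (0 < T)%E /\ steady_soliton 0%E T f u,
      smoothly_closing b f u,
      [/\ f 0 0 = 0, f 1 0 = b, f 2 0 = b & u 0 = 0],
      [/\ tau f 0 t @[t --> 0^'+] --> (0 : R),
          tau f 1 t @[t --> 0^'+] --> c &
          tau f 2 t @[t --> 0^'+] --> - c] &
      forall (T' : \bar R) (f' : 'I_3 -> R -> R) (u' : R -> R),
        (T < T')%E -> steady_soliton 0%E T' f' u' ->
        ~ (forall t : R, (0 < t%:E < T)%E ->
             (forall i, f' i t = f i t) /\ u' t = u t)].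

(* An end of I is complete if it is at infinite distance, or if the structure
   closes up smoothly there over a singular orbit; SU(3)/U(2) = CP^2 is the only
   singular orbit compatible with the principal orbit SU(3)/T^2, and s : 'S_3
   accounts for which f_i vanishes on it. *)
Definition complete_left_end (R : realType) (a : \bar R)
    (f : 'I_3 -> R -> R) (u : R -> R) : Prop :=
  a = -oo%E \/
  exists (a0 : R) (s : 'S_3) (b0 : R),
    a = a0%:E /\
    smoothly_closing b0 (fun i t => f (s i) (a0 + t)) (fun t => u (a0 + t)).

(* The pull-back of (f, u) under t |-> - t, where X = u d/dt. *)
Definition reverse_f (R : realType) (f : 'I_3 -> R -> R) : 'I_3 -> R -> R :=
  fun i t => f i (- t).

Definition reverse_u (R : realType) (u : R -> R) : R -> R := fun t => - u (- t).

Definition complete_soliton (R : realType) (a b : \bar R)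
    (f : 'I_3 -> R -> R) (u : R -> R) : Prop :=
  [/\ (a < b)%E, steady_soliton a b f u, complete_left_end a f u &
      complete_left_end (- b)%E (reverse_f f) (reverse_u u)].

(* Orbits of the Klein four-group.  phi = dt /\ omega + Re Omega is sent to
   - phi by (omega, Omega) |-> (- omega, - conj Omega), which preserves (f, u)
   and the soliton equations, whereas (omega, Omega) |-> (- omega, conj Omega)
   is, up to the diffeomorphism t |-> - t, the reversal of (f, u).  Hence the
   group acts on (f, u) through reversal, recorded here by rev. *)
Definition complete_invariant_soliton (R : realType) (rev : bool) (a b : \bar R)
    (f : 'I_3 -> R -> R) (u : R -> R) : Prop :=
  if rev then complete_soliton (- b)%E (- a)%E (reverse_f f) (reverse_u u)
  else complete_soliton a b f u.

(* (f, u) on ]a, b[ is (f', u') on ]0, +oo[ up to the scaling by m, translation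
   in t, permutation of (f_1, f_2, f_3) and reversal. *)
Definition equivalent_to (R : realType) (rev : bool) (a b : \bar R)
    (f : 'I_3 -> R -> R) (u : R -> R)
    (f' : 'I_3 -> R -> R) (u' : R -> R) : Prop :=
  exists (m t0 : R) (s : 'S_3), 0 < m /\
    forall t : R, let t' := (-1) ^+ rev * (t - t0) / m in
      ((a < t%:E < b)%E <-> 0 < t') /\
      (0 < t' -> (forall i, f (s i) t = m * f' i t') /\
                 u t = (-1) ^+ rev * m^-1 * u' t').

(* In terms of r = f_1 f_3. *)
Definition bryant_salamon (R : realType) (m : R) (a b : \bar R)
    (f : 'I_3 -> R -> R) : Prop :=
  m != 0 /\
  forall t : R, (a < t%:E < b)%E ->
    let r := f 0 t * f 2 t in
    [/\ f 0 t = r * (r ^+ 2 + m ^+ 2) `^ (- (1 / 4)),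
        f 1 t = (r ^+ 2 + m ^+ 2) `^ (1 / 4) &
        f 2 t = (r ^+ 2 + m ^+ 2) `^ (1 / 4)].

Definition cone (R : realType) (k : 'I_3 -> R) : 'I_3 -> R -> R :=
  fun i t => k i * t.

Definition C_tf (R : realType) : 'I_3 -> R -> R := @cone R (fun=> 1 / 2).

Definition asymptotic_to (R : realType) (C : 'I_3 -> R -> R) (nu : R)
    (f : 'I_3 -> R -> R) : Prop :=
  exists t0 : R, forall (i : 'I_3) (n : nat), exists K : R,
    \forall t \near +oo,
      `| derive1n n (fun s : R => f i (s + t0) - C i s) t |
        <= K * t `^ (1 + nu - n%:R).

Definition grows_exponentially (R : realType) (h : R -> \bar R) : Prop :=
  exists l K1 K2 : R, [/\ 0 < l, 0 < K1, 0 < K2 &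
    \forall t \near +oo,
      ((K1 * expR (l * t))%:E <= h t <= (K2 * expR (l * t))%:E)%E].

(* Geodesic balls of g = dt^2 + sum_i f_i^2 g_i on the manifold obtained from
   [0, +oo[ x SU(3)/T^2 by collapsing the directions in which f vanishes at
   t = 0.  Points and curves are lifted to [0, +oo[ x SU(3): g pulls back to a
   degenerate metric, moving along the fibres costs nothing, and the distance
   between two points is that of their images. *)

HB.instance Definition _ (K : rcfType) := isPointed.Build K[i]%C 0.

Definition SU3 (R : realType) : set 'M[R[i]%C]_3 :=
  [set A | (A \is unitarymx) /\ \det A = 1].

Definition C1 (R : realType) (h : R -> R) : Prop :=
  (forall s : R, derivable h s 1) /\ continuous (derive1 h).

Definition C1_mx (R : realType) (A : R -> 'M[R[i]%C]_3) : Prop :=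
  forall i j, C1 (fun s : R => complex.Re (A s i j)) /\
              C1 (fun s : R => complex.Im (A s i j)).

Definition derive1_mx (R : realType) (A : R -> 'M[R[i]%C]_3) (s : R) :
    'M[R[i]%C]_3 :=
  \matrix_(i, j) Complex (derive1 (fun x : R => complex.Re (A x i j)) s)
                         (derive1 (fun x : R => complex.Im (A x i j)) s).

(* The root spaces are the matrix entries (i+1, i+2), with i in Z/3.  The 2-sphere
   SU(2)/U(1) has curvature 4 for the norm |z| on matrices (0, z; - conj z, 0),
   whence the factor 4. *)
Definition speed (R : realType) (f : 'I_3 -> R -> R)
    (t : R -> R) (A : R -> 'M[R[i]%C]_3) (s : R) : R :=
  let w := invmx (A s) *m derive1_mx A s in
  Num.sqrt (derive1 t s ^+ 2 +
    \sum_(i < 3) f i (t s) ^+ 2 *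
      (4 * (complex.Re (w (i + 1) (i + 2)) ^+ 2 +
            complex.Im (w (i + 1) (i + 2)) ^+ 2))).

Definition curve_length (R : realType) (f : 'I_3 -> R -> R)
    (t : R -> R) (A : R -> 'M[R[i]%C]_3) : R :=
  Rintegral (@lebesgue_measure R) `[0, 1] (speed f t A).

(* Points joined by a piecewise C^1 curve of length l. *)
Inductive joined (R : realType) (f : 'I_3 -> R -> R) :
    R * 'M[R[i]%C]_3 -> R * 'M[R[i]%C]_3 -> R -> Prop :=
| joined_C1 (t : R -> R) (A : R -> 'M[R[i]%C]_3) :
    C1 t -> C1_mx A ->
    (forall s : R, 0 <= s <= 1 -> 0 <= t s /\ SU3 (A s)) ->
    joined f (t 0, A 0) (t 1, A 1) (curve_length f t A)
| joined_cat p q r l l' :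
    joined f p q l -> joined f q r l' -> joined f p r (l + l').

Definition geodesic_ball (R : realType) (f : 'I_3 -> R -> R)
    (p : R * 'M[R[i]%C]_3) (r : R) : set (R * 'M[R[i]%C]_3) :=
  [set q | exists2 l : R, joined f p q l & l < r].

Definition coordinate_halfspaces (R : realType) : set (set 'M[R[i]%C]_3) :=
  [set H | exists (i j : 'I_3) (x : R),
     H = [set A : 'M[R[i]%C]_3 | complex.Re (A i j) < x] \/
     H = [set A : 'M[R[i]%C]_3 | complex.Im (A i j) < x]].

Definition borel_mx (R : realType) := g_sigma_algebraType (@coordinate_halfspaces R).

(* The Haar probability measure of SU(3), as a Borel measure on all matrices. *)
Definition haar_SU3 (R : realType) (nu : probability (borel_mx R) R) : Prop :=
  nu (@SU3 R) = 1%E /\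
  forall (A : 'M[R[i]%C]_3) (B : set (borel_mx R)), SU3 A -> measurable B ->
    nu [set M | B (A *m M : 'M[R[i]%C]_3)] = nu B.

(* (4 pi)^3 / 2 is the volume of SU(3)/T^2 for g_1 + g_2 + g_3: the fibration
   over CP^2 has fibre a unit 2-sphere, of area 4 pi, and base of volume 8 pi^2. *)
Definition riemannian_volume (R : realType) (nu : probability (borel_mx R) R)
    (f : 'I_3 -> R -> R) (B : set (R * 'M[R[i]%C]_3)) : \bar R :=
  (((4 * pi) ^+ 3 / 2)%:E *
   \int[@lebesgue_measure R]_(t in `[0%R, +oo[)
     ((prodf f t ^+ 2)%:E * nu [set A | B (t, A)]))%E.

Definition exponential_volume_growth (R : realType) (f : 'I_3 -> R -> R) : Prop :=
  forall nu : probability (borel_mx R) R, haar_SU3 nu ->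
  forall (t0 : R) (A0 : 'M[R[i]%C]_3), 0 <= t0 -> SU3 A0 ->
    grows_exponentially
      (fun r => riemannian_volume nu f (geodesic_ball f (t0, A0) r)).

(* Main.v *)
(** Integrating the soliton equations once gives [tau_i = u f_i^2 + c_i] with
    constants [c_i] of sum 0, hence [u = - (1/3) sum_i c_i / f_i^2] and a first
    order system for [f].  For S_{1,c} put [k = |c| / 3], [A = f_2 f_3],
    [y = (f_2^2 - f_3^2) / (2 A)], [z = (f_2^2 + f_3^2) / (2 A)] and [r = A / z]
    (after exchanging [f_2] and [f_3] if [c < 0]), so that [r] tends to 1 at the
    zero section and
      [z f_1 r' = (f_1 - 2 k y)^2 + 2 (r - 2 k^2) y^2].
    If [2 k^2 <= 1], i.e. [c^2 <= 9/2], then [r >= 1] persists and keeps the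
    solution from degenerating in finite time.  If [2 k^2 > 1], [r] decreases to
    0 in finite time.  If [2 k^2 = 1], the relations [f_1 = 2 k y] and [A = z]
    persist and the solution is explicit.  If [2 k^2 < 1], [r] grows
    quadratically, [y / z] tends to 0 and [(f_1 / z)^2 - r] and [(y / z)^2 r] stay
    bounded, whence [f_i = t / 2 + O(1)], and differentiating the equations bounds
    all derivatives.

    For an arbitrary complete soliton, [(f_1 f_2 f_3)^(1/3)] is increasing with
    derivative bounded below, so that the left end is a singular orbit and the
    right end is infinite.

    For the volume growth, curves of length less than [l] change [t] by less than
    [l], whereas any two points of a level are joined by a curve of bounded
    length in this level: up to bounded errors, the ball of radius [l] about a
    point consists of the levels [t < l]. *)

Require Import Defs.
From mathcomp Require Import all_boot all_order all_algebra fingroup perm.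
From mathcomp Require Import spectral complex.
From mathcomp Require Import all_classical all_reals all_analysis.
From mathcomp Require Import measurable_realfun.
From mathcomp Require Import ring lra.
Set Implicit Arguments.
Unset Strict Implicit.
Unset Printing Implicit Defensive.
Import Order.TTheory GRing.Theory Num.Theory numFieldNormedType.Exports.
Local Open Scope classical_set_scope.
Local Open Scope ring_scope.

(** * Calculus *)

(* The cost of [lra] and [nra] grows with the context, so they are first run on
   few hypotheses: those comparing points, without any function value, when the
   goal is of this kind, and otherwise the most recent ones. *)
Ltac applied_in P := match goal with g : _ -> _ |- _ => match P with context [g] => idtac end end.
Ltac revert_points n := lazymatch n with
  | O => idtac
  | S ?m => try match goal with
    | H : ?P |- _ => lazymatch P with
      | is_true (Order.le _ _) => idtac
      | is_true (Order.lt _ _) => idtac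
      | is_true (andb _ _) => idtac
      end; tryif applied_in P then fail else (revert H; revert_points m)
    end
  end.
Ltac revert_real n := lazymatch n with
  | O => idtac
  | S ?m => try match goal with
    | H : is_true (Order.le _ _) |- _ => revert H; revert_real m
    | H : is_true (Order.lt _ _) |- _ => revert H; revert_real m
    | H : is_true (andb _ _) |- _ => revert H; revert_real m
    | H : @eq ?T _ _ |- _ => lazymatch T with complex _ => fail | _ => revert H; revert_real m end
    end
  end.
Ltac points_lra n := match goal with |- ?G =>
  tryif applied_in G then fail else solve [revert_points n; clear; lra] end.
Ltac rlra := first [points_lra 3%N | points_lra 100%N | solve [revert_real 3%N; clear; lra]
  | solve [revert_real 100%N; clear; lra] | lra].
Ltac rnra := first [solve [revert_real 3%N; clear; nra] | solve [revert_real 100%N; clear; nra] | nra].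

(** The equations are singular at [t = 0], so no uniqueness theorem can start there. All that is
    known of S_{1,c} at the zero section are one-sided limits, and each property is carried to later
    times from arbitrarily small positive ones by a barrier or a Gronwall estimate. The parameter
    enters through a single limit, that of [y / f_1], which is [k].

    The function [r] is the harmonic mean of [f_2^2] and [f_3^2], hence comparable with the square
    of the smaller of the two. A positive lower bound on [r] therefore bounds all variables on
    bounded intervals, and by continuation and maximality a finite end time is possible only if [r]
    is not bounded below.

    For finite-time collapse the sign of [r'] is not enough: [- r' z / f_1] has to stay above a
    positive constant and [f_1^2 / (A z)] away from 0. Together they make the square root of [r]
    decrease at a definite rate. *)

Section Derivatives.
Context {R : realType}.
Implicit Types (f g : R -> R) (t a b : R).

Definition is_der f (t a : R) : Prop := derivable f t 1 /\ (f^`())%classic t = a.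

Lemma is_derP f t a : is_der f t a <-> is_derive t 1 f a.
Proof. by split=> -[h]; rewrite ?derive1E => h2; split=> //; rewrite derive1E. Qed.

Lemma der_derivable f t a : is_der f t a -> derivable f t 1.
Proof. by case. Qed.

Lemma der_val f t a : is_der f t a -> (f^`())%classic t = a.
Proof. by case. Qed.

Lemma derivable_der f t : derivable f t 1 -> is_der f t ((f^`())%classic t).
Proof. by []. Qed.

Lemma der_eq f t a b : is_der f t a -> a = b -> is_der f t b.
Proof. by move=> h <-. Qed.

Lemma der_cst (c t : R) : is_der (fun=> c) t 0.
Proof. by apply/is_derP; exact: is_derive_cst. Qed.

Lemma der_id t : is_der (fun x : R => x) t 1.
Proof. by apply/is_derP; exact: is_derive_id. Qed.

Lemma derD f g t a b : is_der f t a -> is_der g t b ->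
  is_der (fun x => f x + g x) t (a + b).
Proof.
by move=> /is_derP h1 /is_derP h2; apply/is_derP; exact (@is_deriveD _ _ _ f g t 1 a b h1 h2).
Qed.

Lemma derN f t a : is_der f t a -> is_der (fun x => - f x) t (- a).
Proof.
by move=> /is_derP h; apply/is_derP; exact (@is_deriveN _ _ _ f t 1 a h).
Qed.

Lemma derM f g t a b : is_der f t a -> is_der g t b ->
  is_der (fun x => f x * g x) t (a * g t + f t * b).
Proof.
move=> /is_derP h1 /is_derP h2; apply/is_derP; have h := @is_deriveM _ _ f g t 1 a b h1 h2.
by apply: (is_derive_eq h); rewrite /GRing.scale /= addrC; congr (_ + _); rewrite mulrC.
Qed.

Lemma derX f n t a : is_der f t a ->
  is_der (fun x => f x ^+ n) t (n%:R * f t ^+ n.-1 * a).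
Proof.
move=> /is_derP h; apply/is_derP; rewrite (_ : (fun x => _) = f ^+ n); last first.
  by apply/funext => x; rewrite exprfctE.
by have h' := @is_deriveX _ _ f n t 1 a h; apply: (is_derive_eq h').
Qed.

Lemma derV f t a : f t != 0 -> is_der f t a ->
  is_der (fun x => (f x)^-1) t (- a / f t ^+ 2).
Proof.
move=> f0 /is_derP h; apply/is_derP; have h' := @is_deriveV _ f t a 1 f0 h.
by apply: (is_derive_eq h'); rewrite /GRing.scale /= !mulNr mulrC.
Qed.

Lemma der_comp f g t a b : is_der f (g t) a -> is_der g t b ->
  is_der (fun x => f (g x)) t (a * b).
Proof.
by move=> /is_derP h1 /is_derP h2; apply/is_derP; exact: (@is_derive1_comp _ f g t a b).
Qed.

Lemma der_sqrt f t a : 0 < f t -> is_der f t a ->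
  is_der (fun x => Num.sqrt (f x)) t (a / (2 * Num.sqrt (f t))).
Proof.
move=> f0 h; rewrite mulrC.
apply: (@der_comp (@Num.sqrt R) f t ((2 * Num.sqrt (f t))^-1) a) => //.
by apply/is_derP; exact: is_derive1_sqrt.
Qed.

Lemma der_expR f t a : is_der f t a ->
  is_der (fun x => expR (f x)) t (a * expR (f t)).
Proof.
move=> h; rewrite mulrC; apply: (@der_comp expR f t (expR (f t)) a) => //.
by apply/is_derP; exact: is_derive_expR.
Qed.

Lemma der_cont f t a : is_der f t a -> {for t, continuous f}.
Proof.
by move=> /der_derivable h; apply: differentiable_continuous; apply/derivable1_diffP.
Qed.

Lemma der_near f g t a : (\forall x \near t, f x = g x) ->
  is_der f t a -> is_der g t a.
Proof.
by move=> h /is_derP h'; apply/is_derP; exact (near_eq_is_derive h h').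
Qed.

End Derivatives.

Ltac der := repeat (match goal with
  | H : is_der ?f ?t _ |- is_der ?f ?t _ => exact H
  | H : is_der ?f ?t _ |- is_der (fun x => ?f x) ?t _ => exact H
  | |- is_der (fun=> ?c) _ _ => exact: der_cst
  | |- is_der (fun x => x) _ _ => exact: der_id
  | |- is_der id _ _ => exact: der_id
  | |- is_der (GRing.mul ?c) ?t ?a => change (is_der (fun x => c * x) t a)
  | |- is_der (fun x => _ + _) _ _ => eapply derD
  | |- is_der (fun x => _ * _) _ _ => eapply derM
  | |- is_der (fun x => - _) _ _ => eapply derN
  | |- is_der (fun x => _ ^+ _) _ _ => eapply derX
  | |- is_der (fun x => (_)^-1) _ _ => eapply derV
  | |- is_der (fun x => Num.sqrt _) _ _ => eapply der_sqrt
  | |- is_der (fun x => expR _) _ _ => eapply der_expR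
  end).
Ltac der_eq := eapply der_eq; [der|simpl].

Ltac pos := first [assumption | apply: ltW; assumption | lazymatch goal with
  | |- is_true (0 <= _ * _) => apply: mulr_ge0; pos
  | |- is_true (0 < _ * _) => apply: mulr_gt0; pos
  | |- is_true (0 < _ ^-1) => rewrite invr_gt0; pos
  | |- is_true (0 <= _ ^-1) => rewrite invr_ge0; pos
  | |- is_true (0 <= _ ^+ 2) => exact: sqr_ge0
  | |- is_true (0 <= _ ^+ _) => apply: exprn_ge0; pos
  | |- is_true (0 < _ ^+ _) => apply: exprn_gt0; pos
  | |- is_true (0 <= Num.sqrt _) => exact: sqrtr_ge0
  | |- is_true (0 < expR _) => exact: expR_gt0
  | |- is_true (0 <= expR _) => exact: expR_ge0
  | |- is_true (0 <= _ + _) => first [solve [assumption | by apply: ltW | rlra] | apply: addr_ge0; pos]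
  | |- is_true (0 < _ + _) => first [solve [assumption | rlra] | apply: addr_gt0; pos]
  | _ => solve [done | rlra]
  end].

(** * Monotonicity, barriers and Gronwall estimates *)

Section Monotonicity.
Context {R : realType}.
Implicit Types (f g : R -> R) (t a b : R).

Lemma ge0_der_le f (df : R -> R) a b : a <= b ->
  (forall t, a <= t <= b -> is_der f t (df t)) ->
  (forall t, a <= t <= b -> 0 <= df t) -> f a <= f b.
Proof.
rewrite le_eqVlt => /orP[/eqP -> //|ab] h1 h2.
apply: (@ger0_derive1_le_cc _ f a b) => //.
- by move=> x xab; apply: der_derivable; apply: h1; have := xab; rewrite in_itv /= => /andP[/ltW -> /ltW ->].
- move=> x xab; rewrite (der_val (h1 x _)); last first.
    by have := xab; rewrite in_itv /= => /andP[/ltW -> /ltW ->].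
  by apply: h2; have := xab; rewrite in_itv /= => /andP[/ltW -> /ltW ->].
- apply: derivable_within_continuous => x xab; apply: der_derivable; apply: h1.
  by move: xab; rewrite in_itv.
- by rewrite in_itv /= lexx ltW.
- by rewrite in_itv /= lexx ltW.
- exact: ltW.
Qed.

Lemma le0_der_ge f (df : R -> R) a b : a <= b ->
  (forall t, a <= t <= b -> is_der f t (df t)) ->
  (forall t, a <= t <= b -> df t <= 0) -> f b <= f a.
Proof.
move=> ab h1 h2; rewrite -lerN2.
apply: (@ge0_der_le (fun x => - f x) (fun x => - df x)) => // t tab.
  by apply: derN; apply: h1.
by rewrite oppr_ge0 h2.
Qed.

Lemma der0_eq f a b : a <= b ->
  (forall t, a <= t <= b -> is_der f t 0) -> f a = f b.
Proof.
move=> ab h; apply/eqP; rewrite eq_le (@ge0_der_le f (fun=> 0)) //=.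
by rewrite (@le0_der_ge f (fun=> 0)).
Qed.

(** Continuous induction on the supremum of the times up to which [f] has stayed positive. The
    nonvanishing hypothesis may assume positivity at all earlier times, so it has to be checked at a
    first zero only. *)
Lemma pos_preserved f (df : R -> R) a b : a <= b ->
  (forall t, a <= t <= b -> is_der f t (df t)) -> 0 < f a ->
  (forall t, a < t <= b -> (forall s, a <= s < t -> 0 < f s) -> f t != 0) ->
  forall t, a <= t <= b -> 0 < f t.
Proof.
move=> ab hd fa hc t /andP[at_ tb].
rewrite ltNge; apply/negP => ft.
set E := [set x | a <= x <= t /\ forall s, a <= s <= x -> 0 < f s].
have Ea : E a.
  by split; [rewrite lexx|move=> s /andP[h1 h2]; have -> : s = a by rlra].
have supE : has_sup E by split; [exists a|exists t => x [/andP[_ ?] _]].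
pose m := sup E.
have am : a <= m by apply: ub_le_sup => //; case: supE.
have mt : m <= t by apply: ge_sup; [exists a|move=> x [/andP[]]].
have Pm0 : forall s, a <= s < m -> 0 < f s.
  move=> s /andP[as_ sm].
  have ms : 0 < m - s by rewrite subr_gt0.
  have [e [_ Ee] se] := sup_adherent ms supE.
  by apply: Ee; rewrite as_ /=; apply: ltW; move: se; rewrite -/m; rlra.
have cm : {for m, continuous f} by apply: (der_cont (hd m _)); rewrite am (le_trans mt tb).
have fm0 : 0 <= f m.
  rewrite leNgt; apply/negP => fm.
  have am' : a < m by rewrite lt_neqAle am andbT; apply/eqP => e; move: fm; rewrite -e ltNge ltW.
  have /nbhs_ballP [e /= e0 He] := cm [set x | x < 0] (open_nbhs_nbhs (conj (@open_lt _ (0 : R)) fm)).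
  have := He (Num.max a (m - e / 2)); rewrite /ball /=.
  have h : a <= Num.max a (m - e/2) < m by rewrite le_max lexx gt_max am' /=; rlra.
  move=> h'; have := Pm0 _ h; rewrite ltNge => /negP; apply; apply/ltW/h'.
  have h2 : m - e/2 <= Num.max a (m - e/2) by rewrite le_max lexx orbT.
  by rewrite ger0_norm; rlra.
have fm : 0 < f m.
  rewrite lt_neqAle fm0 andbT eq_sym.
  move: am; rewrite le_eqVlt => /orP[/eqP <-|am]; first by rewrite gt_eqF.
  by apply: hc; [rewrite am (le_trans mt tb)|].
have mt' : m < t.
  by rewrite lt_neqAle mt andbT; apply/eqP => e; move: fm; rewrite e ltNge ft.
have /nbhs_ballP [e /= e0 He] := cm [set x | 0 < x] (open_nbhs_nbhs (conj (@open_gt _ (0 : R)) fm)).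
pose x := Num.min t (m + e / 2).
have xm : m < x <= t by rewrite /x lt_min mt' ge_min lexx /= andbT; rlra.
have xe : x <= m + e/2 by rewrite /x ge_min lexx orbT.
have : E x.
  split; first by move: xm => /andP[? ?]; apply/andP; split; rlra.
  move=> s /andP[s1 s2]; have [sm|sm] := ltP s m; first by apply: Pm0; rewrite s1.
  by apply: He; rewrite /ball /= distrC ger0_norm; rlra.
have hub : has_ubound E by case: supE.
by move/(ub_le_sup hub); rewrite -/m; move: xm => /andP[? _]; rlra.
Qed.

Lemma der_pos_left f t d a : a < t -> is_der f t d -> 0 < d ->
  exists2 s, a <= s < t & f s < f t.
Proof.
move=> at_ [h1]; rewrite derive1E => h2 d0; move: h1; rewrite /derivable => /cvg_ex [l hl].
have ld : l = d by rewrite -h2; apply/esym/cvg_lim.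
rewrite ld in hl.
have /nbhs_ballP [e /= e0 He] := hl [set x | 0 < x] (open_nbhs_nbhs (conj (@open_gt _ (0 : R)) d0)).
pose w := Num.min (e / 2) (t - a).
have w0 : 0 < w by rewrite lt_min subr_gt0 at_ andbT; rlra.
have we : w <= e / 2 by rewrite ge_min lexx.
have wa : w <= t - a by rewrite ge_min lexx orbT.
exists (t - w); first by apply/andP; split; rlra.
have := He (- w); rewrite /ball /= opprK add0r gtr0_norm //.
move=> /(_ ltac:(rlra)) /(_ ltac:(by rewrite oppr_eq0 gt_eqF)).
rewrite /GRing.scale /= mulr1 (addrC (- w)) => h.
have : (f (t - w) - f t) * (- w)^-1 > 0 by rewrite mulrC.
by rewrite invrN mulrN oppr_gt0 pmulr_llt0 ?invr_gt0 // subr_lt0.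
Qed.

(** At a first zero [f] comes down from positive values, so its derivative there cannot be positive,
    whereas the hypothesis says that it is. *)
Lemma pos_barrier f (df : R -> R) a b :
  (forall t, a <= t <= b -> is_der f t (df t)) -> 0 < f a ->
  (forall t, a < t <= b -> (forall s, a <= s < t -> 0 < f s) -> f t = 0 -> 0 < df t) ->
  forall t, a <= t <= b -> 0 < f t.
Proof.
move=> hd fa hc t tab; have ab : a <= b by rlra.
apply: (pos_preserved ab hd fa) => // {}t {}tab hs; apply/eqP => ft.
have at_ : a < t by rlra.
have tab' : a <= t <= b by rlra.
have [s /hs s0 st] := der_pos_left at_ (hd t tab') (hc t tab hs ft).
by move: st; rewrite ft; rlra.
Qed.

Lemma barrier_ge f (df : R -> R) (m : R) a b : a <= b ->
  (forall t, a <= t <= b -> is_der f t (df t)) -> m <= f a ->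
  (forall t, a <= t <= b -> f t < m -> 0 <= df t) -> m <= f b.
Proof.
move=> ab hd ma hm; apply/ler_addgt0Pr => e e0.
have [C C0 Cb] : exists2 C, 0 < C & C * (b - a + 1) = e.
  by exists (e / (b - a + 1)); [rewrite divr_gt0 //|rewrite divfK // gt_eqF //]; rlra.
(* the tilted line [m - C (1 + t - a)] can only be crossed upwards *)
suff : 0 < f b - m + C * (b - a + 1) by rewrite Cb; rlra.
apply: (@pos_barrier (fun t => f t - m + C * (t - a + 1)) (fun t => df t + C) a b).
- by move=> t /hd h; der_eq; ring.
- by rewrite subrr add0r mulr1; rlra.
- move=> t tab hs h0; have Ct : 0 < C * (t - a + 1) by rewrite mulr_gt0 //; rlra.
  by have := hm t; rlra.
- by rewrite ab lexx.
Qed.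

Lemma barrier_le f (df : R -> R) (m : R) a b : a <= b ->
  (forall t, a <= t <= b -> is_der f t (df t)) -> f a <= m ->
  (forall t, a <= t <= b -> m < f t -> df t <= 0) -> f b <= m.
Proof.
move=> ab hd ma hm; rewrite -lerN2.
apply: (@barrier_ge (fun t => - f t) (fun t => - df t) _ a b) => //.
- by move=> t /hd h; apply: derN.
- by rewrite lerN2.
- by move=> t tab; rewrite ltrN2 oppr_ge0; exact: hm.
Qed.

Lemma expR_affine_der (C a t : R) :
  is_der (fun x : R => expR (C * (x - a))) t (C * expR (C * (t - a))).
Proof.
by eapply der_eq; [apply: der_expR; der|]; rewrite /=; ring.
Qed.

Lemma gronwall f (df : R -> R) (C : R) a b : a <= b ->
  (forall t, a <= t <= b -> is_der f t (df t)) ->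
  (forall t, a <= t <= b -> df t <= C * f t) ->
  f b <= f a * expR (C * (b - a)).
Proof.
move=> ab hd hC.
have hexp t := @expR_affine_der (- C) a t.
have : f b * expR (- C * (b - a)) <= f a * expR (- C * (a - a)).
  apply: (@le0_der_ge (fun t => f t * expR (- C * (t - a)))
     (fun t => df t * expR (- C * (t - a)) + f t * (- C * expR (- C * (t - a))))) => // t tab.
    by have h := hd t tab; apply: derM.
  have := hC t tab; have := expR_gt0 (- C * (t - a)) => e0 h.
  have -> : df t * expR (- C * (t - a)) + f t * (- C * expR (- C * (t - a))) =
    (df t - C * f t) * expR (- C * (t - a)) by ring.
  by rewrite pmulr_lle0 // subr_le0.
rewrite subrr mulr0 expR0 mulr1 mulNr expRN ler_pdivrMr ?expR_gt0 //.
Qed.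

(** The weight [expR (- |C| (t - a))] makes negative values of [f] nondecreasing, since there
    [df >= C f >= |C| f]. If [f b < 0], a start where [f] is at least half the weighted value at [b]
    contradicts this. Nothing is asked of [f] at [a], which is the singular orbit in the
    application. *)
Lemma ge0_from_limit f (df : R -> R) (C : R) a b : a < b ->
  (forall t, a < t <= b -> is_der f t (df t)) ->
  (forall t, a < t <= b -> f t < 0 -> C * f t <= df t) ->
  (forall e, 0 < e -> exists2 t, a < t < b & - e <= f t) -> 0 <= f b.
Proof.
move=> ab hd hC hl; rewrite leNgt; apply/negP => fb.
pose K := `|C|.
pose g t := f t * expR (- K * (t - a)).
have g_lt0 t : (g t < 0) = (f t < 0) by rewrite /g pmulr_llt0 ?expR_gt0.
have gb : g b < 0 by rewrite g_lt0.
have [|t0 t0ab ft0] := hl (- (g b / 2)); first by rlra.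
have t0b : t0 <= b by rlra.
suff : g b / 2 <= g b by rlra.
apply: (@barrier_ge g (fun t => df t * expR (- K * (t - a)) + f t * (- K * expR (- K * (t - a)))) _ t0) => //.
- move=> t tb; apply: derM; last exact: expR_affine_der.
  by apply: hd; rlra.
- have [f0|f0] := lerP 0 (f t0); first by apply: (@le_trans _ _ 0); [rlra|rewrite /g mulr_ge0 // expR_ge0].
  apply: (@le_trans _ _ (f t0)); first by rlra.
  rewrite /g ler_niMr //; first exact: ltW.
  by rewrite -expR0 ler_expR mulNr oppr_le0 mulr_ge0 ?normr_ge0 // subr_ge0 ltW //; rlra.
- move=> t tb gt; have ft : f t < 0 by rewrite -g_lt0; rlra.
  have := hC t _ ft => /(_ ltac:(rlra)) h.
  rewrite [X in _ <= X](_ : _ = (df t - K * f t) * expR (- K * (t - a))); last by ring.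
  rewrite mulr_ge0 ?expR_ge0 // subr_ge0; apply: le_trans h.
  by rewrite ler_nM2r // /K ler_norm.
Qed.

End Monotonicity.

(** * Smooth functions on open intervals *)

Section Smoothness.
Context {R : realType}.
Implicit Types (f g : R -> R) (D : set R) (n : nat).

(** A form of [smooth_on] recursive in the order: on an open set it is invariant under equality on
    this set, and its closure under the field operations is an induction on [n]. *)
Fixpoint Cn D n g : Prop :=
  if n is n'.+1 then (forall t, D t -> derivable g t 1) /\ Cn D n' (g^`())%classic
  else True.

Lemma Cn_eq D n f g : open D -> (forall t, D t -> f t = g t) -> Cn D n f -> Cn D n g.
Proof.
move=> oD; elim: n f g => //= n IH f g fg [h1 h2].
have hn t : D t -> \forall x \near t, f x = g x.
  by move=> Dt; apply: filterS (open_nbhs_nbhs (conj oD Dt)) => x /fg.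
have hd t : D t -> is_der g t ((f^`())%classic t).
  by move=> Dt; apply: (der_near (hn t Dt)); apply/derivable_der/h1.
split; first by move=> t /hd /der_derivable.
by apply: (IH _ _ _ h2) => t /hd /der_val.
Qed.

Lemma Cn_der D n g dg : open D -> (forall t, D t -> is_der g t (dg t)) ->
  Cn D n dg -> Cn D n.+1 g.
Proof.
move=> oD h1 h2; split; first by move=> t /h1 /der_derivable.
by apply: Cn_eq h2 => // t /h1 /der_val.
Qed.

Lemma CnW D n g : open D -> Cn D n.+1 g -> Cn D n g.
Proof.
move=> oD; elim: n g => // n IH g [h1 h2]; split => //.
exact: IH.
Qed.

Lemma Cn_cst D n (c : R) : open D -> Cn D n (fun=> c).
Proof.
move=> oD; elim: n c => //= n IH c; apply: (@Cn_der _ _ _ (fun=> 0)) => //.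
by move=> t _; apply: der_cst.
Qed.

Lemma Cn_id D n : open D -> Cn D n (fun x => x).
Proof.
move=> oD; case: n => // n; apply: (@Cn_der _ _ _ (fun=> 1)) => //.
  by move=> t _; apply: der_id.
exact: Cn_cst.
Qed.

Lemma CnD D n f g : open D -> Cn D n f -> Cn D n g -> Cn D n (fun x => f x + g x).
Proof.
move=> oD; elim: n f g => // n IH f g [f1 f2] [g1 g2].
apply: (@Cn_der _ _ _ (fun x => (f^`())%classic x + (g^`())%classic x)) => //.
  by move=> t Dt; apply: derD; apply: derivable_der; [exact: f1|exact: g1].
exact: IH.
Qed.

Lemma CnM D n f g : open D -> Cn D n f -> Cn D n g -> Cn D n (fun x => f x * g x).
Proof.
move=> oD; elim: n f g => // n IH f g hf hg.
have [[f1 f2] [g1 g2]] := (hf, hg).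
apply: (@Cn_der _ _ _ (fun x => (f^`())%classic x * g x + f x * (g^`())%classic x)) => //.
  by move=> t Dt; apply: derM; apply: derivable_der; [exact: f1|exact: g1].
by apply: CnD => //; apply: IH => //; apply: CnW.
Qed.

Lemma CnN D n f : open D -> Cn D n f -> Cn D n (fun x => - f x).
Proof.
move=> oD hf; apply: (@Cn_eq _ _ (fun x => (-1) * f x)) => //.
  by move=> t _; rewrite mulN1r.
by apply: CnM => //; apply: Cn_cst.
Qed.

Lemma CnX D n f k : open D -> Cn D n f -> Cn D n (fun x => f x ^+ k).
Proof.
move=> oD hf; elim: k => [|k IH]; first exact: Cn_cst.
apply: (@Cn_eq _ _ (fun x => f x * f x ^+ k)) => //; last exact: CnM.
by move=> t _; rewrite exprS.
Qed.

Lemma CnV D n f : open D -> (forall t, D t -> f t != 0) -> Cn D n f ->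
  Cn D n (fun x => (f x)^-1).
Proof.
move=> oD f0; elim: n f f0 => // n IH f f0 hf; have [h1 h2] := hf.
apply: (@Cn_der _ _ _ (fun x => - (f^`())%classic x * ((f x)^-1 * (f x)^-1))) => //.
  move=> t Dt; apply: der_eq; first by apply: derV; [exact: f0|apply/derivable_der/h1].
  by rewrite -invfM expr2.
apply: CnM => //; first exact: CnN.
by apply: CnM => //; apply: IH => //; apply: CnW.
Qed.

Definition oitv (a b : \bar R) : set R := [set t | (a < t%:E < b)%E].

Lemma open_oitv a b : open (oitv a b).
Proof.
have -> : oitv a b = [set t | (a < t%:E)%E] `&` [set t | (t%:E < b)%E].
  by apply/seteqP; split => t /=; [move=> /andP|move=> [? ?]; apply/andP].
by apply: openI; [exact: open_ereal_gt|exact: open_ereal_lt].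
Qed.

Lemma smooth_onP a b g : smooth_on a b g <-> forall n, Cn (oitv a b) n g.
Proof.
have key n h : (forall k t, (k < n)%N -> oitv a b t -> derivable (h^`(k))%classic t 1) <->
    Cn (oitv a b) n h.
  elim: n h => [|n IH] h; first by split.
  split=> [H|[H1 /IH H2] [|k] t kn Dt].
  - split; first by move=> t; exact: (H 0%N).
    by apply/IH => k t kn Dt; rewrite -derive1Sn; apply: H.
  - exact: H1.
  - by rewrite derive1Sn; apply: H2.
split=> [H n|H n t tab]; first by apply/key => k t _; exact: H.
by have /key := H n.+1; apply.
Qed.

Lemma smooth_on_derivable a b g t : smooth_on a b g -> oitv a b t -> is_der g t ((g^`())%classic t).
Proof. by move=> h /(h 0%N). Qed.

Lemma smooth_on_derivable2 a b g t : smooth_on a b g -> oitv a b t ->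
  is_der (g^`())%classic t ((g^`(2))%classic t).
Proof. by move=> h /(h 1%N) h1; apply: derivable_der. Qed.

Lemma oitv_between a b s t x : oitv a b s -> oitv a b t -> s <= x <= t -> oitv a b x.
Proof.
move=> /andP[h1 _] /andP[_ h2] /andP[h3 h4]; apply/andP; split.
  by apply: lt_le_trans h1 _; rewrite lee_fin.
by apply: le_lt_trans h2; rewrite lee_fin.
Qed.

Lemma der0_const a b g : (forall t, oitv a b t -> is_der g t 0) ->
  forall s t, oitv a b s -> oitv a b t -> g s = g t.
Proof.
move=> h; suff H s t : s <= t -> oitv a b s -> oitv a b t -> g s = g t.
  by move=> s t hs ht; have [st|/ltW st] := leP s t; [|apply/esym]; exact: H.
move=> st hs ht; apply: der0_eq => // x xst; apply: h.
exact: oitv_between xst.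
Qed.

Lemma near_itv (a b t : R) : a < t < b -> \forall s \near t, a < s < b.
Proof.
move=> /andP[h1 h2]; near=> s; apply/andP; split; near: s.
  by exact: (open_nbhs_nbhs (conj (@open_gt _ a) h1)).
by exact: (open_nbhs_nbhs (conj (@open_lt _ b) h2)).
Unshelve. all: by end_near. Qed.

Lemma oitv_near a b t : oitv a b t -> \forall s \near t, oitv a b s.
Proof. by move=> h; apply: open_nbhs_nbhs; split => //; exact: open_oitv. Qed.

End Smoothness.

(** * The soliton equations as an ordinary differential equation *)

Section SolitonODE.
Context {R : realType}.

Lemma I3P (P : 'I_3 -> Prop) : P 0 -> P 1 -> P 2 -> forall i, P i.
Proof.
move=> h0 h1 h2 [[|[|[|//]]] hi].
- by have -> : Ordinal hi = 0 by apply/val_inj.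
- by have -> : Ordinal hi = 1 by apply/val_inj.
- by have -> : Ordinal hi = 2 by apply/val_inj.
Qed.

Lemma sum3 (h : 'I_3 -> R) : \sum_(i < 3) h i = h 0 + h 1 + h 2.
Proof.
rewrite !big_ord_recl big_ord0 addr0 addrA.
by congr (_ + h _ + h _); apply/val_inj.
Qed.

Lemma prod3 (h : 'I_3 -> R) : \prod_(i < 3) h i = h 0 * h 1 * h 2.
Proof.
rewrite !big_ord_recl big_ord0 mulr1 mulrA.
by congr (_ * h _ * h _); apply/val_inj.
Qed.

(* [c i] is the first integral [tau_i - u f_i^2]; summing the logarithmic
   derivatives of the [f_i^2] turns closedness into this formula for [u]. *)
Definition soliton_u (c x : 'I_3 -> R) : R :=
  - (1 / 3) * (c 0 / x 0 ^+ 2 + c 1 / x 1 ^+ 2 + c 2 / x 2 ^+ 2).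

Definition soliton_field (c x : 'I_3 -> R) (i : 'I_3) : R :=
  1 / 2 * ((x 0 ^+ 2 + x 1 ^+ 2 + x 2 ^+ 2 - 2 * x i ^+ 2) * x i / (x 0 * x 1 * x 2)
           + soliton_u c x * x i + c i / x i).

Definition soliton_ode (c : 'I_3 -> R) (D : set R) (f : 'I_3 -> R -> R) : Prop :=
  forall t, D t -> (forall i, 0 < f i t) /\
    forall i, is_der (f i) t (soliton_field c (f^~ t) i).

Lemma steady_soliton_ode a b f u : (a < b)%E -> steady_soliton a b f u ->
  exists c : 'I_3 -> R, [/\ c 0 + c 1 + c 2 = 0, soliton_ode c (oitv a b) f,
    forall t, oitv a b t -> u t = soliton_u c (f^~ t) &
    forall t i, oitv a b t -> tau f i t = u t * f i t ^+ 2 + c i].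
Proof.
move=> ab [[fpos fsm hp] usm hconst hsum].
have hd t i : oitv a b t -> is_der (f i) t ((f i)^`()%classic t).
  by move=> Dt; exact: (smooth_on_derivable (fsm i) Dt).
have [t0 Dt0] : exists t0, oitv a b t0.
  move: ab; rewrite /oitv /=; clear; case: a b => [a||] [b||] //=.
  - by rewrite lte_fin => ab; exists ((a + b) / 2); rewrite !lte_fin; rlra.
  - by move=> _; exists (a + 1); rewrite ltry lte_fin; rlra.
  - by move=> _; exists (b - 1); rewrite ltNyr lte_fin; rlra.
  - by move=> _; exists 0; rewrite ltNyr ltry.
pose c i := tau f i t0 - u t0 * f i t0 ^+ 2.
have tauE t i : oitv a b t -> tau f i t = 2 * f i t * (f i)^`()%classic t +
    f i t ^+ 2 / (f 0 t * f 1 t * f 2 t) * (2 * f i t ^+ 2 - (f 0 t ^+ 2 + f 1 t ^+ 2 + f 2 t ^+ 2)).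
  move=> Dt; rewrite /tau /prodf prod3 /sumsq sum3; congr (_ + _).
  by apply: der_val; have h := hd t i Dt; der_eq; rewrite expr1.
have tauc t i : oitv a b t -> tau f i t = u t * f i t ^+ 2 + c i.
  move=> Dt; rewrite /c; suff -> : tau f i t0 - u t0 * f i t0 ^+ 2 = tau f i t - u t * f i t ^+ 2 by ring.
  apply: (@der0_const _ a b (fun s => tau f i s - u s * f i s ^+ 2)) => // s Ds.
  rewrite -(hconst i s Ds); apply: derivable_der.
  have hs : forall x, oitv a b x -> f 0 x * f 1 x * f 2 x != 0.
    by move=> x Dx; rewrite !mulf_neq0 // gt_eqF // fpos.
  have [d h] : exists d, is_der (fun s => 2 * f i s * (f i)^`()%classic s +
    f i s ^+ 2 / (f 0 s * f 1 s * f 2 s) * (2 * f i s ^+ 2 - (f 0 s ^+ 2 + f 1 s ^+ 2 + f 2 s ^+ 2))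
     - u s * f i s ^+ 2) s d.
    have h0 := hd s 0 Ds; have h1 := hd s 1 Ds; have h2 := hd s 2 Ds.
    have hi := hd s i Ds; have hii := smooth_on_derivable2 (fsm i) Ds.
    have hu := smooth_on_derivable usm Ds.
    by eexists; der; exact: hs.
  apply: der_derivable; apply: der_near h.
  by apply: filterS (oitv_near Ds) => x Dx; rewrite tauE.
have c0 : c 0 + c 1 + c 2 = 0.
  by have := hsum t0 Dt0; rewrite /c sum3 /sumsq sum3 => h; rlra.
(* The first integrals express [f_i'] through [u]; substituted into the closedness equation they
   give one linear equation for [u]. *)
have key t : oitv a b t -> u t = soliton_u c (f^~ t) /\
    forall i, (f i)^`()%classic t = soliton_field c (f^~ t) i.
  move=> Dt.
  have p0 : 0 < f 0 t by exact: fpos. have p1 : 0 < f 1 t by exact: fpos.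
  have p2 : 0 < f 2 t by exact: fpos.
  have [n0 n1 n2] : [/\ f 0 t != 0, f 1 t != 0 & f 2 t != 0] by rewrite !gt_eqF.
  have di i : f i t != 0 -> (f i)^`()%classic t = 1 / 2 * ((f 0 t ^+ 2 + f 1 t ^+ 2 + f 2 t ^+ 2 - 2 * f i t ^+ 2) * f i t / (f 0 t * f 1 t * f 2 t)
           + u t * f i t + c i / f i t).
    move=> ni; have := tauc t i Dt; rewrite tauE // => h.
    have -> : c i = 2 * f i t * (f i)^`()%classic t +
      f i t ^+ 2 / (f 0 t * f 1 t * f 2 t) * (2 * f i t ^+ 2 - (f 0 t ^+ 2 + f 1 t ^+ 2 + f 2 t ^+ 2)) - u t * f i t ^+ 2 by rewrite h; ring.
    by field; rewrite n0 n1 n2 ni.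
  have hpp : (prodf f)^`()%classic t = (f 0)^`()%classic t * f 1 t * f 2 t +
     f 0 t * (f 1)^`()%classic t * f 2 t + f 0 t * f 1 t * (f 2)^`()%classic t.
    have -> : prodf f = (fun s => f 0 s * f 1 s * f 2 s) by apply/funext => s; rewrite /prodf prod3.
    have h0 := hd t 0 Dt; have h1 := hd t 1 Dt; have h2 := hd t 2 Dt.
    by apply: der_val; der_eq; ring.
  have uE : u t = soliton_u c (f^~ t).
    have := hp t Dt; rewrite hpp /sumsq sum3 (di 0) // (di 1) // (di 2) // => h.
    rewrite /soliton_u.
    have : (u t - - (1 / 3) * (c 0 / f 0 t ^+ 2 + c 1 / f 1 t ^+ 2 + c 2 / f 2 t ^+ 2)) * (f 0 t * f 1 t * f 2 t) * 3 = 0.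
      rewrite -[RHS](subrr (f 0 t ^+ 2 + f 1 t ^+ 2 + f 2 t ^+ 2)) -{1}h.
      by field; rewrite n0 n1 n2.
    move/eqP; rewrite mulf_eq0 pnatr_eq0 orbF mulf_eq0 !mulf_eq0 (negbTE n0) (negbTE n1) (negbTE n2) !orbF.
    by rewrite subr_eq0 => /eqP.
  split=> // i; rewrite di ?gt_eqF ?fpos // /soliton_field uE //.
exists c; split => //; last by move=> t /key [].
move=> t Dt; split=> [i|i]; first exact: fpos.
by rewrite -(key t Dt).2; exact: hd.
Qed.

Lemma soliton_field_Cn (c : 'I_3 -> R) D f n : open D ->
  (forall t, D t -> forall i, 0 < f i t) -> (forall i, Cn D n (f i)) ->
  Cn D n (fun t => soliton_u c (f^~ t)) /\
  forall i, Cn D n (fun t => soliton_field c (f^~ t) i).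
Proof.
move=> oD fpos hf.
have hV i : Cn D n (fun t => (f i t)^-1).
  by apply: CnV => // t Dt; rewrite gt_eqF // fpos.
have hX i : Cn D n (fun t => f i t ^+ 2) by apply: CnX.
have hXV i : Cn D n (fun t => (f i t ^+ 2)^-1).
  by apply: CnV => // t Dt; rewrite gt_eqF // exprn_gt0 // fpos.
have hu : Cn D n (fun t => soliton_u c (f^~ t)).
  rewrite /soliton_u; apply: CnM => //; first exact: Cn_cst.
  by do 2?apply: CnD => //; apply: CnM => //; exact: Cn_cst.
split=> // i; rewrite /soliton_field.
apply: CnM => //; first exact: Cn_cst.
apply: CnD => //; last by apply: CnM => //; exact: Cn_cst.
apply: CnD => //; last exact: CnM.
apply: CnM => //; last first.
  apply: CnV => //; first by move=> t Dt; rewrite gt_eqF // !mulr_gt0 // fpos.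
  by apply: CnM => //; exact: CnM.
apply: CnM => //; apply: CnD => //; first by do 2?apply: CnD => //.
by apply: CnN => //; apply: CnM => //; exact: Cn_cst.
Qed.

(** Bootstrap: the field is a rational function of the [f_i] with nonvanishing denominators, so
    solutions that are [n] times derivable are [n + 1] times derivable. *)
Lemma ode_smooth (c : 'I_3 -> R) a b f : soliton_ode c (oitv a b) f ->
  (forall i, smooth_on a b (f i)) /\ smooth_on a b (fun t => soliton_u c (f^~ t)).
Proof.
move=> h; have oD := @open_oitv R a b.
have fpos t : oitv a b t -> forall i, 0 < f i t by move=> /h [].
have H n : forall i, Cn (oitv a b) n (f i).
  elim: n => // n IH i; apply: (Cn_der oD (dg := fun t => soliton_field c (f^~ t) i)).
    by move=> t /h [].
  exact: (soliton_field_Cn c oD fpos IH).2.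
split=> [i|]; apply/smooth_onP => // n.
exact: (soliton_field_Cn c oD fpos (H n)).1.
Qed.

Lemma ode_tau (c : 'I_3 -> R) D f t i : soliton_ode c D f -> D t ->
  tau f i t = soliton_u c (f^~ t) * f i t ^+ 2 + c i.
Proof.
move=> h /h [fpos hd]; rewrite /tau /prodf prod3 /sumsq sum3.
have -> : (fun s => f i s ^+ 2)^`()%classic t = 2 * f i t * soliton_field c (f^~ t) i.
  by apply: der_val; have h1 := hd i; der_eq; rewrite expr1.
rewrite /soliton_field.
have [n0 n1 n2 ni] : [/\ f 0 t != 0, f 1 t != 0, f 2 t != 0 & f i t != 0] by rewrite !gt_eqF.
by field; rewrite n0 n1 n2 ni.
Qed.

Lemma ode_steady_soliton (c : 'I_3 -> R) a b f u : c 0 + c 1 + c 2 = 0 ->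
  soliton_ode c (oitv a b) f -> (forall t, oitv a b t -> u t = soliton_u c (f^~ t)) ->
  steady_soliton a b f u.
Proof.
move=> c0 h hu; have [hs1 hs2] := ode_smooth h.
have tE t i : oitv a b t -> tau f i t = u t * f i t ^+ 2 + c i.
  by move=> Dt; rewrite (ode_tau i h Dt) hu.
split; first split => //.
- by move=> i t /h [].
- move=> t /h [fpos hd].
  have -> : (prodf f)^`()%classic t = soliton_field c (f^~ t) 0 * f 1 t * f 2 t +
     f 0 t * soliton_field c (f^~ t) 1 * f 2 t + f 0 t * f 1 t * soliton_field c (f^~ t) 2.
    have -> : prodf f = (fun s => f 0 s * f 1 s * f 2 s) by apply/funext => s; rewrite /prodf prod3.
    have h0 := hd 0; have h1 := hd 1; have h2 := hd 2.
    by apply: der_val; der_eq; ring.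
  rewrite /sumsq sum3 /soliton_field /soliton_u.
  have [n0 n1 n2] : [/\ f 0 t != 0, f 1 t != 0 & f 2 t != 0] by rewrite !gt_eqF.
  by field; rewrite n0 n1 n2.
- apply/smooth_onP => n; have /smooth_onP/(_ n) := hs2.
  by apply: Cn_eq => [|t Dt]; [exact: open_oitv|rewrite hu].
- move=> i t Dt; apply: der_val; apply: (@der_near _ (fun=> c i)); last exact: der_cst.
  by apply: filterS (oitv_near Dt) => s Ds; rewrite tE //; ring.
- move=> t Dt; rewrite sum3 !tE // /sumsq sum3.
  have -> : c 2 = - c 0 - c 1 by rlra.
  by ring.
Qed.

End SolitonODE.

(** * Local existence and continuation *)

Section Picard.
Context {R : realType}.
Notation state := ('I_3 -> R).
Implicit Types (phi psi : state -> R).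

Definition dist3 (x y : state) : R := `|x 0 - y 0| + `|x 1 - y 1| + `|x 2 - y 2|.

Lemma dist3_ge0 x y : 0 <= dist3 x y.
Proof. by rewrite !addr_ge0. Qed.

Lemma dist3_coord (x y : state) i : `|x i - y i| <= dist3 x y.
Proof.
have [h0 h1 h2] : [/\ 0 <= `|x 0 - y 0|, 0 <= `|x 1 - y 1| & 0 <= `|x 2 - y 2|].
  by split.
by rewrite /dist3; elim/I3P: i; rlra.
Qed.

Lemma dist3_le (x y : state) C : (forall i, `|x i - y i| <= C) -> dist3 x y <= 3 * C.
Proof. by move=> h; rewrite /dist3; have := h 0; have := h 1; have := h 2; rlra. Qed.

Definition bounded_lipschitz phi : Prop :=
  (exists2 B : R, 0 <= B & forall x, `|phi x| <= B) /\
  (exists2 L : R, 0 <= L & forall x y, `|phi x - phi y| <= L * dist3 x y).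

Lemma bl_cst (c : R) : bounded_lipschitz (fun=> c).
Proof.
split; first by exists `|c|.
by exists 0 => // x y; rewrite subrr normr0 mul0r.
Qed.

Lemma blD phi psi : bounded_lipschitz phi -> bounded_lipschitz psi ->
  bounded_lipschitz (fun x => phi x + psi x).
Proof.
move=> [[B B0 hB] [L L0 hL]] [[B' B'0 hB'] [L' L'0 hL']]; split.
  exists (B + B') => [|x]; first exact: addr_ge0.
  by apply: le_trans (ler_normD _ _) _; apply: lerD.
exists (L + L') => [|x y]; first exact: addr_ge0.
have -> : phi x + psi x - (phi y + psi y) = (phi x - phi y) + (psi x - psi y) by ring.
by rewrite mulrDl; apply: le_trans (ler_normD _ _) _; apply: lerD.
Qed.

Lemma blM phi psi : bounded_lipschitz phi -> bounded_lipschitz psi ->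
  bounded_lipschitz (fun x => phi x * psi x).
Proof.
move=> [[B B0 hB] [L L0 hL]] [[B' B'0 hB'] [L' L'0 hL']]; split.
  exists (B * B') => [|x]; first exact: mulr_ge0.
  by rewrite normrM ler_pM.
exists (L * B' + B * L') => [|x y]; first by rewrite addr_ge0 // mulr_ge0.
have -> : phi x * psi x - phi y * psi y = (phi x - phi y) * psi x + phi y * (psi x - psi y) by ring.
apply: le_trans (ler_normD _ _) _; rewrite [X in _ <= X]mulrDl !normrM; apply: lerD.
  by rewrite mulrAC ler_pM.
by rewrite -mulrA ler_pM.
Qed.

Lemma blN phi : bounded_lipschitz phi -> bounded_lipschitz (fun x => - phi x).
Proof.
move=> h; have := blM (bl_cst (-1)) h; congr bounded_lipschitz.
by apply/funext => x; rewrite mulN1r.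
Qed.

Lemma blX phi n : bounded_lipschitz phi -> bounded_lipschitz (fun x => phi x ^+ n).
Proof.
move=> h; elim: n => [|n IH]; first exact: bl_cst.
have := blM h IH; congr bounded_lipschitz.
by apply/funext => x; rewrite exprS.
Qed.

Lemma blV phi (e : R) : 0 < e -> (forall x, e <= phi x) ->
  bounded_lipschitz phi -> bounded_lipschitz (fun x => (phi x)^-1).
Proof.
move=> e0 he [_ [L L0 hL]].
have p0 x : 0 < phi x by exact: lt_le_trans (he x).
have pe x : (phi x)^-1 <= e^-1 by rewrite lef_pV2 ?posrE.
split.
  by exists e^-1 => [|x]; [rewrite invr_ge0 ltW|rewrite gtr0_norm ?invr_gt0].
exists (e^-1 * e^-1 * L) => [|x y].
  by rewrite !mulr_ge0 // invr_ge0 ltW.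
have -> : (phi x)^-1 - (phi y)^-1 = (phi x)^-1 * (phi y)^-1 * (phi y - phi x).
  by field; rewrite !gt_eqF.
rewrite normrM -[X in _ <= X]mulrA; apply: ler_pM => //; last by rewrite distrC.
by rewrite gtr0_norm ?mulr_gt0 ?invr_gt0 // ler_pM // invr_ge0 ltW.
Qed.

Definition clamp (m M v : R) : R := Num.max m (Num.min v M).

Lemma clamp_bounds m M v : m <= M -> m <= clamp m M v <= M.
Proof. by move=> mM; rewrite /clamp le_max lexx /= ge_max mM /= ge_min lexx orbT. Qed.

Lemma clamp_id m M v : m <= v <= M -> clamp m M v = v.
Proof. by move=> /andP[h1 h2]; rewrite /clamp min_l // max_r. Qed.

Lemma clamp_lipschitz m M v w : `|clamp m M v - clamp m M w| <= `|v - w|.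
Proof.
rewrite /clamp; wlog vw : v w / w <= v.
  move=> H; have [h|/ltW h] := leP w v; first exact: H.
  by rewrite distrC (distrC v); exact: H.
have h1 : Num.min w M <= Num.min v M.
  by rewrite le_min !ge_min vw lexx /= orbT.
have h2 : Num.max m (Num.min w M) <= Num.max m (Num.min v M).
  by rewrite ge_max !le_max lexx h1 orbT.
rewrite ger0_norm ?subr_ge0 // [X in _ <= X]ger0_norm ?subr_ge0 //.
have h3 : Num.min v M - Num.min w M <= v - w.
  by have [h|h] := leP v M; have [h'|h'] := leP w M; rlra.
by have [h|h] := leP m (Num.min v M); have [h'|h'] := leP m (Num.min w M); rlra.
Qed.

Lemma clamp_cont m M : continuous (clamp m M).
Proof.
move=> v; apply/cvgrPdist_lt => e e0; near=> w.
apply: le_lt_trans (clamp_lipschitz _ _ _ _) _.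
by near: w; apply: (@cvgr_dist_lt _ _ _ _ _ id v cvg_id).
Unshelve. all: by end_near. Qed.

Lemma bl_clamp m M i : m <= M -> bounded_lipschitz (fun x => clamp m M (x i)).
Proof.
move=> mM; split.
  exists (`|m| + `|M|) => [|x]; first exact: addr_ge0.
  have /andP[h1 h2] := clamp_bounds (x i) mM.
  have := ler_norm (- m); have := ler_norm M; have := normr_ge0 m; have := normr_ge0 M.
  by rewrite normrN ler_norml => *; apply/andP; split; rlra.
exists 1 => // x y; rewrite mul1r.
exact: le_trans (clamp_lipschitz _ _ _ _) (dist3_coord _ _ _).
Qed.

(** Clamping every coordinate to [[m, M]] with [m > 0] keeps the denominators away from 0. The field
    becomes bounded and Lipschitz on the whole space, and the Picard iterates need not be confined
    to a domain. *)
Lemma bl_soliton_field (c : state) m M i : 0 < m -> m <= M ->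
  bounded_lipschitz (fun x => soliton_field c (fun j => clamp m M (x j)) i).
Proof.
move=> m0 mM.
have hc j : bounded_lipschitz (fun x => clamp m M (x j)) by exact: bl_clamp.
have cm (x : state) j : m <= clamp m M (x j) by case/andP: (clamp_bounds (x j) mM).
have cp (x : state) j : 0 <= clamp m M (x j) by apply: le_trans (cm x j); exact: ltW.
have hV j : bounded_lipschitz (fun x => (clamp m M (x j))^-1).
  by apply: (blV m0).
have hXV j : bounded_lipschitz (fun x => (clamp m M (x j) ^+ 2)^-1).
  apply: (@blV _ (m ^+ 2)); first exact: exprn_gt0.
    by move=> x; rewrite ler_pXn2r ?nnegrE // ltW.
  exact: blX.
have hP : bounded_lipschitz (fun x => (clamp m M (x 0) * clamp m M (x 1) * clamp m M (x 2))^-1).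
  apply: (@blV _ (m * m * m)); first by rewrite !mulr_gt0.
    by move=> x; do 2?[apply: ler_pM => //]; rewrite ?mulr_ge0 // ltW.
  by do !apply: blM.
have hX j : bounded_lipschitz (fun x => clamp m M (x j) ^+ 2) by exact: blX.
rewrite /soliton_field /soliton_u.
apply: blM; first exact: bl_cst.
apply: blD; last by apply: blM => //; exact: bl_cst.
apply: blD.
  apply: blM => //; apply: blM => //; apply: blD; first by do 2?apply: blD.
  by apply: blN; apply: blM => //; exact: bl_cst.
apply: blM => //; apply: blM; first exact: bl_cst.
by do 2?apply: blD; apply: blM => //; exact: bl_cst.
Qed.

Lemma exists_antiderivative (phi : R -> R) a b t1 : a < t1 < b -> continuous phi ->
  exists F : R -> R, F t1 = 0 /\ forall t, a < t < b -> is_der F t (phi t).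
Proof.
move=> /andP[at1 t1b] cphi.
pose G t := (\int[@lebesgue_measure R]_(s in `[a, t]) phi s)%R.
have hG t : a < t < b -> is_der G t (phi t).
  move=> /andP[at_ tb]; apply: (@continuous_FTC1_closed R phi a t b) => //.
  - apply: continuous_compact_integrable; first exact: segment_compact.
    exact: continuous_subspaceT.
  - exact: cphi.
exists (fun t => G t - G t1); split; first by rewrite subrr.
by move=> t /hG h; der_eq; rewrite ?oppr0 addr0.
Qed.

Lemma mean_value_bound (g dg : R -> R) (K a b t s : R) :
  (forall t, a <= t <= b -> is_der g t (dg t)) ->
  (forall t, a <= t <= b -> `|dg t| <= K) ->
  a <= t <= b -> a <= s <= b -> `|g t - g s| <= K * `|t - s|.
Proof.
move=> h1 h2.
wlog st : s t / s <= t.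
  move=> H ht hs; have [st|/ltW st] := leP s t; first exact: H.
  by rewrite distrC (distrC t); apply: H.
move=> tab sab; have hb : forall x : R, s <= x <= t -> a <= x <= b by move=> x; rlra.
rewrite (ger0_norm (_ : 0 <= t - s)) ?subr_ge0 // ler_norml; apply/andP; split.
  have : g s - - K * s <= g t - - K * t.
    apply: (@ge0_der_le _ (fun x => g x - - K * x) (fun x => dg x + K)) => // x /hb hx.
      by have h := h1 x hx; der_eq; ring.
    by have := h2 x hx; rewrite ler_norml; rlra.
  by rlra.
have : g t - K * t <= g s - K * s.
  apply: (@le0_der_ge _ (fun x => g x - K * x) (fun x => dg x - K)) => // x /hb hx.
    by have h := h1 x hx; der_eq; ring.
  by have := h2 x hx; rewrite ler_norml; rlra.
by rlra.
Qed.

(** The intervals of radius [2 C / 2 ^ k] about [y k] are nested, and [l] is the supremum of their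
    left ends. *)
Lemma geometric_limit (y : nat -> R) (C : R) : 
  (forall k, `|y k.+1 - y k| <= C / 2 ^+ k) ->
  exists l, forall k, `|l - y k| <= 2 * C / 2 ^+ k.
Proof.
move=> h.
have C0 : 0 <= C by have := h 0%N; rewrite expr0 divr1; apply: le_trans.
pose E k : R := 2 * C / 2 ^+ k.
have ES k : E k = E k.+1 + C / 2 ^+ k.
  by rewrite /E exprS; field; rewrite expf_neq0.
have u_dec j k : (j <= k)%N -> y k + E k <= y j + E j.
  elim: k => [|k IH]; first by rewrite leqn0 => /eqP ->.
  rewrite leq_eqVlt => /orP[/eqP -> //|/IH]; apply: le_trans.
  by have := h k; rewrite ler_norml (ES k); rlra.
have l_inc j k : (j <= k)%N -> y j - E j <= y k - E k.
  elim: k => [|k IH]; first by rewrite leqn0 => /eqP ->.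
  rewrite leq_eqVlt => /orP[/eqP -> //|/IH h']; apply: le_trans h' _.
  by have := h k; rewrite ler_norml (ES k); rlra.
have E0 k : 0 <= E k by rewrite /E divr_ge0 ?mulr_ge0 ?exprn_ge0.
have lu j k : y j - E j <= y k + E k.
  have h1 := l_inc j (maxn j k) (leq_maxl _ _); have h2 := u_dec k (maxn j k) (leq_maxr _ _).
  by have := E0 (maxn j k); rlra.
have hs : has_sup [set y j - E j | j in [set: nat]].
  by split; [exists (y 0%N - E 0%N), 0%N|exists (y 0%N + E 0%N) => _ [j _ <-]].
exists (sup [set y j - E j | j in [set: nat]]) => k; rewrite ler_norml; apply/andP; split.
  have : y k - E k <= sup [set y j - E j | j in [set: nat]].
    by apply: ub_le_sup; [case: hs|exists k].
  by rewrite -/(E k); rlra.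
have : sup [set y j - E j | j in [set: nat]] <= y k + E k.
  by apply: ge_sup; [case: hs|move=> _ [j _ <-]].
by rewrite -/(E k); rlra.
Qed.

Lemma geometric_le0 (a C : R) : (forall k, a <= C / 2 ^+ k) -> a <= 0.
Proof.
move=> h; rewrite leNgt; apply/negP => a0.
have C0 : 0 < C by have := h 0%N; rewrite expr0 divr1; exact: lt_le_trans.
pose k := Num.bound (C / a).
have hk : C / a < k%:R by apply: archi_boundP; rewrite divr_ge0 ?ltW.
have k2 : (k%:R : R) <= 2 ^+ k by rewrite -natrX ler_nat ltnW // ltn_expl.
have p2 : 0 < (2 : R) ^+ k by rewrite exprn_gt0.
have := h k; rewrite ler_pdivlMr // => h1.
have : C < k%:R * a by rewrite -ltr_pdivrMr.
have : k%:R * a <= 2 ^+ k * a by rewrite ler_pM2r.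
by rlra.
Qed.

Section Iteration.
Variables (V : state -> state) (B L t1 d : R) (x0 : state).
Hypotheses (B0 : 0 <= B) (L0 : 0 <= L) (d0 : 0 < d)
  (hB : forall x i, `|V x i| <= B)
  (hL : forall (x y : state) i, `|V x i - V y i| <= L * dist3 x y)
  (hd : 6 * L * d <= 1).

(** Clamping time makes the integrands continuous on the whole line, as [exists_antiderivative]
    asks. *)
Let tc (t : R) : R := clamp (t1 - d) (t1 + d) t.

Let J (t : R) : Prop := t1 - d <= t <= t1 + d.

Let tcJ t : J (tc t).
Proof. by apply: clamp_bounds; move: (d0); lra. Qed.

Let V_cont (x : 'I_3 -> R -> R) i : (forall j t, J t -> {for t, continuous (x j)}) ->
  continuous (fun t => V (fun j => x j (tc t)) i).
Proof.
move=> cx t; apply/cvgrPdist_lt => e e0.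
have cc j : {for t, continuous (fun s => x j (tc s))}.
  apply: continuous_comp; first exact: clamp_cont.
  exact/cx/tcJ.
pose e' := e / (3 * (L + 1)).
have L1 : 0 < 3 * (L + 1) by move: (L0); lra.
have e'0 : 0 < e' by rewrite divr_gt0.
near=> s.
apply: le_lt_trans (hL _ _ _) _.
have h j : `|x j (tc t) - x j (tc s)| <= e'.
  move: j; apply: I3P; apply: ltW; near: s; exact: (@cvgr_dist_lt _ _ _ _ _ _ _ (cc _) _ e'0).
apply: (@le_lt_trans _ _ (L * (3 * e'))).
  by rewrite ler_wpM2l //; apply: dist3_le.
have -> : L * (3 * e') = e - e / (L + 1) by rewrite /e'; field; rewrite gt_eqF //; move: (L0); lra.
by rewrite ltrBlDr ltrDl divr_gt0 //; move: (L0); lra.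
Unshelve. all: by end_near. Qed.

(** Continuity of [x] is a premise inside the conclusion, so that [step] is a total function that
    can be iterated; a discontinuous input is sent to itself. *)
Let step_exists (x : 'I_3 -> R -> R) : exists y : 'I_3 -> R -> R,
  (forall j t, J t -> {for t, continuous (x j)}) ->
  forall i, y i t1 = x0 i /\
  forall t, J t -> is_der (y i) t (V (fun j => x j (tc t)) i).
Proof.
have [cx|ncx] := pselect (forall j t, J t -> {for t, continuous (x j)}); last first.
  by exists x.
have H i : exists F : R -> R, F t1 = 0 /\ forall t, t1 - 2 * d < t < t1 + 2 * d ->
    is_der F t (V (fun j => x j (tc t)) i).
  by apply: exists_antiderivative; [move: (d0); lra|exact: V_cont].
exists (fun i t => x0 i + projT1 (cid (H i)) t) => _ i.
case: (cid (H i)) => F [F0 hF] /=; split; first by rewrite F0 addr0.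
move=> t [/andP[h1 h2]]; have h : is_der F t (V (fun j => x j (tc t)) i).
  by apply: hF; move: (d0); lra.
by der_eq; rewrite add0r.
Qed.

Let step x := projT1 (cid (step_exists x)).

Let it k := iter k step (fun j _ => x0 j).

Let itP k : (forall j t, J t -> {for t, continuous (it k j)}) /\
  forall i, it k.+1 i t1 = x0 i /\
    forall t, J t -> is_der (it k.+1 i) t (V (fun j => it k j (tc t)) i).
Proof.
have key k' : (forall j t, J t -> {for t, continuous (it k' j)}) -> forall i, it k'.+1 i t1 = x0 i /\
    forall t, J t -> is_der (it k'.+1 i) t (V (fun j => it k' j (tc t)) i).
  by move=> hc i; exact: projT2 (cid (step_exists (it k'))) hc i.
have hc : forall j t, J t -> {for t, continuous (it k j)}.
  elim: k => [|k IH] j t Jt; first exact: cst_continuous.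
  by have [_ /(_ t Jt) /der_cont] := key k IH j.
by split=> // i; exact: key.
Qed.

Let J1 : J t1. Proof. by rewrite /J; move: (d0); lra. Qed.

Let it0 k i : it k i t1 = x0 i.
Proof. by case: k => [//|k]; have [_ /(_ i) []] := itP k. Qed.

Let itV k i t : J t -> is_der (it k.+1 i) t (V (fun j => it k j t) i).
Proof.
move=> Jt; have [_ /(_ i) [_ /(_ t Jt)]] := itP k.
by rewrite /tc clamp_id.
Qed.

Let Jd t : J t -> `|t - t1| <= d.
Proof. by move=> /andP[h1 h2]; rewrite ler_norml; lra. Qed.

(** As [dist3] sums three coordinates, one step contracts by the factor [3 L d], and [6 L d <= 1]
    makes it at most [1 / 2]. *)
Let it_diff k i t : J t -> `|it k.+1 i t - it k i t| <= B * d / 2 ^+ k.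
Proof.
elim: k i t => [|k IH] i t Jt.
  have := @mean_value_bound (it 1 i) (fun t => V (fun j => it 0 j t) i) B _ _ t t1
    (itV 0 i) (fun s _ => hB _ _) Jt J1.
  rewrite it0 expr0 divr1 => /le_trans; apply.
  by rewrite ler_wpM2l // Jd.
have := @mean_value_bound (fun s => it k.+2 i s - it k.+1 i s)
  (fun s => V (fun j => it k.+1 j s) i - V (fun j => it k j s) i)
  (B / 2 ^+ k.+1) (t1 - d) (t1 + d) t t1 _ _ Jt J1.
rewrite !it0 subrr subr0 => /(_ _ _)/le_trans; apply.
- move=> s Js; have h1 := @itV k.+1 i s Js; have h2 := @itV k i s Js.
  by der_eq.
- move=> s Js; apply: le_trans (hL _ _ _) _.
  have h : dist3 (it k.+1 ^~ s) (it k ^~ s) <= 3 * (B * d / 2 ^+ k).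
    by apply: dist3_le => j; exact: IH.
  apply: le_trans (ler_wpM2l L0 h) _.
  have p0 : 0 <= B / 2 ^+ k.+1 by rewrite divr_ge0 // exprn_ge0.
  have -> : L * (3 * (B * d / 2 ^+ k)) = (6 * L * d) * (B / 2 ^+ k.+1).
    by rewrite exprS; field; rewrite expf_neq0.
  by rewrite -[X in _ <= X]mul1r ler_wpM2r.
- rewrite mulrAC ler_wpM2r ?invr_ge0 ?exprn_ge0 // ler_wpM2l //.
  exact: Jd.
Qed.

Lemma picard : exists x : 'I_3 -> R -> R, forall i,
  [/\ x i t1 = x0 i,
      forall t, t1 - d <= t <= t1 + d -> `|x i t - x0 i| <= B * d &
      forall t, t1 - d < t < t1 + d -> is_der (x i) t (V (x^~ t) i)].
Proof.
have hlim i t : exists l, J t -> forall k, `|l - it k i t| <= 2 * (B * d) / 2 ^+ k.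
  have [Jt|nJt] := pselect (J t); last by exists 0.
  have [l hl] := @geometric_limit (fun k => it k i t) (B * d) (fun k => it_diff k i Jt).
  by exists l.
pose x i t := projT1 (cid (hlim i t)).
have xP i t : J t -> forall k, `|x i t - it k i t| <= 2 * (B * d) / 2 ^+ k.
  by move=> Jt k; rewrite /x; case: (cid (hlim i t)) => l /= /(_ Jt).
have x1 i : x i t1 = x0 i.
  apply/eqP; rewrite -subr_eq0 -normr_le0; apply: (@geometric_le0 _ (2 * (B * d))) => k.
  by have := xP i t1 J1 k; rewrite it0.
have it_lip k i s t : J s -> J t -> `|it k i s - it k i t| <= B * `|s - t|.
  case: k => [|k] Js Jt; first by rewrite subrr normr0 mulr_ge0.
  by apply: (@mean_value_bound (it k.+1 i) (fun t => V (fun j => it k j t) i) B _ _ s t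
    (itV k i) (fun s _ => hB _ _)).
have x_lip i s t : J s -> J t -> `|x i s - x i t| <= B * `|s - t|.
  move=> Js Jt; rewrite -subr_le0; apply: (@geometric_le0 _ (4 * (B * d))) => k.
  have h1 := xP i s Js k; have h2 := xP i t Jt k; have h3 := it_lip k i s t Js Jt.
  have -> : 4 * (B * d) / 2 ^+ k = 2 * (B * d) / 2 ^+ k + 2 * (B * d) / 2 ^+ k by ring.
  have -> : x i s - x i t = (x i s - it k i s) + ((it k i s - it k i t) - (x i t - it k i t)) by ring.
  have h4 := ler_normD (x i s - it k i s) ((it k i s - it k i t) - (x i t - it k i t)).
  have h5 := ler_normB (it k i s - it k i t) (x i t - it k i t).
  by lra.
pose xc i t := x i (tc t).
have xcE i t : J t -> xc i t = x i t by move=> Jt; rewrite /xc /tc clamp_id.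
have xc_cont i t : {for t, continuous (xc i)}.
  have B1 : 0 < B + 1 by move: (B0); lra.
  apply/cvgrPdist_lt => e e0; have e1 : 0 < e / (B + 1) by rewrite divr_gt0.
  near=> s.
  apply: le_lt_trans (x_lip i _ _ (tcJ _) (tcJ _)) _.
  apply: (@le_lt_trans _ _ (B * `|t - s|)).
    by rewrite ler_wpM2l // clamp_lipschitz.
  apply: (@le_lt_trans _ _ ((B + 1) * `|t - s|)); first by rewrite ler_wpM2r //; lra.
  rewrite mulrC -ltr_pdivlMr //; near: s; exact: (@cvgr_dist_lt _ _ _ _ _ id t cvg_id _ e1).
(* One more step, applied to the limit [x], yields a differentiable [y]. Comparing [y] with the
   iterates shows [y = x], so no limit has to be exchanged with a derivative. *)
have [y /(_ (fun j t _ => xc_cont j t)) yP] := step_exists xc.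
have yx i t : J t -> y i t = x i t.
  move=> Jt; apply/eqP; rewrite -subr_eq0 -normr_le0.
  apply: (@geometric_le0 _ (3 * (B * d))) => k.
  have [y1 yd] := yP i.
  have := @mean_value_bound (fun s => y i s - it k.+1 i s)
    (fun s => V (fun j => x j s) i - V (fun j => it k j s) i)
    (B / 2 ^+ k) (t1 - d) (t1 + d) t t1 _ _ Jt J1.
  rewrite y1 it0 subrr subr0 => /(_ _ _) h.
  have h1 : `|y i t - it k.+1 i t| <= B / 2 ^+ k * `|t - t1|.
    apply: h => s Js.
      have h1 := @itV k i s Js; have h2 := yd s Js.
      der_eq; congr (V _ _ - _); apply/funext => j.
      by rewrite /xc [tc (tc _)]clamp_id // /tc clamp_id.
    apply: le_trans (hL _ _ _) _.
    have h : dist3 (x ^~ s) (it k ^~ s) <= 3 * (2 * (B * d) / 2 ^+ k).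
      by apply: dist3_le => j; exact: xP.
    apply: le_trans (ler_wpM2l L0 h) _.
    have p0 : 0 <= B / 2 ^+ k by rewrite divr_ge0 // exprn_ge0.
    have -> : L * (3 * (2 * (B * d) / 2 ^+ k)) = (6 * L * d) * (B / 2 ^+ k) by ring.
    by rewrite -[X in _ <= X]mul1r ler_wpM2r.
  have h2 : B / 2 ^+ k * `|t - t1| <= (B * d) / 2 ^+ k.
    by rewrite mulrAC ler_wpM2r ?invr_ge0 ?exprn_ge0 // ler_wpM2l // Jd.
  have h3 := xP i t Jt k.+1.
  have h4 : 2 * (B * d) / 2 ^+ k.+1 = B * d / 2 ^+ k.
    by rewrite exprS; field; rewrite expf_neq0.
  rewrite h4 in h3.
  have -> : y i t - x i t = (y i t - it k.+1 i t) - (x i t - it k.+1 i t) by ring.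
  have h5 := ler_normB (y i t - it k.+1 i t) (x i t - it k.+1 i t).
  have h6 : 0 <= B * d / 2 ^+ k by rewrite divr_ge0 ?exprn_ge0 // mulr_ge0 // ltW.
  have -> : 3 * (B * d) / 2 ^+ k = 3 * (B * d / 2 ^+ k) by ring.
  by lra.
exists x => i; split; first exact: x1.
- move=> t Jt; rewrite -(x1 i); apply: le_trans (x_lip _ _ _ Jt J1) _.
  by rewrite ler_wpM2l // Jd.
- move=> t /andP[ht1 ht2]; have Jt : J t by rewrite /J !ltW.
  have [_ /(_ t Jt) h] := yP i.
  apply: (@der_near _ (y i)).
    have : \forall s \near t, t1 - d < s < t1 + d by apply: near_itv; rewrite ht1.
    by apply: filterS => s /andP[hs1 hs2]; apply: yx; rewrite /J !ltW.
  move: h; congr is_der; congr V; apply/funext => j.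
  by rewrite /xc [tc (tc _)]clamp_id // /tc clamp_id.
Unshelve. all: by end_near. Qed.

End Iteration.
End Picard.

(** * Uniqueness and continuation past a finite time *)

Section Continuation.
Context {R : realType}.

Lemma gronwall_unique (V : ('I_3 -> R) -> 'I_3 -> R) (L a b : R) (x y : 'I_3 -> R -> R) :
  0 <= L -> (forall v w i, `|V v i - V w i| <= L * dist3 v w) ->
  (forall i t, a <= t <= b -> is_der (x i) t (V (x^~ t) i)) ->
  (forall i t, a <= t <= b -> is_der (y i) t (V (y^~ t) i)) ->
  (forall i, x i a = y i a) -> forall i t, a <= t <= b -> x i t = y i t.
Proof.
move=> L0 hL hx hy xy i t tab.
pose G s := (x 0 s - y 0 s) ^+ 2 + (x 1 s - y 1 s) ^+ 2 + (x 2 s - y 2 s) ^+ 2.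
pose W i s := V (x^~ s) i - V (y^~ s) i.
pose dG s := 2 * (x 0 s - y 0 s) * W 0 s + 2 * (x 1 s - y 1 s) * W 1 s +
   2 * (x 2 s - y 2 s) * W 2 s.
(* The rate is [6 L] because [2 L (n0 + n1 + n2)^2 <= 6 L (n0^2 + n1^2 + n2^2)] for the coordinate
   distances [n0], [n1], [n2]. *)
have : G t <= G a * expR (6 * L * (t - a)).
  apply: (@gronwall _ G dG); first by rlra.
    move=> s hs; have [h0 [h1 h2]] : is_der (fun s => x 0 s - y 0 s) s (W 0 s) /\
       is_der (fun s => x 1 s - y 1 s) s (W 1 s) /\ is_der (fun s => x 2 s - y 2 s) s (W 2 s).
      have hs' : a <= s <= b by rlra.
      by split; [|split]; (apply: derD; [exact: hx|apply: derN; exact: hy]).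
    rewrite /G /dG; eapply der_eq.
      apply: derD; [apply: derD|]; apply: derX; [exact: h0|exact: h1|exact: h2].
    by rewrite /= !expr1.
  move=> s hs; rewrite /dG.
  have hW j : (x j s - y j s) * W j s <= `|x j s - y j s| * (L * dist3 (x^~ s) (y^~ s)).
    by apply: le_trans (ler_norm _) _; rewrite normrM ler_wpM2l //; exact: hL.
  have := hW 0; have := hW 1; have := hW 2; rewrite /dist3.
  set n0 := `|x 0 s - y 0 s|; set n1 := `|x 1 s - y 1 s|; set n2 := `|x 2 s - y 2 s|.
  have -> : G s = n0 ^+ 2 + n1 ^+ 2 + n2 ^+ 2 by rewrite /G -!normrX !ger0_norm ?sqr_ge0.
  have : 0 <= L * ((n0 - n1) ^+ 2 + (n1 - n2) ^+ 2 + (n0 - n2) ^+ 2).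
    by rewrite mulr_ge0 // !addr_ge0 // sqr_ge0.
  by rnra.
have -> : G a = 0 by rewrite /G !xy !subrr expr0n /= !addr0.
rewrite mul0r => Gt.
have := sqr_ge0 (x 0 t - y 0 t); have := sqr_ge0 (x 1 t - y 1 t); have := sqr_ge0 (x 2 t - y 2 t).
rewrite /G in Gt => g2 g1 g0; apply/eqP; rewrite -subr_eq0 -sqrf_eq0; apply/eqP.
by elim/I3P: i; rlra.
Qed.

(** The length [d] of the Picard interval depends on [m], [M] and [c] only, so that a start at some
    [t1] within [d / 2] of [T] reaches beyond [T]. The margin [m / 2] of the clamp, with
    [B d <= m / 2], keeps the new solution where the clamp is inactive. *)
Lemma ode_extend (c : 'I_3 -> R) (T t0 m M : R) f : 0 < T -> t0 < T -> 0 < m ->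
  soliton_ode c (oitv 0%:E T%:E) f ->
  (forall t i, t0 < t < T -> m <= f i t <= M) ->
  exists (T' : R) (g : 'I_3 -> R -> R), [/\ T < T', soliton_ode c (oitv 0%:E T'%:E) g &
    forall t i, 0 < t < T -> g i t = f i t].
Proof.
move=> T0 t0T m0 hf hb.
have mM : m <= M.
  have := hb ((t0 + T) / 2) 0 ltac:(rlra).
  by move=> /andP[]; exact: le_trans.
pose V x i := soliton_field c (fun j => clamp (m / 2) (M + m / 2) (x j)) i.
have hV i : bounded_lipschitz (V^~ i) by apply: bl_soliton_field; rlra.
have [B B0 hB] : exists2 B : R, 0 <= B & forall x i, `|V x i| <= B.
  have [[[B0 B00 hB0] _] [[B1 B10 hB1] _] [[B2 B20 hB2] _]] := And3 (hV 0) (hV 1) (hV 2).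
  exists (B0 + B1 + B2) => [|x]; first by rewrite !addr_ge0.
  by apply: I3P; [have := hB0 x|have := hB1 x|have := hB2 x]; rlra.
have [L L0 hL] : exists2 L : R, 0 <= L & forall x y i, `|V x i - V y i| <= L * dist3 x y.
  have [[_ [L0 L00 hL0]] [_ [L1 L10 hL1]] [_ [L2 L20 hL2]]] := And3 (hV 0) (hV 1) (hV 2).
  exists (L0 + L1 + L2) => [|x y]; first by rewrite !addr_ge0.
  apply: I3P; rewrite !mulrDl.
  - have := hL0 x y; have := mulr_ge0 L10 (dist3_ge0 x y); have := mulr_ge0 L20 (dist3_ge0 x y); rlra.
  - have := hL1 x y; have := mulr_ge0 L00 (dist3_ge0 x y); have := mulr_ge0 L20 (dist3_ge0 x y); rlra.
  - have := hL2 x y; have := mulr_ge0 L10 (dist3_ge0 x y); have := mulr_ge0 L00 (dist3_ge0 x y); rlra.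
have [d [d0 dL dB]] : exists d, [/\ 0 < d, 6 * L * d <= 1 & B * d <= m / 2].
  have p1 : 0 < 6 * L + 1 by rlra. have p2 : 0 < B + 1 by rlra.
  exists (Num.min (6 * L + 1)^-1 (m / 2 / (B + 1))); split.
  - by rewrite lt_min invr_gt0 p1 divr_gt0 //; rlra.
  - apply: (@le_trans _ _ (6 * L * (6 * L + 1)^-1)).
      by rewrite ler_wpM2l ?ge_min ?lexx //; rlra.
    by rewrite ler_pdivrMr //; rlra.
  - apply: (@le_trans _ _ (B * (m / 2 / (B + 1)))).
      by rewrite ler_wpM2l ?ge_min ?lexx ?orbT.
    by rewrite mulrA ler_pdivrMr //; rnra.
pose t1 := Num.max (Num.max (T / 2) (T - d / 2)) ((t0 + T) / 2).
have [t10 t11 t12 t13] : [/\ T / 2 <= t1, T - d / 2 <= t1, t0 < t1 & t1 < T].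
  split; rewrite /t1; first by rewrite !le_max lexx.
  - by rewrite !le_max lexx orbT.
  - by rewrite lt_max; apply/orP; right; rlra.
  - by rewrite !gt_max -andbA; apply/and3P; split; rlra.
have [x hx] := @picard R V B L t1 d (f^~ t1) B0 L0 d0 hB hL dL.
have fb t i : t1 <= t < T -> m <= f i t <= M by move=> ?; apply: hb; rlra.
have xb t i : t1 - d < t < t1 + d -> m / 2 <= x i t <= M + m / 2.
  move=> ht; have [_ hx2 _] := hx i.
  have : `|x i t - f i t1| <= B * d by apply: hx2; rlra.
  have := fb t1 i; rewrite ler_norml; rlra.
have Vf t i : t1 <= t < T -> is_der (f i) t (V (f^~ t) i).
  move=> ht; have [|_ /(_ i)] := hf t; first by rewrite /oitv /= !lte_fin; rlra.
  move/der_eq; apply; rewrite /V; congr (soliton_field _ _ _); apply/funext => j.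
  by rewrite clamp_id //; have := fb t j ht; rlra.
have Vx t i : t1 - d < t < t1 + d -> is_der (x i) t (soliton_field c (x^~ t) i).
  move=> ht; have [_ _ /(_ t ht)] := hx i; move/der_eq; apply.
  rewrite /V; congr (soliton_field _ _ _); apply/funext => j.
  by rewrite clamp_id //; exact: xb.
have fx t i : t1 <= t < T -> f i t = x i t.
  move=> ht; apply: (@gronwall_unique V L t1 t) => //.
  - by move=> j s hs; apply: Vf; rlra.
  - by move=> j s hs; have [_ _ ] := hx j; apply; rlra.
  - by move=> j; have [-> _ _] := hx j.
  - by rlra.
exists (t1 + d), (fun i t => if t < T then f i t else x i t); split; first by rlra.
- move=> t; rewrite /oitv /= !lte_fin => ht.
  have [tT|Tt] := ltP t T.
    have [|h1 h2] := hf t; first by rewrite /oitv /= !lte_fin; rlra.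
    split=> i; first exact: h1.
    apply: der_near (h2 i); have : \forall s \near t, 0 < s < T by apply: near_itv; rlra.
    by apply: filterS => s /andP[_ ->].
  split=> i; first by have := xb t i ltac:(rlra); rlra.
  apply: (@der_near _ (x i)); last by apply: Vx; rlra.
  have : \forall s \near t, t1 < s < t1 + d by apply: near_itv; rlra.
  apply: filterS => s /andP[/ltW hs _]; have [sT|_] := ltP s T; last by [].
  by rewrite fx // sT hs.
- by move=> t i /andP[_ ->].
Qed.

End Continuation.

(** * The reduced system *)

Section Reduced.
Context {R : realType}.
Implicit Types (k t a b : R) (f A y z : R -> R) (g : 'I_3 -> R -> R).

(* With [f = f_1], [A = f_2 f_3] and [f_2 / f_3 = e^h] the unknowns are
   [y = sinh h] and [z = cosh h]; [hdot] is [h'] and [k] is [c / 3]. *)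
Definition hdot k f A y z t : R := - 2 * y t / f t + 3 * k * z t / A t.

Definition fdot k f A y z t : R := z t - f t ^+ 2 / (2 * A t) + k * f t * y t / A t.

Definition reduced k (D : set R) f A y z : Prop := forall t, D t ->
  [/\ 0 < f t, 0 < A t, 0 < z t, z t ^+ 2 = 1 + y t ^+ 2 &
   [/\ is_der f t (fdot k f A y z t), is_der A t (f t - k * y t),
       is_der y t (z t * hdot k f A y z t) & is_der z t (y t * hdot k f A y z t)]].

Definition red_A g t : R := g 1 t * g 2 t.
Definition red_y g t : R := (g 1 t ^+ 2 - g 2 t ^+ 2) / (2 * red_A g t).
Definition red_z g t : R := (g 1 t ^+ 2 + g 2 t ^+ 2) / (2 * red_A g t).

Lemma ode_reduced (c : 'I_3 -> R) k D g : c 0 = 0 -> c 1 = 3 * k -> c 2 = - (3 * k) ->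
  soliton_ode c D g -> reduced k D (g 0) (red_A g) (red_y g) (red_z g).
Proof.
move=> c0 c1 c2 h t Dt; have [gpos hd] := h t Dt.
have p0 := gpos 0; have p1 := gpos 1; have p2 := gpos 2.
have [n0 n1 n2] : [/\ g 0 t != 0, g 1 t != 0 & g 2 t != 0] by rewrite !gt_eqF.
have A0 : 0 < red_A g t by rewrite mulr_gt0.
have d0 := hd 0; have d1 := hd 1; have d2 := hd 2.
have dA : is_der (red_A g) t (g 0 t - k * red_y g t).
  rewrite /red_A; der_eq; rewrite /soliton_field /soliton_u /red_y /red_A c0 c1 c2.
  by field; rewrite n0 n1 n2.
split => //.
- by rewrite divr_gt0 ?mulr_gt0 // addr_gt0 ?exprn_gt0.
- by rewrite /red_z /red_y /red_A; field; rewrite n1 n2.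
split => //.
- move/der_eq: d0; apply; rewrite /soliton_field /soliton_u /fdot /red_z /red_y /red_A c0 c1 c2.
  by field; rewrite n0 n1 n2.
- rewrite [X in is_der X](_ : _ = fun t => (g 1 t ^+ 2 - g 2 t ^+ 2) * (2 * (g 1 t * g 2 t))^-1); last first.
    by apply/funext => s.
  der_eq; first by rewrite !mulf_neq0 ?pnatr_eq0.
  rewrite /soliton_field /soliton_u /hdot /red_z /red_y /red_A c0 c1 c2.
  by field; rewrite n0 n1 n2.
- rewrite [X in is_der X](_ : _ = fun t => (g 1 t ^+ 2 + g 2 t ^+ 2) * (2 * (g 1 t * g 2 t))^-1); last first.
    by apply/funext => s.
  der_eq; first by rewrite !mulf_neq0 ?pnatr_eq0.
  rewrite /soliton_field /soliton_u /hdot /red_z /red_y /red_A c0 c1 c2.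
  by field; rewrite n0 n1 n2.
Qed.

Lemma red_sq1 g t : 0 < g 1 t -> 0 < g 2 t -> g 1 t ^+ 2 = red_A g t * (red_z g t + red_y g t).
Proof.
by move=> h1 h2; rewrite /red_z /red_y /red_A; field; rewrite !gt_eqF.
Qed.

Lemma red_sq2 g t : 0 < g 1 t -> 0 < g 2 t -> g 2 t ^+ 2 = red_A g t * (red_z g t - red_y g t).
Proof.
by move=> h1 h2; rewrite /red_z /red_y /red_A; field; rewrite !gt_eqF.
Qed.

Lemma perm_sum3 (s : 'S_3) (h : 'I_3 -> R) : h (s 0) + h (s 1) + h (s 2) = h 0 + h 1 + h 2.
Proof.
rewrite -(sum3 h) -(sum3 (h \o s)); apply/esym.
by rewrite (reindex_inj (@perm_inj _ s)).
Qed.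

Lemma perm_prod3 (s : 'S_3) (h : 'I_3 -> R) : h (s 0) * h (s 1) * h (s 2) = h 0 * h 1 * h 2.
Proof.
rewrite -(prod3 h) -(prod3 (h \o s)); apply/esym.
by rewrite (reindex_inj (@perm_inj _ s)).
Qed.

Lemma soliton_u_perm (s : 'S_3) (c x : 'I_3 -> R) :
  soliton_u (fun i => c (s i)) (fun i => x (s i)) = soliton_u c x.
Proof. by rewrite /soliton_u (perm_sum3 s (fun i => c i / x i ^+ 2)). Qed.

Lemma soliton_field_perm (s : 'S_3) (c x : 'I_3 -> R) i :
  soliton_field (fun i => c (s i)) (fun i => x (s i)) i = soliton_field c x (s i).
Proof.
by rewrite /soliton_field soliton_u_perm (perm_sum3 s (fun i => x i ^+ 2)) (perm_prod3 s x).
Qed.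

Lemma soliton_ode_perm (s : 'S_3) (c : 'I_3 -> R) D g : soliton_ode c D g ->
  soliton_ode (fun i => c (s i)) D (fun i => g (s i)).
Proof.
move=> h t Dt; have [h1 h2] := h t Dt; split => i //.
by have := h2 (s i); rewrite -soliton_field_perm.
Qed.

(** The last limit is the first-order datum through which the parameter of the family enters; the
    other four are the same for all members. *)
Definition closes k f A y z : Prop :=
  [/\ f t @[t --> 0^'+] --> (0 : R), A t @[t --> 0^'+] --> (1 : R),
      y t @[t --> 0^'+] --> (0 : R), z t @[t --> 0^'+] --> (1 : R) & y t / f t @[t --> 0^'+] --> k].

Lemma near_pick (P : R -> Prop) (T : R) : 0 < T -> (\forall t \near 0^'+, P t) ->
  exists2 t, 0 < t < T & P t.
Proof.
move=> T0 h; have : \forall t \near (0:R)^'+, P t /\ 0 < t < T.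
  near=> t; split; first by near: t.
  by apply/andP; split; near: t; [exact: nbhs_right_gt|exact: nbhs_right_lt].
by move=> hP; have [t [h1 h2]] := @filter_ex _ _ (at_right_proper_filter 0) _ hP; exists t.
Unshelve. all: by end_near. Qed.

Lemma cvg_right_der (F : R -> R) (d : R) : is_der F 0 d -> F 0 = 0 -> F t / t @[t --> 0^'+] --> d.
Proof.
move=> [h1]; rewrite derive1E => h2 F0.
have h : h^-1 *: ((F \o shift (0 : R)) h%:A - F 0) @[h --> 0^'] --> d.
  by rewrite -h2; exact: h1.
have : h^-1 *: ((F \o shift (0 : R)) h%:A - F 0) @[h --> 0^'+] --> d.
  exact: cvg_dnbhs_at_right.
apply: cvg_trans; apply: near_eq_cvg; near=> t.
by rewrite /= F0 subr0 addr0 /GRing.scale /= mulr1 mulrC.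
Unshelve. all: by end_near. Qed.

Lemma cvg_right_cont (F : R -> R) : {for (0 : R), continuous F} -> F t @[t --> (0 : R)^'+] --> F 0.
Proof. by move=> h; exact: (cvg_at_right_filter h). Qed.

Lemma cvg_right_ext (F G : R -> R) (e l : R) : 0 < e -> (forall t, 0 < t < e -> F t = G t) ->
  F t @[t --> 0^'+] --> l -> G t @[t --> 0^'+] --> l.
Proof.
move=> e0 FG; apply: cvg_trans; apply: near_eq_cvg; near=> t.
by apply: FG; apply/andP; split; near: t; [exact: nbhs_right_gt|exact: nbhs_right_lt].
Unshelve. all: by end_near. Qed.

Lemma cvg_right_lim (F : R -> R) (l m : R) :
  F t @[t --> 0^'+] --> l -> l = m -> F t @[t --> 0^'+] --> m.
Proof. by move=> h <-. Qed.

Lemma cvg_right_uniq (F : R -> R) (l m : R) :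
  F t @[t --> 0^'+] --> l -> F t @[t --> 0^'+] --> m -> l = m.
Proof. by move=> h1 h2; apply: (cvg_unique _ h1 h2). Qed.

(** By parity [g 1 ^+ 2] and [g 2 ^+ 2] extend with opposite slopes [d] and [- d] at 0. The singular
    part of [tau g 1] contains their difference divided by [g 0], which tends to [2 d], so [tau g 1]
    tends to [d + 2 d]. Hence [c = 3 d]: the torsion datum determines the slope. The limit of
    [tau g 0] is 0 for every closing structure. *)
Lemma smoothly_closing_limits (b c : R) g u : smoothly_closing b g u ->
  (exists2 e, 0 < e & forall t, 0 < t < e -> forall i, 0 < g i t) ->
  tau g 1 t @[t --> 0^'+] --> c ->
  [/\ [/\ g 0 t @[t --> 0^'+] --> 0, g 1 t @[t --> 0^'+] --> b,
      g 2 t @[t --> 0^'+] --> b & u t @[t --> 0^'+] --> 0],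
      (g 1 t ^+ 2 - g 2 t ^+ 2) / g 0 t @[t --> 0^'+] --> 2 * (c / 3) &
      tau g 0 t @[t --> 0^'+] --> 0].
Proof.
move=> [b0 [e [F [U [e0 [smF smU] FE odd [F0' F1 F2]]]]]] [e' e'0 gpos] htau.
have D0 : oitv (- e)%:E e%:E 0 by rewrite /oitv /= !lte_fin; rlra.
have [F00 F1sq U0] : [/\ F 0 0 = 0, forall t, - e < t < e -> F 2 t ^+ 2 = F 1 (- t) ^+ 2 & U 0 = 0].
  split.
  - by have [|h _ _] := odd 0; [rlra|move: h; rewrite oppr0; rlra].
  - by move=> t te; have [|_ -> _] := odd (- t); rewrite ?opprK //; rlra.
  - by have [|_ _ h] := odd 0; [rlra|move: h; rewrite oppr0; rlra].
have dF i t : oitv (- e)%:E e%:E t -> is_der (F i) t ((F i)^`()%classic t).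
  by move=> ht; exact: (smooth_on_derivable (smF i) ht).
have cF i : F i t @[t --> 0^'+] --> F i 0.
  by apply: cvg_right_cont; exact: der_cont (dF i 0 D0).
have gE i (l : R) : F i t @[t --> 0^'+] --> l -> g i t @[t --> 0^'+] --> l.
  by apply: (cvg_right_ext e0) => t /FE [].
have g0 : g 0 t @[t --> 0^'+] --> 0 by apply: gE; have := cF 0; rewrite F00.
have g1 : g 1 t @[t --> 0^'+] --> b by apply: gE; have := cF 1; rewrite F1.
have g2 : g 2 t @[t --> 0^'+] --> b by apply: gE; have := cF 2; rewrite F2.
have hu : u t @[t --> 0^'+] --> 0.
  apply: (cvg_right_ext e0 (F := U)); first by move=> t /FE [].
  by have := cvg_right_cont (der_cont (smooth_on_derivable smU D0)); rewrite U0.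
(* [d] is the derivative of [F_2^2] at 0, so [- d] is that of [F_3^2] *)
pose d := 2 * b * (F 1)^`()%classic 0.
pose sq i t := F i t ^+ 2.
have dsq i t : oitv (- e)%:E e%:E t -> is_der (sq i) t (2 * F i t * (F i)^`()%classic t).
  by move=> ht; have h := dF i t ht; rewrite /sq; der_eq; rewrite expr1.
have csq i : (2 * F i t * (F i)^`()%classic t) @[t --> 0^'+] --> 2 * F i 0 * (F i)^`()%classic 0.
  apply: cvg_right_cont; apply: continuousM; last exact: der_cont (smooth_on_derivable2 (smF i) D0).
  by apply: continuousM; [exact: cst_continuous|exact: der_cont (dF i 0 D0)].
have dsq2 : is_der (sq 2) 0 (- d).
  apply: (@der_near _ (fun t => sq 1 (- t))).
    have : \forall t \near 0, - e < t < e by apply: near_itv; rlra.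
    by apply: filterS => t ht; rewrite /sq F1sq.
  rewrite -mulrN1; apply: (@der_comp _ (sq 1) (fun t => - t) 0 d (-1)).
    by rewrite oppr0; have := dsq 1 0 D0; rewrite F1.
  by apply: derN; exact: der_id.
have q : (F 1 t ^+ 2 - F 2 t ^+ 2) / t @[t --> 0^'+] --> 2 * d.
  apply: (@cvg_right_der (fun t => F 1 t ^+ 2 - F 2 t ^+ 2)); last by rewrite F1 F2 subrr.
  have -> : 2 * d = d + - - d by ring.
  by apply: derD; [have := dsq 1 0 D0; rewrite F1|exact: derN].
have q0 : F 0 t / t @[t --> 0^'+] --> (1 : R).
  by apply: cvg_right_der => //; have := dF 0 0 D0; rewrite F0'.
have quot : (g 1 t ^+ 2 - g 2 t ^+ 2) / g 0 t @[t --> 0^'+] --> 2 * d.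
  have e1 : 0 < Num.min e e' by rewrite lt_min e0.
  apply: (cvg_right_ext e1 (F := fun t => (F 1 t ^+ 2 - F 2 t ^+ 2) / t * (F 0 t / t)^-1)).
    move=> t /andP[t0]; rewrite lt_min => /andP[te te'].
    have [h _] := FE t ltac:(rlra); rewrite !h.
    by field; rewrite !gt_eqF // gpos // t0.
  apply: (@cvg_right_lim _ (2 * d * 1^-1)); last by rewrite invr1 mulr1.
  exact: cvgM q (cvgV (oner_neq0 _) q0).
have bN0 : b != 0 by rewrite gt_eqF.
have tauE i t : 0 < t < e -> tau g i t = 2 * F i t * (F i)^`()%classic t +
   g i t ^+ 2 / prodf g t * (2 * g i t ^+ 2 - sumsq g t).
  move=> te; rewrite /tau; congr (_ + _); apply: der_val.
  apply: (@der_near _ (sq i)); last by apply: dsq; rewrite /oitv /= !lte_fin; rlra.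
  have : \forall s \near t, 0 < s < e by exact: near_itv.
  by apply: filterS => s /FE [h _]; rewrite /sq h.
have em : 0 < Num.min e e' by rewrite lt_min e0.
have tau1 : tau g 1 t @[t --> 0^'+] --> 3 * d.
  apply: (cvg_right_ext em (F := fun t => 2 * F 1 t * (F 1)^`()%classic t +
     (g 1 t / g 2 t) * ((g 1 t ^+ 2 - g 2 t ^+ 2) / g 0 t - g 0 t))).
    move=> t /andP[t0]; rewrite lt_min => /andP[te te'].
    rewrite tauE ?t0 // /prodf prod3 /sumsq sum3.
    by field; rewrite !gt_eqF // gpos // t0.
  apply: (@cvg_right_lim _ (2 * F 1 0 * (F 1)^`()%classic 0 + b / b * (2 * d - 0))); last first.
    by rewrite F1 /d; field.
  apply: cvgD; first exact: csq.
  apply: cvgM; last exact: cvgB.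
  exact: cvgM g1 (cvgV bN0 g2).
have dc : d = c / 3 by have := cvg_right_uniq tau1 htau; rlra.
split; first by split.
  by rewrite -dc.
apply: (cvg_right_ext em (F := fun t => 2 * F 0 t * (F 0)^`()%classic t +
     (g 0 t / (g 1 t * g 2 t)) * (g 0 t ^+ 2 - g 1 t ^+ 2 - g 2 t ^+ 2))).
  move=> t /andP[t0]; rewrite lt_min => /andP[te te'].
  rewrite tauE ?t0 // /prodf prod3 /sumsq sum3.
  by field; rewrite !gt_eqF // gpos // t0.
apply: (@cvg_right_lim _ (2 * F 0 0 * (F 0)^`()%classic 0 + (0 / (b * b)) * (0 ^+ 2 - b ^+ 2 - b ^+ 2))); last first.
  by rewrite F00; ring.
apply: cvgD; first exact: csq.
apply: cvgM.
  by apply: cvgM => //; apply: cvgV; [rewrite mulf_neq0|exact: cvgM].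
have h (v : R -> R) (l : R) : v t @[t --> (0:R)^'+] --> l -> v t ^+ 2 @[t --> (0:R)^'+] --> l ^+ 2.
  by move=> hv; rewrite expr2; under eq_fun do rewrite expr2; exact: cvgM.
by apply: cvgB; [apply: cvgB|]; exact: h.
Qed.

Lemma closes_of_limits k g e : 0 < e -> (forall t, 0 < t < e -> forall i, 0 < g i t) ->
  g 0 t @[t --> 0^'+] --> (0 : R) -> g 1 t @[t --> 0^'+] --> (1 : R) ->
  g 2 t @[t --> 0^'+] --> (1 : R) ->
  (g 1 t ^+ 2 - g 2 t ^+ 2) / g 0 t @[t --> 0^'+] --> 2 * k ->
  closes k (g 0) (red_A g) (red_y g) (red_z g).
Proof.
move=> e0 gpos h0 h1 h2 hq.
have hA : red_A g t @[t --> 0^'+] --> (1 : R).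
  by apply: (@cvg_right_lim _ (1 * 1)); [exact: cvgM|rewrite mulr1].
have h2A : (2 * red_A g t)^-1 @[t --> 0^'+] --> (2^-1 : R).
  apply: cvgV; first by rewrite pnatr_eq0.
  apply: (@cvg_right_lim _ (2 * 1)); last by rewrite mulr1.
  exact: cvgM (cvg_cst _) hA.
have sq (v : R -> R) (l : R) : v t @[t --> (0:R)^'+] --> l -> v t ^+ 2 @[t --> (0:R)^'+] --> l ^+ 2.
  by move=> hv; rewrite expr2; under eq_fun do rewrite expr2; exact: cvgM.
have h1s := sq _ _ h1; have h2s := sq _ _ h2; rewrite expr1n in h1s h2s.
split => //.
- apply: (@cvg_right_lim _ ((1 - 1) * 2^-1)); last by rewrite subrr mul0r.
  exact: cvgM (cvgB h1s h2s) h2A.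
- apply: (@cvg_right_lim _ ((1 + 1) * 2^-1)); last by rewrite mulfV // pnatr_eq0.
  exact: cvgM (cvgD h1s h2s) h2A.
- apply: (cvg_right_ext e0 (F := fun t => (g 1 t ^+ 2 - g 2 t ^+ 2) / g 0 t * (2 * red_A g t)^-1)).
    move=> t te; rewrite /red_y /red_A; field.
    by rewrite !gt_eqF // gpos.
  apply: (@cvg_right_lim _ (2 * k * 2^-1)); last by field.
  exact: cvgM hq h2A.
Qed.

Lemma S_soliton_reduced (c : R) (T : \bar R) (f : 'I_3 -> R -> R) (u : R -> R) : S_soliton 1 c T f u ->
  exists (s : 'S_3) (cc : 'I_3 -> R), let g := fun i => f (s i) in let k := `|c| / 3 in
  [/\ s 0 = 0, [/\ cc 0 = 0, cc 1 = 3 * k & cc 2 = - (3 * k)],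
     soliton_ode cc (oitv 0%:E T) g,
     forall t, oitv 0%:E T t -> u t = soliton_u cc (g^~ t) &
     closes k (g 0) (red_A g) (red_y g) (red_z g)].
Proof.
move=> [[T0 hst] hcl _ [ht0 ht1 ht2] _].
have [cc [ccsum ode hu htau]] := steady_soliton_ode T0 hst.
have [e e0 hD] : exists2 e : R, 0 < e & forall t, 0 < t < e -> oitv 0%:E T t.
  move: T0; rewrite /oitv /=; case: T {hst ode hu htau} => [T||] //.
  - by rewrite lte_fin => T0; exists T => // t; rewrite !lte_fin.
  - by move=> _; exists 1 => // t /andP[t1 t2]; rewrite lte_fin t1 ltry.
have fpos t : 0 < t < e -> forall i, 0 < f i t by move=> /hD /ode [].
have [|[l0 l1 l2 lu] lq _] := smoothly_closing_limits hcl _ ht1; first by exists e.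
(* Since [u] tends to 0 and [f i] has a limit, the first integral [cc i] equals the limit of
   [tau f i]. *)
have ccE i (l m : R) : tau f i t @[t --> 0^'+] --> l -> f i t @[t --> 0^'+] --> m -> cc i = l.
  move=> h1 h2; have : tau f i t - u t * (f i t * f i t) @[t --> 0^'+] --> l - 0 * (m * m).
    exact: cvgB h1 (cvgM lu (cvgM h2 h2)).
  rewrite mul0r subr0; apply: cvg_right_uniq.
  apply: (cvg_right_ext e0 (F := fun=> cc i)); last exact: cvg_cst.
  by move=> t /hD Dt; rewrite htau //; ring.
have c0 := ccE _ _ _ ht0 l0; have c1 := ccE _ _ _ ht1 l1; have c2 := ccE _ _ _ ht2 l2.
have [cge|clt] := ger0P c.
  exists 1%g, cc; rewrite perm1 c0 c1 c2.
  have -> : (fun i => f ((1%g : 'S_3) i)) = f by apply/funext => i; rewrite perm1.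
  have kE : 3 * (c / 3) = c by field.
  split; rewrite /=; [by []|by rewrite kE|exact: ode|exact: hu|].
  exact: (closes_of_limits e0 fpos l0 l1 l2 lq).
have [s0 s1 s2] : [/\ tperm (1 : 'I_3) 2 0 = 0, tperm (1 : 'I_3) 2 1 = 2 & tperm (1 : 'I_3) 2 2 = 1].
  by rewrite tpermL tpermR tpermD.
exists (tperm 1 2), (fun i => cc (tperm 1 2 i)).
have kE : 3 * (- c / 3) = - c by field.
split; rewrite /=.
- exact: s0.
- by rewrite s0 s1 s2 c0 c1 c2 kE opprK.
- exact: soliton_ode_perm.
- by move=> t Dt; rewrite hu //; exact/esym/(soliton_u_perm (tperm 1 2) cc (f^~ t)).
- apply: (@closes_of_limits _ (fun i => f (tperm 1 2 i)) e); rewrite /= ?s0 ?s1 ?s2 //.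
    by move=> t te i; exact: fpos.
  have -> : 2 * (- c / 3) = - (2 * (c / 3)) by ring.
  have : - ((f 1 t ^+ 2 - f 2 t ^+ 2) / f 0 t) @[t --> 0^'+] --> - (2 * (c / 3)) by exact: cvgN.
  by under eq_fun do rewrite -mulNr opprB.
Qed.

End Reduced.

(** * Qualitative behaviour of smoothly-closing solutions *)

Section Dynamics.
Context {R : realType}.
Implicit Types (k t a b : R) (f A y z : R -> R) (T : \bar R).

Definition closing_solution k T f A y z : Prop :=
  [/\ 0 <= k, (0%:E < T)%E, reduced k (oitv 0%:E T) f A y z & closes k f A y z].

Lemma oitv0_sub T t s : oitv 0%:E T t -> 0 < s <= t -> oitv 0%:E T s.
Proof.
move=> /andP[_ h] /andP[s0 st]; apply/andP; split; first by rewrite lte_fin.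
by apply: le_lt_trans h; rewrite lee_fin.
Qed.

Lemma oitv0_gt0 T t : oitv 0%:E T t -> 0 < t.
Proof. by move=> /andP[]; rewrite lte_fin. Qed.

Lemma near_lim (F : R -> R) (l e : R) : F t @[t --> 0^'+] --> l -> 0 < e ->
  \forall t \near 0^'+, l - e < F t < l + e.
Proof.
move=> h e0; have h' : \forall t \near 0^'+, `|l - F t| < e by exact: (@cvgr_dist_lt _ _ _ _ _ _ _ h _ e0).
by apply: filterS h' => t; rewrite distrC ltr_distl.
Qed.

Lemma pick_lim (F : R -> R) (l e T : R) : 0 < T -> F t @[t --> 0^'+] --> l -> 0 < e ->
  exists2 t, 0 < t < T & l - e < F t < l + e.
Proof. by move=> T0 h e0; exact: near_pick T0 (near_lim h e0). Qed.

Lemma reduced_r_der k D f A y z t : reduced k D f A y z -> D t ->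
  is_der (fun t => A t / z t) t
    ((f t ^+ 2 - 4 * k * y t * f t + 2 * (A t / z t) * y t ^+ 2) / (z t * f t)).
Proof.
move=> h Dt; have [f0 A0 z0 zy [df dA dy dz]] := h t Dt.
have [nf nA nz] : [/\ f t != 0, A t != 0 & z t != 0] by rewrite !gt_eqF.
by der_eq => //; rewrite /hdot; field; rewrite nf nA nz.
Qed.

Lemma reduced_p_der k D f A y z t : reduced k D f A y z -> D t ->
  is_der (fun t => f t * A t) t (z t * A t + f t ^+ 2 / 2).
Proof.
move=> h Dt; have [f0 A0 z0 zy [df dA dy dz]] := h t Dt.
by der_eq; rewrite /fdot; field; rewrite gt_eqF.
Qed.

Lemma reduced_z_ge1 k D f A y z t : reduced k D f A y z -> D t -> 1 <= z t.
Proof.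
move=> h Dt; have [f0 A0 z0 zy _] := h t Dt.
have := sqr_ge0 (y t); rnra.
Qed.

(** At small times [y] is positive because [y / f] tends to [k > 0]; later, at a zero of [y], its
    derivative is [3 k z^2 / A > 0]. *)
Lemma closing_y_pos k T f A y z t : closing_solution k T f A y z -> 0 < k ->
  oitv 0%:E T t -> 0 < y t.
Proof.
move=> [_ T0 red [_ _ _ _ cyf]] k0 Dt; have t0 := oitv0_gt0 Dt.
have [s /andP[s0 st] hs] := pick_lim t0 cyf k0.
have D x : s <= x <= t -> oitv 0%:E T x by move=> hx; apply: (oitv0_sub Dt); rlra.
have [fs As zs _ _] := red s (D s ltac:(rlra)).
have ys : 0 < y s.
  by have : 0 < y s / f s by [rlra]; rewrite pmulr_lgt0 ?invr_gt0.
apply: (@pos_barrier _ y (fun x => z x * hdot k f A y z x) s t) => //.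
- by move=> x /D /red [_ _ _ _ []].
- move=> x hx _ yx; have [|fx Ax zx _ _] := red x; first by apply: D; rlra.
  by rewrite /hdot yx mulr0 mul0r add0r !mulr_gt0 ?invr_gt0.
- by rlra.
Qed.

(** For [k = 0] the square of [y] is nonincreasing, and it starts from the limit 0. This replaces an
    appeal to uniqueness at the singular time. *)
Lemma closing_y_zero T f A y z t : closing_solution 0 T f A y z -> oitv 0%:E T t -> y t = 0.
Proof.
move=> [_ T0 red [_ _ cy _ _]] Dt; have t0 := oitv0_gt0 Dt.
suff : y t ^+ 2 <= 0 by move=> h; apply/eqP; rewrite -sqrf_eq0 eq_le h sqr_ge0.
apply/ler_addgt0Pr => e e0; rewrite add0r.
have e1 : 0 < Num.min e 1 by rewrite lt_min e0 ltr01.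
have [s /andP[s0 st] hs] := pick_lim t0 cy e1.
have D x : s <= x <= t -> oitv 0%:E T x by move=> hx; apply: (oitv0_sub Dt); rlra.
apply: (@le_trans _ _ (y s ^+ 2)).
  apply: (@le0_der_ge _ (fun x => y x ^+ 2) (fun x => 2 * y x * (z x * hdot 0 f A y z x))).
  - exact: ltW.
  - by move=> x /D /red [_ _ _ _ [_ _ h _]]; der_eq; rewrite expr1.
  - move=> x /D /red [fx Ax zx _ _].
    have -> : 2 * y x * (z x * hdot 0 f A y z x) = - (4 * y x ^+ 2 * z x / f x).
      by rewrite /hdot; field; rewrite !gt_eqF.
    by rewrite oppr_le0 divr_ge0 ?(ltW fx) // mulr_ge0 ?(ltW zx) // mulr_ge0 ?sqr_ge0.
have [h1 h2] : Num.min e 1 <= e /\ Num.min e 1 <= 1 by rewrite !ge_min !lexx orbT.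
by rnra.
Qed.

Lemma closing_y_ge0 k T f A y z t : closing_solution k T f A y z ->
  oitv 0%:E T t -> 0 <= y t.
Proof.
move=> sol Dt; have [k0 _ _ _] := sol; move: k0; rewrite le_eqVlt => /orP[/eqP k0|k0].
  by rewrite -k0 in sol; rewrite (closing_y_zero sol Dt).
by apply/ltW/(closing_y_pos sol).
Qed.

Lemma closing_r_lim k T f A y z : closing_solution k T f A y z ->
  A t / z t @[t --> 0^'+] --> (1 : R).
Proof.
move=> [_ _ _ [_ cA _ cz _]]; apply: (@cvg_right_lim _ _ (1 * 1^-1)); last by rewrite invr1 mulr1.
by apply: cvgM => //; apply: cvgV => //; exact: oner_neq0.
Qed.

(** Completing the square, [E = r - 2 k^2] satisfies [E' >= 2 y^2 / (z f) E], with a limit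
    [1 - 2 k^2 >= 0] at the zero section. In the critical case this limit is 0, hence the Gronwall
    argument from the singular end; it needs the coefficient to be bounded although [f] tends to 0,
    which follows from the limit of [y / f]. *)
Lemma closing_r_excess k T f A y z t : closing_solution k T f A y z -> 2 * k ^+ 2 <= 1 ->
  oitv 0%:E T t -> 0 <= A t / z t - 2 * k ^+ 2.
Proof.
move=> sol k1 Dt; have [_ _ red [_ _ cy cz cyf]] := sol; have t0 := oitv0_gt0 Dt.
have cr := closing_r_lim sol.
(* [2 y^2 / (z f)] is bounded near 0, hence on all of ]0, t] *)
have [s /andP[s0 st] hs] : exists2 s, 0 < s < t & forall x, 0 < x <= s -> 2 * y x ^+ 2 / (z x * f x) <= 1.
  have h : \forall x \near 0^'+, (k - 1 < y x / f x < k + 1 /\ 0 - (2 * k + 2)^-1 < y x < 0 + (2 * k + 2)^-1) .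
    apply: filterI; first exact: near_lim cyf ltr01.
    apply: near_lim cy _; rewrite invr_gt0; have [] := sol; rlra.
  move: h; rewrite near_withinE => /nbhs_ballP [e /= e0 he].
  exists (Num.min (t / 2) (e / 2)).
    rewrite lt_min gt_min; apply/andP; split; last by apply/orP; left; rlra.
    by apply/andP; split; rlra.
  move=> x /andP[x0]; rewrite le_min => /andP[x1 x2].
  have [||h1 h2] := he x; [by rewrite /ball /= sub0r normrN gtr0_norm; rlra|by []|].
  have [|fx Ax zx zy _] := red x; first by apply: (oitv0_sub Dt); rlra.
  have z1 : 1 <= z x by apply: (reduced_z_ge1 red); apply: (oitv0_sub Dt); rlra.
  have y0 : 0 <= y x by apply: (closing_y_ge0 sol); apply: (oitv0_sub Dt); rlra.
  have [k0 _ _ _] := sol.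
  have -> : 2 * y x ^+ 2 / (z x * f x) = 2 * (y x / f x) * y x / z x.
    by field; rewrite !gt_eqF.
  rewrite ler_pdivrMr // mul1r; apply: le_trans z1.
  have q : (2 * k + 2) * y x <= 1.
    rewrite mulrC -ler_pdivlMr; last by rlra.
    by rewrite mul1r; rlra.
  by apply: le_trans q; rewrite ler_wpM2r //; rlra.
have [C C0 hC] : exists2 C, 0 <= C & forall x, 0 < x <= t -> 2 * y x ^+ 2 / (z x * f x) <= C.
  have D x : s <= x <= t -> oitv 0%:E T x by move=> hx; apply: (oitv0_sub Dt); rlra.
  have [||m hm1 hm2] := @EVT_max R (fun x => 2 * y x ^+ 2 / (z x * f x)) s t.
  - exact: ltW.
  - apply: derivable_within_continuous => x; rewrite in_itv /= => /D /red [fx Ax zx _ [df dA dy dz]].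
    by eapply der_derivable; der; rewrite mulf_neq0 // gt_eqF.
  exists (Num.max 1 (2 * y m ^+ 2 / (z m * f m))); first by rewrite le_max ler01.
  move=> x /andP[x0 xt]; rewrite le_max; have [xs|sx] := leP x s.
    by rewrite hs // x0.
  by rewrite hm2 ?orbT // in_itv /= xt ltW.
apply: (@ge0_from_limit _ (fun x => A x / z x - 2 * k ^+ 2)
   (fun x => (f x ^+ 2 - 4 * k * y x * f x + 2 * (A x / z x) * y x ^+ 2) / (z x * f x)) C 0 t) => //.
- move=> x hx; have Dx : oitv 0%:E T x by exact: oitv0_sub hx.
  have h := reduced_r_der red Dx.
  have {}h : is_der (fun x => A x / z x - 2 * k ^+ 2) x (((f x ^+ 2 - 4 * k * y x * f x + 2 * (A x / z x) * y x ^+ 2) / (z x * f x)) + - 0).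
    by apply: derD h _; apply: derN; exact: der_cst.
  by move/der_eq: h; apply; rewrite oppr0 addr0.
- move=> x hx Ex; have Dx : oitv 0%:E T x by exact: oitv0_sub hx.
  have [fx Ax zx _ _] := red x Dx.
  apply: (@le_trans _ _ (2 * y x ^+ 2 / (z x * f x) * (A x / z x - 2 * k ^+ 2))).
    by rewrite ler_nM2r // hC.
  have -> : (f x ^+ 2 - 4 * k * y x * f x + 2 * (A x / z x) * y x ^+ 2) / (z x * f x) =
    (f x - 2 * k * y x) ^+ 2 / (z x * f x) + 2 * y x ^+ 2 / (z x * f x) * (A x / z x - 2 * k ^+ 2).
    by field; rewrite !gt_eqF.
  by rewrite lerDr divr_ge0 ?sqr_ge0 // mulr_ge0 ?ltW.
- move=> e e0; have [x hx1 hx2] := pick_lim t0 cr e0.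
  by exists x => //; rlra.
Qed.

Lemma closing_r_nondecr k T f A y z s t : closing_solution k T f A y z -> 2 * k ^+ 2 <= 1 ->
  0 < s <= t -> oitv 0%:E T t -> A s / z s <= A t / z t.
Proof.
move=> sol k1 /andP[s0 st] Dt; have [_ _ red _] := sol.
have D x : s <= x <= t -> oitv 0%:E T x by move=> hx; apply: (oitv0_sub Dt); rlra.
apply: (@ge0_der_le _ (fun x => A x / z x) _ s t st (fun x hx => reduced_r_der red (D x hx))).
move=> x /D Dx; have [fx Ax zx _ _] := red x Dx; have h := closing_r_excess sol k1 Dx.
have -> : f x ^+ 2 - 4 * k * y x * f x + 2 * (A x / z x) * y x ^+ 2 =
  (f x - 2 * k * y x) ^+ 2 + 2 * (A x / z x - 2 * k ^+ 2) * y x ^+ 2 by ring.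
rewrite divr_ge0 ?mulr_ge0 ?(ltW fx) ?(ltW zx) // addr_ge0 ?sqr_ge0 //.
by apply: mulr_ge0; rewrite ?sqr_ge0 //; apply: mulr_ge0.
Qed.

Lemma closing_r_ge1 k T f A y z t : closing_solution k T f A y z -> 2 * k ^+ 2 <= 1 ->
  oitv 0%:E T t -> 1 <= A t / z t.
Proof.
move=> sol k1 Dt; have t0 := oitv0_gt0 Dt.
apply/ler_addgt0Pr => e e0; have [s /andP[s0 st] hs] := pick_lim t0 (closing_r_lim sol) e0.
have := @closing_r_nondecr _ _ _ _ _ _ s t sol k1 _ Dt; rewrite s0 ltW //= => /(_ isT); rlra.
Qed.

Lemma z_bounds k D f A y z t : reduced k D f A y z -> D t -> 0 <= y t ->
  [/\ 1 <= z t + y t, y t <= z t, z t <= z t + y t & z t - y t = (z t + y t)^-1].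
Proof.
move=> red Dt y0; have [f0 A0 z0 zy _] := red t Dt; have z1 := reduced_z_ge1 red Dt.
split; try rlra.
  by have [//|yz] := leP (y t) (z t); rnra.
have h : (z t - y t) * (z t + y t) = 1 by rewrite -[RHS](addrK (y t ^+ 2)) -zy; ring.
by rewrite -[LHS](mulfK (x := z t + y t)) ?h ?mul1r // gt_eqF //; rlra.
Qed.

(** Everything is controlled by a lower bound on [r = A / z]. The logarithmic derivative of [z + y]
    is [hdot <= 3 k / rho]; then [f' <= z + k f / rho], since [y / A <= 1 / rho]; then [A' <= f].
    From below, [A >= rho z >= rho], and [f] is bounded because the product [f A] increases while
    [A] is bounded above. *)
Lemma closing_compact k (T rho s : R) f A y z : closing_solution k T%:E f A y z -> 0 < s < T ->
  0 < rho -> (forall t, s <= t < T -> rho <= A t / z t) ->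
  exists m M : R, 0 < m /\ forall t, s <= t < T ->
    [/\ m <= f t <= M, m <= A t <= M & z t + y t <= M].
Proof.
move=> sol /andP[s0 sT] rho0 hrho; have [k0 _ red _] := sol.
have D t : s <= t < T -> oitv 0%:E T%:E t by move=> ht; rewrite /oitv /= !lte_fin; rlra.
have Ds : oitv 0%:E T%:E s by apply: D; rlra.
have [fs As zs _ _] := red s Ds.
have hz t : s <= t < T -> z t + y t <= (z s + y s) * expR (3 * k / rho * (t - s)).
  move=> ht; apply: (@gronwall _ (fun x => z x + y x)
    (fun x => y x * hdot k f A y z x + z x * hdot k f A y z x)); first by rlra.
    by move=> x hx; have [_ _ _ _ [_ _ hy hz]] := red x (D x ltac:(rlra)); apply: derD.
  move=> x hx; have Dx := D x ltac:(rlra); have [fx Ax zx _ _] := red x Dx.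
  have y0 := closing_y_ge0 sol Dx.
  rewrite -mulrDl mulrC (addrC (y x)) ler_wpM2r //; first by rlra.
  have rx := hrho x ltac:(rlra).
  have h1 : 0 <= y x / f x by rewrite divr_ge0 // ltW.
  have -> : hdot k f A y z x = 3 * k / (A x / z x) - 2 * (y x / f x).
    by rewrite /hdot; field; rewrite !gt_eqF.
  have : 3 * k / (A x / z x) <= 3 * k / rho.
    by rewrite ler_wpM2l ?mulr_ge0 // lef_pV2 // posrE divr_gt0.
  by rlra.
pose Z := (z s + y s) * expR (3 * k / rho * (T - s)).
have hZ t : s <= t < T -> z t + y t <= Z.
  move=> ht; apply: le_trans (hz t ht) _; have := closing_y_ge0 sol Ds => ys.
  rewrite ler_wpM2l //; first by rlra.
  by rewrite ler_expR ler_wpM2l ?divr_ge0 ?mulr_ge0 // ?(ltW rho0) //; rlra.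
have Z1 : 1 <= Z.
  have ys := closing_y_ge0 sol Ds.
  by apply: le_trans (hZ s _); [have [] := z_bounds red Ds ys|rlra].
pose K := 1 + k / rho.
have K0 : 1 <= K by rewrite lerDl divr_ge0 // ltW.
have hf t : s <= t < T -> f t + Z <= (f s + Z) * expR (K * (t - s)).
  move=> ht; apply: (@gronwall _ (fun x => f x + Z) (fun x => fdot k f A y z x)); first by rlra.
    move=> x hx; have [_ _ _ _ [h _ _ _]] := red x (D x ltac:(rlra)).
    by rewrite -[fdot _ _ _ _ _ _]addr0; apply: derD => //; exact: der_cst.
  move=> x hx; have Dx := D x ltac:(rlra); have [fx Ax zx _ _] := red x Dx.
  have y0 := closing_y_ge0 sol Dx; have [_ yz zz _] := z_bounds red Dx y0.
  have zZ := hZ x ltac:(rlra); have rx := hrho x ltac:(rlra).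
  have h1 : y x / A x <= rho^-1.
    have Az : rho * z x <= A x by rewrite -ler_pdivlMr.
    by rewrite ler_pdivrMr // mulrC ler_pdivlMr //; rnra.
  have h2 : 0 <= f x ^+ 2 / (2 * A x) by rewrite divr_ge0 ?sqr_ge0 // mulr_ge0 // ltW.
  rewrite /fdot.
  have -> : k * f x * y x / A x = (k * f x) * (y x / A x) by ring.
  have h3 : (k * f x) * (y x / A x) <= (k * f x) * rho^-1.
    by rewrite ler_wpM2l // mulr_ge0 // ltW.
  have h4 : 0 <= k / rho * Z by rewrite mulr_ge0 ?divr_ge0 // ?(ltW rho0) //; rlra.
  rewrite /K; have -> : (1 + k / rho) * (f x + Z) = f x + Z + k * f x * rho^-1 + k / rho * Z by ring.
  by rlra.
pose M1 := (f s + Z) * expR (K * (T - s)).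
have hfM t : s <= t < T -> f t <= M1.
  move=> ht; apply: (@le_trans _ _ (f t + Z)); first by rlra.
  apply: le_trans (hf t ht) _; rewrite ler_wpM2l //; first by rlra.
  by rewrite ler_expR ler_wpM2l //; rlra.
have M10 : 0 < M1 by apply: lt_le_trans fs _; apply: hfM; rlra.
pose M2 := A s + M1 * (T - s).
have hA t : s <= t < T -> A t <= M2.
  move=> ht; apply: (@le_trans _ _ (A s + M1 * (t - s))); last first.
    by rewrite lerD2l ler_wpM2l ?(ltW M10) //; rlra.
  have : A t - M1 * (t - s) <= A s - M1 * (s - s).
    apply: (@le0_der_ge _ (fun x => A x - M1 * (x - s)) (fun x => f x - k * y x - M1)); first by rlra.
      move=> x hx; have [_ _ _ _ [_ h _ _]] := red x (D x ltac:(rlra)).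
      by der_eq; ring.
    move=> x hx; have Dx := D x ltac:(rlra); have := closing_y_ge0 sol Dx => y0.
    have := hfM x ltac:(rlra); have : 0 <= k * y x by exact: mulr_ge0.
    by rlra.
  by rewrite subrr mulr0; rlra.
have M20 : 0 < M2 by apply: lt_le_trans As _; apply: hA; rlra.
have hAm t : s <= t < T -> rho <= A t.
  move=> ht; have := hrho t ht; have Dt := D t ht; have [_ _ zt _ _] := red t Dt.
  by rewrite ler_pdivlMr // => /(le_trans _); apply; rewrite ler_peMr ?(ltW rho0) // (reduced_z_ge1 red).
have hp t : s <= t < T -> f s * A s <= f t * A t.
  move=> ht; apply: (@ge0_der_le _ (fun x => f x * A x) (fun x => z x * A x + f x ^+ 2 / 2)).
  - by rlra.
  - by move=> x hx; apply: (reduced_p_der red); apply: D; rlra.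
  - move=> x hx; have [fx Ax zx _ _] := red x (D x ltac:(rlra)).
    by rewrite addr_ge0 ?divr_ge0 ?sqr_ge0 // mulr_ge0 // ltW.
have hfm t : s <= t < T -> f s * A s / M2 <= f t.
  move=> ht; rewrite ler_pdivrMr //; apply: le_trans (hp t ht) _.
  have [fx _ _ _ _] := red t (D t ht).
  by rewrite ler_wpM2l ?(ltW fx) // hA.
exists (Num.min rho (f s * A s / M2)), (Num.max (Num.max M1 M2) Z).
split; first by rewrite lt_min rho0 !mulr_gt0 ?invr_gt0.
move=> t ht; rewrite !le_max !ge_min (hfm t ht) (hfM t ht) (hAm t ht) (hA t ht) (hZ t ht) !orbT.
by split.
Qed.

End Dynamics.

(** * The critical and the supercritical case *)

Section Dichotomy.
Context {R : realType}.
Implicit Types (k t a b : R) (f A y z : R -> R) (T : \bar R).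

Lemma near_right_interval (P : R -> Prop) (T : R) : 0 < T -> (\forall t \near 0^'+, P t) ->
  exists2 s, 0 < s < T & forall x, 0 < x <= s -> P x.
Proof.
move=> T0; rewrite near_withinE => /nbhs_ballP [e /= e0 he].
exists (Num.min (T / 2) (e / 2)).
  rewrite lt_min gt_min; apply/andP; split; last by apply/orP; left; rlra.
  by apply/andP; split; rlra.
move=> x /andP[x0]; rewrite le_min => /andP[x1 x2]; apply: he => //.
by rewrite /ball /= sub0r normrN gtr0_norm; rlra.
Qed.

Lemma bounded_from_limit (F : R -> R) (l b : R) : 0 < b ->
  (forall t, 0 < t <= b -> {for t, continuous F}) -> F t @[t --> 0^'+] --> l ->
  exists2 C, 0 < C & forall t, 0 < t <= b -> F t <= C.
Proof.
move=> b0 cF hl; have [s /andP[s0 sb] hs] := near_right_interval b0 (near_lim hl ltr01).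
have [||m hm1 hm2] := @EVT_max R F s b; first exact: ltW.
  apply: continuous_in_subspaceT => x; rewrite inE /= in_itv /= => /andP[sx xb].
  by apply: cF; rlra.
exists (Num.max 1 (Num.max (l + 1) (F m))); first by rewrite lt_max ltr01.
move=> t /andP[t0 tb]; rewrite !le_max; have [ts|st] := leP t s.
  by have /andP[_ /ltW ->] := hs t ltac:(rlra); rewrite orbT.
by rewrite hm2 ?orbT // in_itv /= tb ltW.
Qed.

(* [Q = A - 2 k^2 z] and [P = f - 2 k y] vanish to first order at the zero
   section, and [Q >= 0], so a Gronwall estimate for [Q + P^2] forces both to vanish. *)
Lemma critical_relations k T f A y z t : closing_solution k T f A y z -> 2 * k ^+ 2 = 1 ->
  oitv 0%:E T t -> f t = 2 * k * y t /\ A t = 2 * k ^+ 2 * z t.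
Proof.
move=> sol kc Dt; have [k0 _ red [cf cA cy cz _]] := sol; have t0 := oitv0_gt0 Dt.
have kle : 2 * k ^+ 2 <= 1 by rewrite kc.
have k1 : k <= 1 by rnra.
have D x : 0 < x <= t -> oitv 0%:E T x by exact: oitv0_sub.
have [C C0 hC] : exists2 C, 0 < C & forall x, 0 < x <= t -> f x <= C.
  apply: (bounded_from_limit t0 _ cf) => x /D /red [_ _ _ _ [df _ _ _]].
  exact: der_cont df.
pose P x := f x - 2 * k * y x.
pose Q x := A x - 2 * k ^+ 2 * z x.
have Q0 x : 0 < x <= t -> 0 <= Q x.
  move=> /D Dx; have h := closing_r_excess sol kle Dx; have [_ _ zx _ _] := red x Dx.
  have -> : Q x = (A x / z x - 2 * k ^+ 2) * z x by rewrite /Q; field; rewrite gt_eqF.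
  by rewrite mulr_ge0 // ltW.
pose E x := Q x + P x ^+ 2.
have cE : E x @[x --> 0^'+] --> (0 : R).
  apply: (@cvg_right_lim _ _ ((1 - 2 * k ^+ 2 * 1) + (0 - 2 * k * 0) * (0 - 2 * k * 0))); last by rewrite kc; ring.
  apply: cvgD; first exact: cvgB cA (cvgM (cvg_cst _) cz).
  rewrite /P; under eq_fun do rewrite expr2.
  have cP := cvgB cf (cvgM (cvg_cst (2 * k)) cy); apply: cvgM; exact: cP.
(* In the expansion of [E'] below, the two terms in [P^2] are nonpositive. The third term is at most
   [3 Q] as [k <= 1] and [y <= A], and the fourth at most [6 C Q] as [z <= A] and [P <= f <= C].
   This gives the rate [3 + 6 C]. *)
have Egrow x : 0 < x <= t -> E t <= E x * expR ((3 + 6 * C) * (t - x)).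
  move=> /andP[x0 xt].
  apply: (@gronwall _ E (fun s => ((f s - k * y s) - 2 * k ^+ 2 * (y s * hdot k f A y z s)) +
     2 * P s * (fdot k f A y z s - 2 * k * (z s * hdot k f A y z s)))) => //.
    move=> s hs; have [_ _ _ _ [df dA dy dz]] := red s (D s ltac:(rlra)).
    by rewrite /E /Q /P; der_eq; rewrite expr1; ring.
  move=> s hs; have hs' : 0 < s <= t by rlra.
  have Ds := D s hs'; have [fs As zs zy _] := red s Ds.
  have z1 := reduced_z_ge1 red Ds; have y0 := closing_y_ge0 sol Ds.
  have [_ yz _ _] := z_bounds red Ds y0; have Qs := Q0 s hs'.
  have r1 := closing_r_ge1 sol kle Ds; have fC := hC s hs'.
  have zA : z s / A s <= 1 by rewrite ler_pdivrMr // mul1r; move: r1; rewrite ler_pdivlMr // mul1r.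
  have yA : y s / A s <= 1 by apply: le_trans zA; rewrite ler_wpM2r // invr_ge0 ltW.
  have -> : (f s - k * y s - 2 * k ^+ 2 * (y s * hdot k f A y z s)) +
     2 * P s * (fdot k f A y z s - 2 * k * (z s * hdot k f A y z s)) =
     P s ^+ 2 / f s * (1 - 4 * z s) - P s ^+ 2 * (f s / A s) + 3 * k * (y s / A s) * Q s + 6 * (z s / A s) * P s * Q s.
    rewrite /fdot /hdot /P /Q.
    have -> : f s - k * y s = f s - k * y s + 0 by ring.
    have : (z s ^+ 2 - 1 - y s ^+ 2) = 0 by rewrite zy; ring.
    by move=> h; field; rewrite !gt_eqF.
  have h1 : P s ^+ 2 / f s * (1 - 4 * z s) <= 0.
    by rewrite mulr_ge0_le0 ?divr_ge0 ?sqr_ge0 ?(ltW fs) //; rlra.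
  have h2 : 0 <= P s ^+ 2 * (f s / A s) by rewrite mulr_ge0 ?sqr_ge0 // divr_ge0 // ltW.
  have h3 : 3 * k * (y s / A s) * Q s <= 3 * Q s.
    rewrite ler_wpM2r //; have h : 0 <= y s / A s by rewrite divr_ge0 // ltW.
    by rnra.
  have h4 : 6 * (z s / A s) * P s * Q s <= 6 * C * Q s.
    rewrite ler_wpM2r // -mulrA ler_wpM2l //.
    have h : 0 <= z s / A s by rewrite divr_ge0 // ltW.
    have PC : P s <= C by rewrite /P; have : 0 <= 2 * k * y s by [rewrite !mulr_ge0]; rlra.
    have [Pn|Pp] := leP (P s) 0; first by apply: (@le_trans _ _ 0); [rewrite mulr_ge0_le0|rewrite ltW].
    by rnra.
  have h5 : 0 <= (3 + 6 * C) * P s ^+ 2 by rewrite mulr_ge0 ?sqr_ge0 //; rlra.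
  have -> : (3 + 6 * C) * E s = 3 * Q s + 6 * C * Q s + (3 + 6 * C) * P s ^+ 2 by rewrite /E; ring.
  by rlra.
have E0 : E t <= 0.
  apply/ler_addgt0Pr => e e0; rewrite add0r.
  have ee : 0 < e / expR ((3 + 6 * C) * t) by rewrite divr_gt0 ?expR_gt0.
  have [x /andP[x0 xt] hx] := pick_lim t0 cE ee.
  apply: le_trans (Egrow x _) _; first by rewrite x0 ltW.
  apply: (@le_trans _ _ (e / expR ((3 + 6 * C) * t) * expR ((3 + 6 * C) * t))); last first.
    by rewrite divfK // gt_eqF ?expR_gt0.
  apply: ler_pM; rewrite ?expR_ge0 //.
  - by rewrite /E addr_ge0 ?sqr_ge0 // Q0 // x0 ltW.
  - by rlra.
  - by rewrite ler_expR ler_wpM2l //; rlra.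
have Qt := Q0 t ltac:(rlra); have P2 := sqr_ge0 (P t).
have Q00 : Q t = 0 by rewrite /E in E0; rlra.
have : P t ^+ 2 = 0 by rewrite /E in E0; rlra.
move/eqP; rewrite sqrf_eq0 => /eqP; rewrite /P => hP.
by split; [rlra|rewrite /Q in Q00; rlra].
Qed.

(** On the critical relations [hdot] is the constant [- 1 / k + 3 / (2 k) = 1 / (2 k)], and [z + y]
    is the exponential of the primitive of [hdot] that vanishes at the zero section. *)
Lemma critical_exp k T f A y z t : closing_solution k T f A y z -> 2 * k ^+ 2 = 1 ->
  oitv 0%:E T t -> z t + y t = expR (t / (2 * k)).
Proof.
move=> sol kc Dt; have [k0 _ red [cf cA cy cz _]] := sol; have t0 := oitv0_gt0 Dt.
have kp : 0 < k by rewrite lt_neqAle k0 andbT; apply/eqP => h; move: kc; rewrite -h expr0n mulr0; rlra.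
have D x : 0 < x <= t -> oitv 0%:E T x by exact: oitv0_sub.
pose w x := (z x + y x) * expR (- (2 * k)^-1 * (x - 0)).
have dw x : 0 < x <= t -> is_der w x 0.
  move=> /D Dx; have [fx Ax zx _ [_ _ dy dz]] := red x Dx.
  have yx := closing_y_pos sol kp Dx; have [hf hA] := critical_relations sol kc Dx.
  have he := @expR_affine_der R (- (2 * k)^-1) 0 x.
  rewrite /w; apply: der_eq; first by apply: derM he; apply: derD; [exact: dz|exact: dy].
  have -> : hdot k f A y z x = (2 * k)^-1.
    rewrite /hdot hf hA; field; rewrite !gt_eqF //.
  by ring.
have cw : w x @[x --> 0^'+] --> (1 : R).
  apply: (@cvg_right_lim _ _ ((1 + 0) * expR (- (2 * k)^-1 * (0 - 0)))); last by rewrite subrr mulr0 expR0; ring.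
  apply: cvgM; first exact: cvgD.
  by apply: cvg_right_cont; apply: der_cont (expR_affine_der _ _ _).
have : w t = 1.
  apply: (@cvg_right_uniq _ w) => //.
  apply: (cvg_right_ext t0 (F := fun=> w t)); last exact: cvg_cst.
  move=> x /andP[x0 xt]; apply/esym/der0_eq; first exact: ltW.
  by move=> s hs; apply: dw; rlra.
rewrite /w subr0 mulNr expRN => h.
have e0 : expR ((2 * k)^-1 * t) != 0 by rewrite gt_eqF ?expR_gt0.
by have := congr1 (fun v => v * expR ((2 * k)^-1 * t)) h; rewrite /= divfK // mul1r => ->; rewrite mulrC.
Qed.

(* With [r = A / z], this is [- r' z / f]: for [2 k^2 > 1] it starts positive and
   stays bounded below, which forces [r] to vanish in finite time. *)
Definition mfun k f A y z t : R := 4 * k * (y t / f t) - 1 - 2 * (A t / z t) * (y t / f t) ^+ 2.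

(** With [k] eliminated in favour of [m], the derivative is a nonnegative term plus a multiple of
    [(g - 2 m)^2 + 4 m - 5 m^2], so it is visibly positive as long as [0 < m < 4 / 5]. *)
Lemma mfun_der k D f A y z t : reduced k D f A y z -> D t -> y t != 0 ->
  let n := y t / f t in let r := A t / z t in let q := f t ^+ 2 / (A t * z t) in
  let m := mfun k f A y z t in let g := 1 - 2 * r * n ^+ 2 in
  is_der (mfun k f A y z) t
    (z t / f t * (3 * (m + g) ^+ 2 / (4 * n ^+ 2 * r) + q / 4 * ((g - 2 * m) ^+ 2 + 4 * m - 5 * m ^+ 2))).
Proof.
move=> red Dt yn; have [fx Ax zx zy [df dA dy dz]] := red t Dt; rewrite /=.
have [nf nA nz] : [/\ f t != 0, A t != 0 & z t != 0] by rewrite !gt_eqF.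
rewrite {1}/mfun; der_eq; rewrite ?expr1 //.
rewrite /mfun /fdot /hdot.
by field; rewrite nf nA nz yn.
Qed.

(** A logistic equation for [q = f^2 / (A z)]: since [(y / z)^2] lies between 0 and 1, [q] increases
    when below 1 and decreases when above 2. *)
Lemma qfun_der k D f A y z t : reduced k D f A y z -> D t ->
  is_der (fun t => f t ^+ 2 / (A t * z t)) t
   (2 * (f t ^+ 2 / (A t * z t)) * (z t / f t) * (1 - f t ^+ 2 / (A t * z t) + (y t / z t) ^+ 2)).
Proof.
move=> red Dt; have [fx Ax zx zy [df dA dy dz]] := red t Dt.
have [nf nA nz] : [/\ f t != 0, A t != 0 & z t != 0] by rewrite !gt_eqF.
der_eq; first by rewrite mulf_neq0.
rewrite expr1 /fdot /hdot.
by field; rewrite nf nA nz.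
Qed.

Lemma supercritical_bounds k T f A y z s : closing_solution k T f A y z -> 1 < 2 * k ^+ 2 ->
  oitv 0%:E T s -> exists d q0 q1 : R, [/\ 0 < d, 0 < q0 &
    forall t, s <= t -> oitv 0%:E T t ->
    d <= mfun k f A y z t /\ q0 <= f t ^+ 2 / (A t * z t) <= q1].
Proof.
move=> sol kc Ds; have [k0 _ red [cf cA cy cz cyf]] := sol; have s0 := oitv0_gt0 Ds.
have kp : 0 < k by rewrite lt_neqAle k0 andbT; apply/eqP => h; move: kc; rewrite -h expr0n mulr0; rlra.
have cm : mfun k f A y z t @[t --> 0^'+] --> 2 * k ^+ 2 - 1.
  apply: (@cvg_right_lim _ _ (4 * k * k - 1 - 2 * 1 * (k * k))); last by ring.
  rewrite /mfun; under eq_fun do rewrite expr2.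
  apply: cvgB; first by apply: cvgB; [apply: cvgM => //; exact: cvg_cst|exact: cvg_cst].
  apply: cvgM; last exact: cvgM.
  by apply: cvgM; [exact: cvg_cst|exact: closing_r_lim sol].
have e0 : 0 < 2 * k ^+ 2 - 1 by rlra.
have [s1 /andP[s10 s1s] hs1] := pick_lim s0 cm e0.
have D t x : oitv 0%:E T t -> s1 <= x <= t -> oitv 0%:E T x.
  by move=> Dt hx; apply: (oitv0_sub Dt); rlra.
have Ds1 : oitv 0%:E T s1 by apply: (D s) => //; rlra.
have [fs As zs _ _] := red s1 Ds1.
pose qf t := f t ^+ 2 / (A t * z t).
have q_gt0 t : oitv 0%:E T t -> 0 < qf t.
  by move=> /red [ft At zt _ _]; rewrite divr_gt0 ?exprn_gt0 // mulr_gt0.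
have m1 : 0 < mfun k f A y z s1 by rlra.
(* Below [4 / 5] the derivative computed in [mfun_der] is positive, so [mfun] cannot come down to
   [d]. Its positivity at [s1] comes from the limit [2 k^2 - 1] at the zero section. *)
pose d := Num.min (mfun k f A y z s1) (4 / 5) / 2.
have d0 : 0 < d by rewrite divr_gt0 // lt_min m1; rlra.
have [d1 d2] : d < mfun k f A y z s1 /\ d < 4 / 5.
  have : Num.min (mfun k f A y z s1) (4 / 5) <= mfun k f A y z s1 by rewrite ge_min lexx.
  have : Num.min (mfun k f A y z s1) (4 / 5) <= 4 / 5 by rewrite ge_min lexx orbT.
  by move: d0; rewrite /d; rlra.
exists d, (Num.min (qf s1) 1), (Num.max (qf s1) 2); split => //.
  by rewrite lt_min q_gt0 // ltr01.
move=> t st Dt; split; [|apply/andP; split].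
- rewrite -subr_ge0; apply: ltW.
  apply: (@pos_barrier _ (fun x => mfun k f A y z x - d) (fun x =>
    let n := y x / f x in let r := A x / z x in let q := f x ^+ 2 / (A x * z x) in
    let m := mfun k f A y z x in let g := 1 - 2 * r * n ^+ 2 in
    z x / f x * (3 * (m + g) ^+ 2 / (4 * n ^+ 2 * r) + q / 4 * ((g - 2 * m) ^+ 2 + 4 * m - 5 * m ^+ 2)) + - 0) s1 t).
  + move=> x /(D _ _ Dt) Dx; apply: derD; last by apply: derN; exact: der_cst.
    by apply: (mfun_der red Dx); rewrite gt_eqF // (closing_y_pos sol).
  + by rewrite subr_gt0.
  + move=> x hx _ hm; have Dx := D _ x Dt ltac:(rlra).
    have [fx Ax zx _ _] := red x Dx; have yx := closing_y_pos sol kp Dx.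
    have mE : mfun k f A y z x = d by rlra.
    rewrite /= mE oppr0 addr0 mulr_gt0 ?divr_gt0 //.
    apply: ltr_wpDl.
      have h : 0 <= A x / z x by rewrite divr_ge0 // ltW.
      apply: divr_ge0; first by rewrite mulr_ge0 ?sqr_ge0.
      by apply: mulr_ge0 => //; rewrite mulr_ge0 ?sqr_ge0.
    rewrite mulr_gt0 ?(divr_gt0 (q_gt0 x Dx)) //.
    have := sqr_ge0 (1 - 2 * (A x / z x) * (y x / f x) ^+ 2 - 2 * d); rnra.
  + by rlra.
- apply: (@barrier_ge _ qf _ _ s1 t _ (fun x hx => qfun_der red (D _ x Dt hx))); first by rlra.
    by rewrite ge_min lexx.
  move=> x hx; rewrite lt_min => /andP[_ q1]; have Dx := D _ x Dt ltac:(rlra).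
  have [fx Ax zx _ _] := red x Dx.
  have hq0 : 0 <= f x ^+ 2 / (A x * z x) := ltW (q_gt0 x Dx).
  have hzf : 0 <= z x / f x by rewrite divr_ge0 // ltW.
  apply: mulr_ge0; first by rewrite mulr_ge0 // mulr_ge0.
  by have := sqr_ge0 (y x / z x); rewrite /qf in q1; rlra.
- apply: (@barrier_le _ qf _ _ s1 t _ (fun x hx => qfun_der red (D _ x Dt hx))); first by rlra.
    by rewrite le_max lexx.
  move=> x hx; rewrite gt_max => /andP[_ q1]; have Dx := D _ x Dt ltac:(rlra).
  have [fx Ax zx _ _] := red x Dx; have y0 := closing_y_ge0 sol Dx.
  have [_ yz _ _] := z_bounds red Dx y0.
  have hq0 : 0 <= f x ^+ 2 / (A x * z x) := ltW (q_gt0 x Dx).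
  have hzf : 0 <= z x / f x by rewrite divr_ge0 // ltW.
  apply: mulr_ge0_le0; first by rewrite mulr_ge0 // mulr_ge0.
  have h : (y x / z x) ^+ 2 <= 1.
    by rewrite expr_le1 ?divr_ge0 ?(ltW zx) // ler_pdivrMr // mul1r.
  by rewrite /qf in q1; rlra.
Qed.

Lemma reduced_r_derm k D f A y z t : reduced k D f A y z -> D t ->
  is_der (fun t => A t / z t) t (- (f t / z t) * mfun k f A y z t).
Proof.
move=> red Dt; have [fx Ax zx _ _] := red t Dt.
move/der_eq: (reduced_r_der red Dt); apply; rewrite /mfun; field.
by rewrite !gt_eqF.
Qed.

(** With [q = f^2 / (A z) >= q0] one has [f / z >= sqrt (q0 r)], while [r' = - (f / z) mfun]. So the
    square root of [r] decreases at least at the rate [d sqrt q0 / 2], and would become negative. *)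
Lemma supercritical_finite k T f A y z : closing_solution k T f A y z -> 1 < 2 * k ^+ 2 ->
  (T < +oo)%E.
Proof.
move=> sol kc; have [k0 T0 red _] := sol.
case: T sol T0 red => [T||] // sol T0 red; first by rewrite ltry.
have Dp t : 0 < t -> oitv 0%:E +oo%E t by move=> h; rewrite /oitv /= lte_fin h ltry.
have [d [q0 [q1 [d0 q00 hb]]]] := supercritical_bounds sol kc (Dp 1 ltr01).
pose rho t := Num.sqrt (A t / z t).
have r0 t : 0 < t -> 0 < A t / z t by move=> /Dp /red [_ ? ? _ _]; rewrite divr_gt0.
pose C := d * Num.sqrt q0 / 2.
have C0 : 0 < C by rewrite !mulr_gt0 ?sqrtr_gt0.
pose t := 2 + rho 1 / C.
have rho1 : 0 <= rho 1 by exact: sqrtr_ge0.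
have t2 : 2 <= t by rewrite /t lerDl divr_ge0 // ltW.
have h : rho t - - C * t <= rho 1 - - C * 1.
  apply: (@le0_der_ge _ (fun x => rho x - - C * x) (fun x =>
     - (f x / z x) * mfun k f A y z x / (2 * rho x) + C)); first by rlra.
    move=> x hx; have x0 : 0 < x by rlra.
    have h1 := reduced_r_derm red (Dp x x0); 
    have h2 : is_der rho x _ := @der_sqrt _ (fun t => A t / z t) x _ (r0 x x0) h1.
    by der_eq; rewrite /rho; ring.
  move=> x hx; have x0 : 0 < x by rlra.
  have [fx Ax zx _ _] := red x (Dp x x0).
  have [|hm hq] := hb x _ (Dp x x0); first by rlra.
  have rx : 0 < rho x by rewrite sqrtr_gt0 r0.
  have fz : Num.sqrt q0 * rho x <= f x / z x.
    have fz0 : 0 <= f x / z x by rewrite divr_ge0 // ltW.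
    rewrite -(ger0_norm fz0) -sqrtr_sqr /rho -(sqrtrM _ (ltW q00)) ler_wsqrtr //.
    have -> : (f x / z x) ^+ 2 = f x ^+ 2 / (A x * z x) * (A x / z x).
      by field; rewrite !gt_eqF.
    by rewrite ler_wpM2r ?(ltW (r0 x x0)) //; case/andP: hq.
  rewrite mulNr mulNr addrC subr_le0 ler_pdivlMr ?mulr_gt0 //.
  have -> : C * (2 * rho x) = d * (Num.sqrt q0 * rho x) by rewrite /C; field.
  have h1 : 0 <= Num.sqrt q0 * rho x by rewrite mulr_ge0 ?sqrtr_ge0.
  have h2 := ler_pM (ltW d0) h1 hm fz.
  by apply: le_trans h2 _; rewrite mulrC.
have Ct : C * t = 2 * C + rho 1 by rewrite /t; field; rewrite gt_eqF.
by exfalso; have := sqrtr_ge0 (A t / z t); rewrite -/(rho t); rlra.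
Qed.

End Dichotomy.

(** * Maximal existence time and completeness *)

Section Completeness.
Context {R : realType}.
Implicit Types (c k t a b : R) (f : 'I_3 -> R -> R) (u : R -> R).

Lemma S_soliton_unbounded c (T t0 m M : R) f u : S_soliton 1 c T%:E f u ->
  t0 < T -> 0 < m -> ~ (forall t i, t0 < t < T -> m <= f i t <= M).
Proof.
move=> [[T0 hst] _ _ _ hmax] t0T m0 hb.
have [cc [ccsum ode hu _]] := steady_soliton_ode T0 hst.
rewrite lte_fin in T0.
have [T' [g [TT' odeg gf]]] := ode_extend T0 t0T m0 ode hb.
apply: (hmax T'%:E g (fun t => soliton_u cc (g^~ t))).
- by rewrite lte_fin.
- exact: (ode_steady_soliton ccsum odeg).
- move=> t ht; have ht' : 0 < t < T by move: ht; rewrite !lte_fin.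
  split=> [i|]; first exact: gf.
  by rewrite hu //; congr soliton_u; apply/funext => i; exact: gf.
Qed.

Lemma S_closing_solution c (T : \bar R) f u : S_soliton 1 c T f u ->
  exists (s : 'S_3) (cc : 'I_3 -> R) (g : 'I_3 -> R -> R), let k := `|c| / 3 in
  [/\ s 0 = 0 /\ (forall i, g i = f (s i)), [/\ cc 0 = 0, cc 1 = 3 * k & cc 2 = - (3 * k)],
     soliton_ode cc (oitv 0%:E T) g,
     forall t, oitv 0%:E T t -> u t = soliton_u cc (g^~ t) &
     closing_solution k T (g 0) (red_A g) (red_y g) (red_z g)].
Proof.
move=> hS; have [s [cc [s0 [c0 c1 c2] ode hu cl]]] := S_soliton_reduced hS.
have T0 : (0%:E < T)%E by case: hS => -[].
exists s, cc, (fun i => f (s i)); split; [by []|by []|exact: ode|exact: hu|].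
by split; [rewrite divr_ge0|exact: T0|exact: ode_reduced ode|exact: cl].
Qed.

(** By [closing_compact], such a bound would keep [f_1], [A] and [z + y] between positive constants,
    hence also [f_2^2 = A (z + y)] and [f_3^2 = A / (z + y)]; the solution would then extend beyond
    [T], against maximality. *)
Lemma S_soliton_r_not_bounded c (T rho s : R) f u (p : 'S_3) (cc : 'I_3 -> R) g :
  (forall i, g i = f (p i)) -> S_soliton 1 c T%:E f u ->
  soliton_ode cc (oitv 0%:E T%:E) g ->
  closing_solution (`|c| / 3) T%:E (g 0) (red_A g) (red_y g) (red_z g) ->
  0 < s < T -> 0 < rho -> ~ (forall t, s <= t < T -> rho <= red_A g t / red_z g t).
Proof.
move=> gE hS ode sol sT rho0 hrho; have [k0 _ red _] := sol.
have [m [M [m0 hb]]] := closing_compact sol sT rho0 hrho.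
have M0 : 0 < M by have [h _ _] := hb s ltac:(rlra); rlra.
pose m' := Num.min 1 (m / M).
have mM0 : 0 < m / M by rewrite divr_gt0.
have m'0 : 0 < m' by rewrite lt_min ltr01.
have [m'1 m'2] : m' <= 1 /\ m' <= m / M by rewrite /m' !ge_min !lexx orbT.
have sq_bound x (v : R) : 0 < x -> v <= x ^+ 2 -> m' <= v -> m' <= x.
  by move=> x0 h1 h2; have [|x1] := leP 1 x; [rlra|rnra].
have sq_bound' x (v : R) : 0 < x -> x ^+ 2 <= v -> x <= 1 + v.
  by move=> x0 h1; have := sqr_ge0 (x - 1); have := sqr_ge0 x; rnra.
apply: (@S_soliton_unbounded c T s (Num.min m' m) (1 + M * M + M + M) f u hS).
- by rlra.
- by rewrite lt_min m'0.
move=> t i ht; have ht' : s <= t < T by rlra.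
have Dt : oitv 0%:E T%:E t by rewrite /oitv /= !lte_fin; rlra.
have [gpos _] := ode t Dt; have [h0 hA hz] := hb t ht'.
have y0 := closing_y_ge0 sol Dt; have [zy1 _ _ zyV] := z_bounds red Dt y0.
have A0 : 0 < red_A g t by rlra.
have MM : 0 < M * M by rewrite mulr_gt0.
rewrite -(permKV p i) -gE; elim/I3P: (p^-1%g i).
- by rewrite ge_min; apply/andP; split; [apply/orP; right|]; rlra.
- have e := red_sq1 (gpos 1) (gpos 2); have g1 := gpos 1.
  have h1 : m <= g 1 t ^+ 2 by rewrite e; rnra.
  have h2 : g 1 t ^+ 2 <= M * M by rewrite e ler_pM //; rlra.
  have h3 := sq_bound' _ _ g1 h2.
  rewrite ge_min; apply/andP; split; last by rlra.
  apply/orP; left; apply: (sq_bound _ m g1 h1); apply: le_trans m'2 _.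
  have M1 : 1 <= M by rlra.
  by rewrite ler_pdivrMr // ler_peMr // ltW.
- have e := red_sq2 (gpos 1) (gpos 2); have g2 := gpos 2; rewrite zyV in e.
  have p0 : 0 < red_z g t + red_y g t by rlra.
  have h1 : m / M <= g 2 t ^+ 2.
    rewrite e; apply: ler_pM; rewrite ?invr_ge0 ?(ltW m0) ?(ltW M0) //; first by rlra.
    by rewrite lef_pV2 ?posrE.
  have h2 : g 2 t ^+ 2 <= M.
    by rewrite e ler_pdivrMr //; rnra.
  have h3 := sq_bound' _ _ g2 h2.
  rewrite ge_min; apply/andP; split; last by rlra.
  by apply/orP; left; exact: (sq_bound _ _ g2 h1 m'2).
Qed.

Lemma subcritical_complete c (T : \bar R) f u : S_soliton 1 c T f u ->
  c ^+ 2 <= 9 / 2 -> T = +oo%E.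
Proof.
move=> hS hc; have [s [cc [g [[s0 gE] _ ode _ sol]]]] := S_closing_solution hS.
have kle : 2 * (`|c| / 3) ^+ 2 <= 1.
  by rewrite expr_div_n -normrX ger0_norm ?sqr_ge0 //; rlra.
have [_ T0 _ _] := sol.
case: T hS ode sol T0 => [T||] // hS ode sol T0; rewrite lte_fin in T0.
exfalso; apply: (@S_soliton_r_not_bounded c T 1 (T / 2) f u s cc g gE hS ode sol); rewrite ?ltr01 //.
  by rlra.
move=> t ht; apply: (closing_r_ge1 sol kle); rewrite /oitv /= !lte_fin; rlra.
Qed.

Lemma S_soliton_left_end c (T : \bar R) f u : S_soliton 1 c T f u -> complete_left_end 0%:E f u.
Proof.
move=> [_ hcl _ _ _]; right; exists 0, 1%g, 1; split => //.
have -> : (fun t => u (0 + t)) = u by apply/funext => t; rewrite add0r.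
suff -> : (fun i t => f ((1%g : 'S_3) i) (0 + t)) = f by [].
by apply/funext => i; apply/funext => t; rewrite perm1 add0r.
Qed.

Lemma soliton_prodf_der (cc : 'I_3 -> R) D f t : soliton_ode cc D f -> D t ->
  is_der (prodf f) t (sumsq f t / 2).
Proof.
move=> ode Dt; have [fpos hd] := ode t Dt.
have -> : prodf f = (fun s => f 0 s * f 1 s * f 2 s) by apply/funext => s; rewrite /prodf prod3.
have h0 := hd 0; have h1 := hd 1; have h2 := hd 2.
have [n0 n1 n2] : [/\ f 0 t != 0, f 1 t != 0 & f 2 t != 0] by rewrite !gt_eqF.
by der_eq; rewrite /sumsq sum3 /soliton_field /soliton_u; field; rewrite n0 n1 n2.
Qed.

(* The volume density [f_1 f_2 f_3] increases, so it cannot tend to 0 at the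
   right end of the interval, as it would over a singular orbit. *)
Lemma no_right_closing (a : \bar R) (b b0 : R) f u (s : 'S_3) : (a < b%:E)%E ->
  steady_soliton a b%:E f u ->
  ~ smoothly_closing b0 (fun i t => reverse_f f (s i) (- b + t)) (fun t => reverse_u u (- b + t)).
Proof.
move=> ab hst [b00 [e [F [U [e0 [smF _] FE odd [_ F1 F2]]]]]].
have [cc [_ ode _ _]] := steady_soliton_ode ab hst.
have [a' [a'b Da]] : exists a', a' < b /\ forall t, a' < t < b -> oitv a b%:E t.
  case: a ab {hst ode} => [a||] //; rewrite /oitv /=.
    by rewrite lte_fin => ab; exists a; split => // t; rewrite !lte_fin.
  by move=> _; exists (b - 1); split; [rlra|move=> t /andP[_ h]; rewrite ltNyr lte_fin].
pose G t := F 0 t * F 1 t * F 2 t.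
have D0 : oitv (- e)%:E e%:E 0 by rewrite /oitv /= !lte_fin; rlra.
have F00 : F 0 0 = 0 by have [|h _ _] := odd 0; [rlra|move: h; rewrite oppr0; rlra].
have cF i : F i t @[t --> 0^'+] --> F i 0.
  by apply: cvg_right_cont; exact: der_cont (smooth_on_derivable (smF i) D0).
have cG : G t @[t --> 0^'+] --> (0 : R).
  apply: (@cvg_right_lim _ _ (F 0 0 * F 1 0 * F 2 0)); last by rewrite F00 !mul0r.
  by apply: cvgM => //; exact: cvgM.
have GE t : 0 < t < e -> G t = prodf f (b - t).
  move=> te; have [h _] := FE t te; rewrite /G !h /reverse_f opprD opprK /prodf.
  by rewrite (perm_prod3 s (fun i => f i (b - t))) prod3.
pose d := Num.min (e / 2) ((b - a') / 2).
have d0 : 0 < d by rewrite lt_min; apply/andP; split; rlra.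
have [de da] : d <= e / 2 /\ d <= (b - a') / 2 by rewrite /d !ge_min !lexx orbT.
have pd : 0 < prodf f (b - d).
  have Dd : a' < b - d < b by rlra.
  have [h _] := ode (b - d) (Da (b - d) Dd).
  by rewrite /prodf prod3 !mulr_gt0.
have [t ht Gt] := pick_lim d0 cG pd.
have : prodf f (b - d) <= prodf f (b - t).
  apply: (@ge0_der_le _ (prodf f) (fun x => sumsq f x / 2)); first by rlra.
    by move=> x hx; apply: (soliton_prodf_der ode); apply: Da; rlra.
  by move=> x hx; rewrite /sumsq sum3 divr_ge0 // !addr_ge0 ?sqr_ge0.
by have GEt := GE t ltac:(rlra); rewrite -GEt; rlra.
Qed.

Lemma S_soliton_incomplete c (T : R) f u : S_soliton 1 c T%:E f u -> ~ complete_soliton 0%:E T%:E f u.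
Proof.
move=> hS [T0 hst _ [//|[a0 [s [b0 [hTa hcl]]]]]].
have h : - T = a0 by case: hTa.
by rewrite -h in hcl; exact: (no_right_closing T0 hst hcl).
Qed.

(** The collapsing variable is [g 2], with [g 2 ^+ 2 = A / (z + y) <= r]. As [y <= z], one has
    [r' >= - 4 k]; and [r] decreases without a positive lower bound, so [r <= 4 k (T - t)], whence
    the square root. Near [T] this variable is the smallest: [f_1 A] increases, so small [r] forces
    large [z], and then [f_1^2 = q r z^2] exceeds [r]. *)
Lemma supercritical_collapse c (T : R) f u : S_soliton 1 c T%:E f u -> 9 / 2 < c ^+ 2 ->
  exists k : 'I_3,
          [/\ \forall t \near T^'-, forall j, f k t <= f j t,
              f k t @[t --> T^'-] --> (0 : R) &
              exists K : R, \forall t \near T^'-,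
                `| f k t | <= K * Num.sqrt (T - t)].
Proof.
move=> hS hc; have [p [cc [g [[p0 gE] _ ode _ sol]]]] := S_closing_solution hS.
pose k := `|c| / 3; rewrite -/k in sol.
have kc : 1 < 2 * k ^+ 2.
  by rewrite /k expr_div_n -normrX ger0_norm ?sqr_ge0 //; rlra.
have [k0 T0 red _] := sol; rewrite lte_fin in T0.
have D t : 0 < t < T -> oitv 0%:E T%:E t by move=> ht; rewrite /oitv /= !lte_fin.
pose s := T / 2.
have Ds : oitv 0%:E T%:E s by apply: D; rewrite /s; rlra.
have [d [q0 [q1 [d0 q00 hb]]]] := supercritical_bounds sol kc Ds.
pose r t := red_A g t / red_z g t.
have r0 t : 0 < t < T -> 0 < r t by move=> /D /red [_ ? ? _ _]; rewrite divr_gt0.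
have sT : 0 < s < T by rewrite /s; rlra.
have r_lip t t' : s <= t <= t' -> t' < T -> r t - 4 * k * (t' - t) <= r t'.
  move=> /andP[st tt'] t'T.
  have : r t - - (4 * k) * t <= r t' - - (4 * k) * t'.
    apply: (@ge0_der_le _ (fun x => r x - - (4 * k) * x) (fun x =>
      (g 0 x ^+ 2 - 4 * k * red_y g x * g 0 x + 2 * (red_A g x / red_z g x) * red_y g x ^+ 2) / (red_z g x * g 0 x) + 4 * k)) => //.
      move=> x hx; have Dx : oitv 0%:E T%:E x by apply: D; rlra.
      have h : is_der r x _ := reduced_r_der red Dx.
      by der_eq; ring.
    move=> x hx; have Dx : oitv 0%:E T%:E x by apply: D; rlra.
    have [fx Ax zx _ _] := red x Dx; have y0 := closing_y_ge0 sol Dx.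
    have [_ yz _ _] := z_bounds red Dx y0.
    have -> : (g 0 x ^+ 2 - 4 * k * red_y g x * g 0 x + 2 * (red_A g x / red_z g x) * red_y g x ^+ 2) / (red_z g x * g 0 x) + 4 * k =
      (g 0 x ^+ 2 + 4 * k * g 0 x * (red_z g x - red_y g x) + 2 * (red_A g x / red_z g x) * red_y g x ^+ 2) / (red_z g x * g 0 x).
      by field; rewrite !gt_eqF.
    have rx : 0 <= red_A g x / red_z g x by rewrite divr_ge0 // ltW.
    apply: divr_ge0; last by rewrite mulr_ge0 // ltW.
    have h1 : 0 <= 4 * k * g 0 x * (red_z g x - red_y g x).
      by apply: mulr_ge0; [apply: mulr_ge0; [exact: mulr_ge0|exact: ltW]|rlra].
    have h2 : 0 <= 2 * (red_A g x / red_z g x) * red_y g x ^+ 2.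
      by apply: mulr_ge0; [exact: mulr_ge0|exact: sqr_ge0].
    by have := sqr_ge0 (g 0 x); rlra.
  by rlra.
have r_dec t t' : s <= t <= t' -> t' < T -> r t' <= r t.
  move=> /andP[st tt'] t'T.
  apply: (@le0_der_ge _ r (fun x => - (g 0 x / red_z g x) * mfun k (g 0) (red_A g) (red_y g) (red_z g) x)) => //.
    by move=> x hx; apply: (reduced_r_derm red); apply: D; rlra.
  move=> x hx; have Dx : oitv 0%:E T%:E x by apply: D; rlra.
  have [fx Ax zx _ _] := red x Dx; have [|hm _] := hb x _ Dx; first by rlra.
  by rewrite mulNr oppr_le0; pos.
have r_small e : 0 < e -> exists2 t0, s <= t0 < T & forall t, t0 <= t < T -> r t < e.
  move=> e0; apply: contrapT => hn.
  apply: (@S_soliton_r_not_bounded c T e s f u p cc g gE hS ode sol sT e0) => t ht.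
  rewrite leNgt; apply/negP => rt; apply: hn; exists t => // t' ht'.
  by apply: le_lt_trans rt; apply: r_dec; rlra.
have r_le t : s <= t < T -> r t <= 4 * k * (T - t).
  move=> ht; apply/ler_addgt0Pr => e e0.
  have [t0 ht0 ht1] := r_small e e0.
  pose t' := Num.max t t0.
  have [h1 h2] : t <= t' /\ t0 <= t' by rewrite /t' !le_max !lexx orbT.
  have h3 : t' < T by rewrite /t' gt_max; rlra.
  have := r_lip t t' ltac:(rlra) h3; have := ht1 t' ltac:(rlra).
  have : 4 * k * (t' - t) <= 4 * k * (T - t) by rewrite ler_wpM2l ?mulr_ge0 //; rlra.
  by rlra.
have g2r t : 0 < t < T -> g 2 t ^+ 2 <= r t.
  move=> ht; have Dt := D t ht; have [gp _] := ode t Dt.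
  have [fx Ax zx _ _] := red t Dt; have y0 := closing_y_ge0 sol Dt.
  have [_ _ zz zv] := z_bounds red Dt y0.
  rewrite (red_sq2 (gp 1) (gp 2)) zv /r ler_wpM2l ?(ltW Ax) // lef_pV2 ?posrE //; rlra.
have sq_le (x v : R) : 0 <= x -> 0 <= v -> x ^+ 2 <= v ^+ 2 -> x <= v.
  by move=> x0 v0; rewrite ler_pXn2r.
have near_T (P : R -> Prop) t0 : t0 < T -> (forall t, t0 <= t < T -> P t) -> \forall t \near T^'-, P t.
  move=> t0T hP; near=> t; apply: hP; apply/andP; split.
    by near: t; apply: nbhs_left_ge.
  by near: t; exact: nbhs_left_lt.
have g2b t : s <= t < T -> `|g 2 t| <= Num.sqrt (4 * k) * Num.sqrt (T - t).
  move=> ht; have [gp _] := ode t (D t ltac:(rlra)).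
  rewrite gtr0_norm // -sqrtrM ?mulr_ge0 //; apply: sq_le; [exact: ltW|exact: sqrtr_ge0|].
  rewrite sqr_sqrtr; first by apply: le_trans (r_le t ht); apply: g2r; rlra.
  by apply: mulr_ge0; [exact: mulr_ge0|rlra].
exists (p 2); rewrite -gE; split.
- have sp : 0 < g 0 s * red_A g s by have [? ? _ _ _] := red s Ds; rewrite mulr_gt0.
  have q10 : 0 < q1 by have [|_ h] := hb s _ Ds; [rewrite lexx|rlra].
  (* From [(f_1 A)^2 = q r^3 z^4], which is at least its value at [s], and [r^3 <= r < e], this
     choice yields [q0^2 z^4 >= 1]. *)
  pose e := (g 0 s * red_A g s) ^+ 2 * q0 ^+ 2 / q1.
  have e0 : 0 < e by rewrite divr_gt0 // mulr_gt0 // exprn_gt0.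
  have e01 : 0 < Num.min 1 e by rewrite lt_min ltr01.
  have [t0 ht0 ht1] := r_small _ e01.
  apply: (near_T _ t0); first by rlra.
  move=> t ht; have Dt : oitv 0%:E T%:E t by apply: D; rlra.
  have [gp _] := ode t Dt; have [fx Ax zx zy _] := red t Dt; have y0 := closing_y_ge0 sol Dt.
  have rt := r0 t ltac:(rlra); have rm := ht1 t ht.
  have [r1 re] : r t < 1 /\ r t < e by move: rm; rewrite lt_min => /andP.
  have [|_ /andP[hq0 hq1]] := hb t _ Dt; first by rlra.
  set q := g 0 t ^+ 2 / (red_A g t * red_z g t) in hq0 hq1.
  have f2E : g 0 t ^+ 2 = q * r t * red_z g t ^+ 2 by rewrite /q /r; field; rewrite !gt_eqF.
  have AE : red_A g t = r t * red_z g t by rewrite /r; field; rewrite gt_eqF.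
  have ps : g 0 s * red_A g s <= g 0 t * red_A g t.
    apply: (@ge0_der_le _ (fun x => g 0 x * red_A g x) (fun x => red_z g x * red_A g x + g 0 x ^+ 2 / 2)); first by rlra.
      by move=> x hx; apply: (reduced_p_der red); apply: D; rlra.
    move=> x hx; have [_ Ax' zx' _ _] := red x (D x ltac:(rlra)).
    exact: addr_ge0 (mulr_ge0 (ltW zx') (ltW Ax')) (divr_ge0 (sqr_ge0 _) (ler0n _ 2)).
  have z4 : 1 <= q0 ^+ 2 * red_z g t ^+ 4.
    have h1 : (g 0 s * red_A g s) ^+ 2 <= q1 * r t ^+ 3 * red_z g t ^+ 4.
      apply: (@le_trans _ _ ((g 0 t * red_A g t) ^+ 2)).
        by rewrite ler_pXn2r ?nnegrE //; pos.
      rewrite exprMn f2E AE.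
      have -> : q * r t * red_z g t ^+ 2 * (r t * red_z g t) ^+ 2 = q * (r t ^+ 3 * red_z g t ^+ 4) by ring.
      by rewrite -mulrA ler_wpM2r //; pos.
    have r3 : r t ^+ 3 <= e.
      apply: le_trans (ltW re); rewrite -[X in _ <= X]mulr1 exprS ler_wpM2l ?(ltW rt) //.
      by rewrite expr_le1 // ltW.
    have h2 : (g 0 s * red_A g s) ^+ 2 <= q1 * e * red_z g t ^+ 4.
      apply: le_trans h1 _; rewrite ler_wpM2r ?exprn_ge0 ?(ltW zx) //.
      by rewrite ler_wpM2l // ltW.
    have e1 : q1 * e = (g 0 s * red_A g s) ^+ 2 * q0 ^+ 2 by rewrite /e; field; rewrite gt_eqF.
    rewrite e1 -mulrA in h2.
    have ps2 : 0 < (g 0 s * red_A g s) ^+ 2 by rewrite exprn_gt0.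
    by rewrite -(ler_pM2l ps2) mulr1.
  have hz : 1 <= q0 * red_z g t ^+ 2.
    apply: sq_le; [exact: ler01|pos|].
    by rewrite expr1n exprMn -exprM.
  have h20 : g 2 t <= g 0 t.
    apply: sq_le; [exact: ltW|exact: ltW|]; apply: le_trans (g2r t _) _; first by rlra.
    rewrite f2E -mulrA mulrC -mulrA ler_peMr ?(ltW rt) // mulrC.
    by apply: le_trans hz _; rewrite ler_wpM2r ?sqr_ge0.
  have h21 : g 2 t <= g 1 t.
    apply: sq_le; [exact: ltW|exact: ltW|]; rewrite (red_sq1 (gp 1) (gp 2)) (red_sq2 (gp 1) (gp 2)).
    by rewrite ler_wpM2l ?(ltW Ax) //; rlra.
  by move=> j; rewrite -(permKV p j) -gE; elim/I3P: (p^-1%g j).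
- apply/cvgrPdist_le => e e0; have e2 : 0 < e ^+ 2 by rewrite exprn_gt0.
  have [t0 ht0 ht1] := r_small _ e2.
  apply: (near_T _ t0); first by rlra.
  move=> t ht; have [gp _] := ode t (D t ltac:(rlra)).
  rewrite sub0r normrN gtr0_norm //; apply: sq_le; [exact: ltW|exact: ltW|].
  by apply: ltW; apply: le_lt_trans (g2r t _) (ht1 t ht); rlra.
- exists (Num.sqrt (4 * k)); apply: (near_T _ s); first by rlra.
  by move=> t ht; exact: g2b.
Unshelve. all: by end_near. Qed.

Lemma completeness_dichotomy c (T : \bar R) f u : S_soliton 1 c T f u ->
     (c ^+ 2 <= 9 / 2 -> T = +oo%E /\ complete_soliton 0%:E T f u) /\
     (9 / 2 < c ^+ 2 ->
        ~ complete_soliton 0%:E T f u /\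
        exists ts : R, T = ts%:E /\
        exists k : 'I_3,
          [/\ \forall t \near ts^'-, forall j, f k t <= f j t,
              f k t @[t --> ts^'-] --> (0 : R) &
              exists K : R, \forall t \near ts^'-,
                `| f k t | <= K * Num.sqrt (ts - t)]).
Proof.
move=> hS; split=> hc.
  have hT := subcritical_complete hS hc; split => //.
  have [[T0 hst] _ _ _ _] := hS; split => //; first exact: S_soliton_left_end hS.
  by left; rewrite hT.
have [p [cc [g [_ _ ode _ sol]]]] := S_closing_solution hS.
have kc : 1 < 2 * (`|c| / 3) ^+ 2.
  by rewrite expr_div_n -normrX ger0_norm ?sqr_ge0 //; rlra.
have Tfin := supercritical_finite sol kc.
have T0 : (0%:E < T)%E by case: hS => -[].
case: T hS Tfin T0 {ode sol} => [T||] // hS _ _.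
by split; [exact: S_soliton_incomplete hS|exists T; split => //; exact: supercritical_collapse hS hc].
Qed.

End Completeness.

(** * Decay classes at infinity *)

Section Decay.
Context {R : realType}.
Implicit Types (f g : R -> R) (m l t : R) (N n : nat).

(** A property near [+oo] with a positive threshold, so that the rules for real powers of [t] apply
    throughout. *)
Definition ev (P : R -> Prop) : Prop := exists2 M : R, 0 < M & forall t, M < t -> P t.

Lemma evI (P Q : R -> Prop) : ev P -> ev Q -> ev (fun t => P t /\ Q t).
Proof.
move=> [M M0 hM] [M' _ hM']; exists (Num.max M M'); first by rewrite lt_max M0.
by move=> t; rewrite gt_max => /andP[h1 h2]; split; [exact: hM|exact: hM'].
Qed.

Lemma evS (P Q : R -> Prop) : (forall t, 0 < t -> P t -> Q t) -> ev P -> ev Q.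
Proof.
move=> h [M M0 hM]; exists M => // t Mt; apply: h; first exact: lt_trans Mt.
exact: hM.
Qed.

Lemma ev_gt a : ev (fun t => a < t).
Proof. by exists (`|a| + 1) => [|t]; [|have := ler_norm a; rlra]; have := normr_ge0 a; rlra. Qed.

Lemma ev_near (P : R -> Prop) : ev P -> \forall t \near +oo, P t.
Proof. by move=> [M _ hM]; exists M; split => //; exact: num_real. Qed.

Lemma ev_nbhs (P : R -> Prop) : ev P -> ev (fun t => \forall s \near t, P s).
Proof.
move=> [M M0 hM]; exists M => // t Mt.
have : \forall s \near t, M < s < t + 1 by apply: near_itv; rewrite Mt ltrDl ltr01.
by apply: filterS => s /andP[/hM].
Qed.

Definition bounded_by m g : Prop := exists K, ev (fun t => `|g t| <= K * t `^ m).

(** A symbol class of order [m]: each of the first [N] derivatives lowers the order by one. Orders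
    add under products and change sign under inverses, so rates for rational expressions can be read
    off. *)
Fixpoint decays N m g : Prop := bounded_by m g /\
  if N is N'.+1 then ev (fun t => derivable g t 1) /\ decays N' (m - 1) (g^`())%classic
  else True.

Lemma bounded_by_eq m f g : ev (fun t => f t = g t) -> bounded_by m f -> bounded_by m g.
Proof. by move=> h [K hK]; exists K; apply: evS (evI h hK) => t _ [<-]. Qed.

Lemma decays_eq N m f g : ev (fun t => f t = g t) -> decays N m f -> decays N m g.
Proof.
elim: N m f g => [|N IH] m f g fg /= [hb h]; split => //; try exact: bounded_by_eq hb.
have hd : ev (fun t => is_der g t ((f^`())%classic t)).
  apply: evS (evI (ev_nbhs fg) h.1) => t _ [h1 h2].
  by apply: (der_near h1); exact: derivable_der.
split; first by apply: evS hd => t _ /der_derivable.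
by apply: (IH _ _ _ _ h.2); apply: evS hd => t _ /der_val.
Qed.

Lemma decays_bounded N m g : decays N m g -> bounded_by m g.
Proof. by case: N => [|N] []. Qed.

Lemma decays_der N m g dg : ev (fun t => is_der g t (dg t)) -> bounded_by m g ->
  decays N (m - 1) dg -> decays N.+1 m g.
Proof.
move=> h1 h2 h3; split => //; split; first by apply: evS h1 => t _ /der_derivable.
by apply: decays_eq h3; apply: evS h1 => t _ /der_val.
Qed.

Lemma decaysW N m g : decays N.+1 m g -> decays N m g.
Proof.
elim: N m g => [|N IH] m g [h1 [h2 h3]]; split => //; split => //; exact: IH.
Qed.

Lemma decays_is_der N m g : decays N.+1 m g -> ev (fun t => is_der g t ((g^`())%classic t)).
Proof. by move=> [_ [h _]]; apply: evS h => t _ /derivable_der. Qed.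

Lemma bounded_by_zero m : bounded_by m (fun=> 0).
Proof. by exists 0, 1 => // t _; rewrite normr0 mul0r. Qed.

Lemma decays_zero N m : decays N m (fun=> 0).
Proof.
elim: N m => [|N IH] m; first by split => //; exact: bounded_by_zero.
apply: (decays_der (dg := fun=> 0)) => //; last exact: bounded_by_zero.
by exists 1 => // t _; exact: der_cst.
Qed.

Lemma decays_cst N (c : R) : decays N 0 (fun=> c).
Proof.
have hb : bounded_by 0 (fun=> c).
  by exists `|c|, 1 => // t _; rewrite powRr0 mulr1.
case: N => [|N]; first by split.
apply: (decays_der (dg := fun=> 0)) => //; last exact: decays_zero.
by exists 1 => // t _; exact: der_cst.
Qed.

Lemma decays_id N : decays N 1 (fun t => t).
Proof.
have hb : bounded_by 1 (fun t : R => t).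
  by exists 1, 1 => // t t1; rewrite mul1r powRr1 ?gtr0_norm //; rlra.
case: N => [|N]; first by split.
apply: (decays_der (dg := fun=> 1)) => //; last by rewrite subrr; exact: decays_cst.
by exists 1 => // t _; exact: der_id.
Qed.

Lemma decaysD N m f g : decays N m f -> decays N m g -> decays N m (fun t => f t + g t).
Proof.
elim: N m f g => [|N IH] m f g hf hg.
  have [[K hK] [K' hK']] := (decays_bounded hf, decays_bounded hg); split => //.
  exists (K + K'); apply: evS (evI hK hK') => t _ [h1 h2].
  by rewrite mulrDl; apply: le_trans (ler_normD _ _) _; exact: lerD.
apply: (decays_der (dg := fun t => (f^`())%classic t + (g^`())%classic t)).
- by apply: evS (evI (decays_is_der hf) (decays_is_der hg)) => t _ [? ?]; exact: derD.
- exact: decays_bounded (IH _ _ _ (decaysW hf) (decaysW hg)).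
- by apply: IH; [case: hf => _ []|case: hg => _ []].
Qed.

Lemma bounded_byM m l f g : bounded_by m f -> bounded_by l g ->
  bounded_by (m + l) (fun t => f t * g t).
Proof.
move=> [K hK] [K' hK']; exists (K * K'); apply: evS (evI hK hK') => t t0 [h1 h2].
rewrite normrM powRD; last by rewrite (gt_eqF t0) implybT.
by rewrite mulrACA; exact: ler_pM.
Qed.

Lemma decaysM N m l f g : decays N m f -> decays N l g -> decays N (m + l) (fun t => f t * g t).
Proof.
elim: N m l f g => [|N IH] m l f g hf hg.
  by split => //; apply: bounded_byM; [exact: decays_bounded hf|exact: decays_bounded hg].
apply: (decays_der (dg := fun t => (f^`())%classic t * g t + f t * (g^`())%classic t)).
- by apply: evS (evI (decays_is_der hf) (decays_is_der hg)) => t _ [? ?]; exact: derM.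
- by apply: bounded_byM; [exact: decays_bounded hf|exact: decays_bounded hg].
- apply: decaysD.
    by rewrite addrAC; apply: IH; [case: hf => _ []|exact: decaysW].
  by rewrite -addrA; apply: IH; [exact: decaysW|case: hg => _ []].
Qed.

Lemma decaysZ N m (c : R) g : decays N m g -> decays N m (fun t => c * g t).
Proof. by move=> h; rewrite -[m]add0r; apply: decaysM => //; exact: decays_cst. Qed.

Lemma decaysN N m g : decays N m g -> decays N m (fun t => - g t).
Proof.
move=> h; apply: decays_eq (decaysZ (-1) h).
by exists 1 => // t _; rewrite mulN1r.
Qed.

Lemma decays_le N m l g : m <= l -> decays N m g -> decays N l g.
Proof.
have key m' l' h : m' <= l' -> bounded_by m' h -> bounded_by l' h.
  move=> ml [K hK]; exists `|K|; apply: evS (evI (ev_gt 1) hK) => t t0 [t1 ht].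
  apply: (le_trans ht); apply: (@le_trans _ _ (`|K| * t `^ m')).
    by rewrite ler_wpM2r ?powR_ge0 // ler_norm.
  by rewrite ler_wpM2l // ler_powR // ltW.
elim: N m l g => [|N IH] m l g ml [h1 h2]; split => //; try exact: key h1.
by split; [exact: h2.1|apply: IH h2.2; rewrite lerD2r].
Qed.

Lemma decaysX N m g n : decays N m g -> decays N (m *+ n) (fun t => g t ^+ n).
Proof.
move=> h; elim: n => [|n IH]; first exact: decays_cst.
apply: (@decays_eq _ _ (fun t => g t * g t ^+ n)); first by exists 1 => // t _; rewrite exprS.
by rewrite mulrS; exact: decaysM.
Qed.

Lemma decaysV N m (c : R) g : 0 < c -> ev (fun t => c * t `^ m <= g t) ->
  decays N m g -> decays N (- m) (fun t => (g t)^-1).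
Proof.
move=> c0 hc.
have hb : bounded_by (- m) (fun t => (g t)^-1).
  exists c^-1; apply: evS hc => t t0 h.
  have p : 0 < c * t `^ m by rewrite mulr_gt0 // powR_gt0.
  have g0 : 0 < g t by exact: lt_le_trans h.
  by rewrite gtr0_norm ?invr_gt0 // powRN -invfM lef_pV2.
have g0 : ev (fun t => g t != 0).
  apply: evS hc => t t0 h; rewrite gt_eqF //; apply: lt_le_trans h.
  by rewrite mulr_gt0 // powR_gt0.
elim: N => [|N IH] hg; first by split.
apply: (decays_der (dg := fun t => - (g^`())%classic t * ((g t)^-1 * (g t)^-1))) => //.
  apply: evS (evI g0 (decays_is_der hg)) => t _ [gn hd].
  by move/der_eq: (derV gn hd); apply; rewrite -invfM expr2.
have -> : - m - 1 = (m - 1) + (- m + - m) by ring.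
apply: decaysM; first by apply: decaysN; case: hg => _ [].
by apply: decaysM; apply: IH; exact: decaysW.
Qed.

Lemma decays_derive1n m g : (forall N, decays N m g) ->
  forall n, exists K, \forall t \near +oo, `|(g^`(n))%classic t| <= K * t `^ (m - n%:R).
Proof.
move=> h n; suff : bounded_by (m - n%:R) (g^`(n))%classic.
  by move=> [K hK]; exists K; exact: ev_near.
elim: n m g h => [|n IH] m g h; first by rewrite subr0; exact: decays_bounded (h 0%N).
rewrite derive1Sn; have -> : m - n.+1%:R = (m - 1) - n%:R by rewrite -natr1; ring.
by apply: IH => N; have [_ []] := h N.+1.
Qed.

(* Bootstrapping: a bound on [f_i - t / 2] propagates to all derivatives because
   the soliton field is asymptotically homogeneous of degree 0. *)
Lemma ode_decays (c : 'I_3 -> R) (g : 'I_3 -> R -> R) :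
  soliton_ode c (oitv 0%:E +oo%E) g ->
  (forall i, bounded_by 0 (fun t => g i t - 1 / 2 * t)) ->
  forall N i, decays N 0 (fun t => g i t - 1 / 2 * t).
Proof.
move=> ode hb.
have Dp t : 0 < t -> oitv (0%:E : \bar R) +oo%E t by move=> h; rewrite /oitv /= lte_fin h ltry.
have hlow i : ev (fun t => 1 / 4 * t `^ 1 <= g i t).
  have [K hK] := hb i; apply: evS (evI (ev_gt (4 * K)) hK) => t t0 [tK].
  by rewrite powRr0 mulr1 powRr1 ?(ltW t0) // ler_norml; rlra.
have der_e i t : 0 < t -> is_der (fun t => g i t - 1 / 2 * t) t (soliton_field c (g^~ t) i - 1 / 2).
  by move=> t0; have [_ /(_ i) h] := ode t (Dp t t0); der_eq; ring.
move=> N; elim: N => [|N IH]; first by move=> i; split.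
have hg i : decays N 1 (g i).
  apply: (@decays_eq _ _ (fun t => (g i t - 1 / 2 * t) + 1 / 2 * t)).
    by exists 1 => // t _; ring.
  apply: decaysD; first exact: decays_le (IH i).
  by apply: decaysZ; exact: decays_id.
have hV i : decays N (-1) (fun t => (g i t)^-1).
  by apply: (@decaysV _ _ (1 / 4)) => //; rlra.
have hu : decays N (-2) (fun t => soliton_u c (g^~ t)).
  have h i : decays N (-2) (fun t => c i * ((g i t)^-1 * (g i t)^-1)).
    apply: decaysZ; have -> : -2 = -1 + -1 :> R by rlra.
    exact: decaysM.
  apply: (@decays_eq _ _ (fun t => - (1 / 3) * (c 0 * ((g 0 t)^-1 * (g 0 t)^-1) +
    c 1 * ((g 1 t)^-1 * (g 1 t)^-1) + c 2 * ((g 2 t)^-1 * (g 2 t)^-1)))).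
    by exists 1 => // t _; rewrite /soliton_u !expr2 !invfM.
  by apply: decaysZ; apply: decaysD => //; exact: decaysD.
pose e i t := g i t - 1 / 2 * t.
have he i : decays N 0 (e i) by exact: IH.
have het i : decays N 1 (fun t => e i t * t).
  by rewrite -[1]add0r; apply: decaysM => //; exact: decays_id.
have hee i j : decays N 1 (fun t => e i t * e j t).
  by apply: (@decays_le _ 0) => //; rewrite -[0]addr0; exact: decaysM.
(* In the homogeneous part of the field, minus its value on the cone, substitute [g = t / 2 + e]:
   the terms in [t^2] of the numerator cancel. What remains has order 1, over the denominator
   [g_j g_l] of order 2. *)
have main (i j l : 'I_3) : decays N (-1) (fun t => (e j t * e j t + e l t * e l t + - (e j t * e l t) + - (e i t * e i t)
   + - (e i t * t) + 1 / 2 * (e j t * t) + 1 / 2 * (e l t * t)) * ((g j t)^-1 * (g l t)^-1)).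
  have -> : -1 = 1 + (-1 + -1) :> R by rlra.
  apply: decaysM; last exact: decaysM.
  do ![apply: decaysD => //]; try (by apply: decaysN => //); by apply: decaysZ.
have tail i : decays N (-1) (fun t => soliton_u c (g^~ t) * g i t + c i * (g i t)^-1).
  apply: decaysD; last exact: decaysZ.
  by have -> : -1 = -2 + 1 :> R by [rlra]; exact: decaysM.
have ne i t : 0 < t -> g i t != 0 by move=> t0; have [h _] := ode t (Dp t t0); rewrite gt_eqF.
move=> i; apply: (decays_der (dg := fun t => soliton_field c (g^~ t) i - 1 / 2)) => //.
  by exists 1 => // t t1; apply: der_e; rlra.
rewrite sub0r; elim/I3P: i.
- apply: decays_eq (decaysZ (1 / 2) (decaysD (main 0 1 2) (tail 0))).
  exists 1 => // t t1; rewrite /soliton_field /e; have t0 : 0 < t by rlra.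
  by field; rewrite !ne.
- apply: decays_eq (decaysZ (1 / 2) (decaysD (main 1 0 2) (tail 1))).
  exists 1 => // t t1; rewrite /soliton_field /e; have t0 : 0 < t by rlra.
  by field; rewrite !ne.
- apply: decays_eq (decaysZ (1 / 2) (decaysD (main 2 0 1) (tail 2))).
  exists 1 => // t t1; rewrite /soliton_field /e; have t0 : 0 < t by rlra.
  by field; rewrite !ne.
Qed.

End Decay.

(** * Conical asymptotics *)

Section Conical.
Context {R : realType}.
Implicit Types (k t a b K : R) (f A y z X Y r : R -> R).

(* The reduced equations for [X = f / z], [Y = y / z] and [r = A / z]. *)
Definition polar k X Y r z : Prop := forall t, 0 < t ->
  [/\ 0 < X t, 0 <= Y t < 1, 1 <= r t, 1 <= z t &
   [/\ is_der X t (1 + 2 * Y t ^+ 2 - X t ^+ 2 / (2 * r t) - 2 * k * X t * Y t / r t),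
       is_der Y t ((1 - Y t ^+ 2) * (3 * k * (X t / r t) - 2 * Y t) / X t),
       is_der r t ((X t ^+ 2 - 4 * k * X t * Y t + 2 * r t * Y t ^+ 2) / X t) &
       is_der z t (z t * Y t * (3 * k * (X t / r t) - 2 * Y t) / X t)]].

Lemma closing_polar k f A y z : closing_solution k +oo%E f A y z -> 2 * k ^+ 2 <= 1 ->
  polar k (fun t => f t / z t) (fun t => y t / z t) (fun t => A t / z t) z.
Proof.
move=> sol kc t t0; have [k0 _ red _] := sol.
have Dt : oitv (0%:E : \bar R) +oo%E t by rewrite /oitv /= lte_fin t0 ltry.
have [fx Ax zx zy [df dA dy dz]] := red t Dt; have y0 := closing_y_ge0 sol Dt.
have yz : y t < z t by rnra.
have [nf nA nz] : [/\ f t != 0, A t != 0 & z t != 0] by rewrite !gt_eqF.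
split; rewrite ?divr_gt0 //.
- by rewrite divr_ge0 ?(ltW zx) //= ltr_pdivrMr // mul1r.
- exact: closing_r_ge1 sol kc Dt.
- exact: reduced_z_ge1 red Dt.
split.
- by der_eq => //; rewrite /fdot /hdot; field; rewrite nf nA nz.
- by der_eq => //; rewrite /hdot; field; rewrite nf nA nz.
- by move/der_eq: (reduced_r_der red Dt); apply; field; rewrite nf nz.
- by der_eq => //; rewrite /hdot; field; rewrite nf nA nz.
Qed.

(** The quotient [q = X^2 / r] obeys the logistic equation of [qfun_der], namely
    [q' = 2 q (1 - q + Y^2) / X] with [0 <= Y < 1], so the interval from [min (q s) 1] to 2 is
    forward invariant. *)
Lemma polar_q_bounds k X Y r z s : polar k X Y r z -> 0 < s -> X s ^+ 2 <= 2 * r s ->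
  exists q0, 0 < q0 <= 1 /\ forall t, s <= t -> q0 * r t <= X t ^+ 2 <= 2 * r t.
Proof.
move=> pol s0 hs; pose q t := X t ^+ 2 / r t.
have dq t : 0 < t -> is_der q t (2 * q t * (1 - q t + Y t ^+ 2) / X t).
  move=> /pol [Xt _ rt _ [dX _ dr _]].
  have rn : r t != 0 by rewrite gt_eqF //; rlra.
  by rewrite /q; der_eq => //; rewrite ?expr1; field; rewrite rn gt_eqF.
have [Xs _ rs _ _] := pol s s0.
have qs : 0 < q s by rewrite divr_gt0 ?exprn_gt0 //; rlra.
have pos_q t : 0 < t -> 0 < X t /\ 0 <= q t.
  by move=> /pol [Xt _ rt _ _]; rewrite divr_ge0 ?sqr_ge0 //; rlra.
exists (Num.min (q s) 1); split; first by rewrite lt_min qs ltr01 ge_min lexx orbT.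
move=> t st; have t0 : 0 < t by rlra.
have [Xt _ rt _ _] := pol t t0; have r0 : 0 < r t by rlra.
rewrite -ler_pdivlMr // -[X in _ && X]ler_pdivrMr // -/(q t); apply/andP; split.
- apply: (@barrier_ge _ q _ _ s t st (fun x hx => dq x (lt_le_trans s0 (andP hx).1))).
    by rewrite ge_min lexx.
  move=> x hx; rewrite lt_min => /andP[_ q1]; have [X0 q0] := pos_q x ltac:(rlra).
  apply: divr_ge0; last exact: ltW.
  by apply: mulr_ge0; [rewrite mulr_ge0|have := sqr_ge0 (Y x); rlra].
- apply: (@barrier_le _ q _ _ s t st (fun x hx => dq x (lt_le_trans s0 (andP hx).1))).
    by rewrite /q ler_pdivrMr //; rlra.
  move=> x hx q2; have [X0 q0] := pos_q x ltac:(rlra).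
  have [_ /andP[Y0 Y1] _ _ _] := pol x ltac:(rlra).
  rewrite pmulr_lle0 ?invr_gt0 //; apply: mulr_ge0_le0; first by rewrite mulr_ge0.
  by rnra.
Qed.

(** As [r >= 1], it suffices that [(1 - d) X^2 - 4 k X Y + 2 Y^2 >= 0] for [d = (1 - 2 k^2) / 2].
    This holds because [2 k^2 <= 1 - d]: giving away half of the gap [1 - 2 k^2] keeps the
    discriminant nonpositive. *)
Lemma polar_r_growth k X Y r z t : polar k X Y r z -> 2 * k ^+ 2 <= 1 -> 0 < t ->
  (1 - 2 * k ^+ 2) / 2 * X t <= (X t ^+ 2 - 4 * k * X t * Y t + 2 * r t * Y t ^+ 2) / X t.
Proof.
move=> pol kc t0; have [Xt /andP[Y0 Y1] rt _ _] := pol t t0.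
rewrite ler_pdivlMr // -subr_ge0.
have h : 0 <= (r t - 1) * Y t ^+ 2 by rewrite mulr_ge0 ?sqr_ge0 // subr_ge0.
pose d := (1 - 2 * k ^+ 2) / 2.
have hd : 0 < 1 - d by rewrite /d; have := sqr_ge0 k; rlra.
have h1 := sqr_ge0 ((1 - d) * X t - 2 * k * Y t).
have h2 : 0 <= (2 * (1 - d) - 4 * k ^+ 2) * Y t ^+ 2.
  by rewrite mulr_ge0 ?sqr_ge0 // /d; rlra.
rewrite -(pmulr_rge0 _ hd).
have -> : (1 - d) * (X t ^+ 2 - 4 * k * X t * Y t + 2 * r t * Y t ^+ 2 - (1 - 2 * k ^+ 2) / 2 * X t * X t) =
  ((1 - d) * X t - 2 * k * Y t) ^+ 2 + (2 * (1 - d) - 4 * k ^+ 2) * Y t ^+ 2 + 2 * (1 - d) * ((r t - 1) * Y t ^+ 2).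
  by rewrite /d; ring.
have h3 : 0 <= 2 * (1 - d) * ((r t - 1) * Y t ^+ 2) by rewrite mulr_ge0 // mulr_ge0 // ltW.
by rewrite !addr_ge0.
Qed.

(** Since [X >= sqrt (q0 r)], the bound on [r'] says that the square root of [r] grows at least
    linearly; from [2 s] on, [c (t - s) >= c t / 2] absorbs the starting point. *)
Lemma polar_r_quadratic k X Y r z s q0 : polar k X Y r z -> 2 * k ^+ 2 < 1 -> 0 < s -> 0 < q0 ->
  (forall t, s <= t -> q0 * r t <= X t ^+ 2) ->
  exists2 c, 0 < c & forall t, 2 * s <= t -> c * t ^+ 2 <= r t.
Proof.
move=> pol kc s0 q00 hq.
pose c := (1 - 2 * k ^+ 2) / 4 * Num.sqrt q0.
have c0 : 0 < c by rewrite mulr_gt0 ?sqrtr_gt0 //; rlra.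
exists ((c / 2) ^+ 2); first by rewrite exprn_gt0 // divr_gt0.
move=> t st; have r0 x : s <= x -> 0 < r x by move=> sx; have [_ _ h _ _] := pol x ltac:(rlra); rlra.
have h : Num.sqrt (r s) - c * s <= Num.sqrt (r t) - c * t.
  apply: (@ge0_der_le _ (fun x => Num.sqrt (r x) - c * x) (fun x =>
     ((X x ^+ 2 - 4 * k * X x * Y x + 2 * r x * Y x ^+ 2) / X x) / (2 * Num.sqrt (r x)) - c)); first by rlra.
    move=> x hx; have [_ _ _ _ [_ _ dr _]] := pol x ltac:(rlra).
    have rx := r0 x ltac:(rlra); have h2 := der_sqrt rx dr.
    by der_eq; ring.
  move=> x hx; have rx := r0 x ltac:(rlra); have x0 : 0 < x by rlra.
  have [Xx _ _ _ _] := pol x x0.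
  have sr : 0 < Num.sqrt (r x) by rewrite sqrtr_gt0.
  rewrite subr_ge0 ler_pdivlMr ?mulr_gt0 //; apply: le_trans (polar_r_growth pol (ltW kc) x0).
  have hX : Num.sqrt q0 * Num.sqrt (r x) <= X x.
    by rewrite -sqrtrM ?(ltW q00) // -(ger0_norm (ltW Xx)) -sqrtr_sqr ler_wsqrtr // hq //; rlra.
  have -> : c * (2 * Num.sqrt (r x)) = (1 - 2 * k ^+ 2) / 2 * (Num.sqrt q0 * Num.sqrt (r x)).
    by rewrite /c; field.
  by rewrite ler_wpM2l //; rlra.
have h1 : c / 2 * t <= Num.sqrt (r t).
  have := sqrtr_ge0 (r s); have : 0 <= c * (t - 2 * s) by rewrite mulr_ge0 ?(ltW c0) // subr_ge0.
  by rlra.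
have rt : 0 < r t by apply: r0; rlra.
rewrite -exprMn -(sqr_sqrtr (ltW rt)) ler_sqr ?nnegrE ?sqrtr_ge0 //.
by rewrite !mulr_ge0 ?(ltW c0) //; rlra.
Qed.

(** The factor [1 - Y^2] in the equation of [Y] degenerates as [Y] nears 1, so decay is not read off
    directly. While [Y > e], the logarithmic derivative of [z] is at most [- e^2 / X] and that of
    [r] at most [4 / X]; for [N e^2 >= 4] the product [z^N r] would be nonincreasing, although
    [z >= 1] and [r] is unbounded. Hence [Y <= e] at some time, after which the level [e] is a
    barrier. *)
Lemma polar_Y_small k X Y r z s q0 (e : R) : polar k X Y r z -> 0 <= k -> 2 * k ^+ 2 < 1 ->
  0 < s -> 0 < q0 -> (forall t, s <= t -> q0 * r t <= X t ^+ 2 <= 2 * r t) -> 0 < e ->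
  exists2 s', s <= s' & forall t, s' <= t -> Y t <= e.
Proof.
move=> pol k0 kc s0 q00 hq e0.
have hq1 t : s <= t -> q0 * r t <= X t ^+ 2 by move=> /hq /andP[].
have [c c0 hc] := polar_r_quadratic pol kc s0 q00 hq1.
(* Once [r >= B], the bound [X^2 <= 2 r] gives [(3 k X / r)^2 <= 18 k^2 / r <= e^2]. *)
pose B := 18 * k ^+ 2 / e ^+ 2.
have B0 : 0 <= B by rewrite divr_ge0 ?sqr_ge0 // mulr_ge0 ?sqr_ge0.
have hr (C : R) : 0 <= C -> exists2 s1, 2 * s <= s1 & forall t, s1 <= t -> C <= r t.
  move=> C0; exists (2 * s + C / c + 1).
    by have : 0 <= C / c by [rewrite divr_ge0 // ltW]; rlra.
  move=> t ht; have p : 0 <= C / c by rewrite divr_ge0 // ltW.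
  apply: le_trans (hc t _); last by rlra.
  rewrite -[C](divfK (lt0r_neq0 c0)) mulrC ler_pM2l //; rnra.
have [s1 s1s hB] := hr B B0.
have hX t : s1 <= t -> 3 * k * (X t / r t) <= e.
  move=> st; have [Xt _ rt _ _] := pol t ltac:(rlra).
  have h0 : 0 <= X t / r t by rewrite divr_ge0 //; rlra.
  have h1 : (X t / r t) ^+ 2 <= 2 / r t.
    have /andP[_ h] := hq t ltac:(rlra).
    rewrite expr_div_n expr2 [r t ^+ 2]expr2 -expr2 ler_pdivrMr ?mulr_gt0 //; try rlra.
    by rewrite mulrA divfK // gt_eqF //; rlra.
  have h2 : 18 * k ^+ 2 / r t <= e ^+ 2.
    have := hB t st; rewrite /B ler_pdivrMr ?exprn_gt0 // => h.
    by rewrite ler_pdivrMr 1?mulrC //; rlra.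
  rewrite -ler_sqr ?nnegrE ?(ltW e0) //; last by rewrite mulr_ge0 // mulr_ge0.
  apply: le_trans h2; rewrite exprMn.
  have -> : 18 * k ^+ 2 / r t = (3 * k) ^+ 2 * (2 / r t) by ring.
  by rewrite ler_wpM2l // sqr_ge0.
have [s2 hs2 Ys2] : exists2 s2, s1 <= s2 & Y s2 <= e.
  apply/not_exists2P => hN.
  have hY t : s1 <= t -> e < Y t by move=> st; have [|/negP] := hN t => //; rewrite -ltNge.
  have [N hN'] : exists N : nat, 4 <= N%:R * e ^+ 2.
    exists (Num.truncn (4 / e ^+ 2)).+1; rewrite -ler_pdivrMr ?exprn_gt0 //.
    by apply/ltW/truncnS_gt.
  have hm t : s1 <= t -> z t ^+ N * r t <= z s1 ^+ N * r s1.
    move=> st.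
    apply: (@le0_der_ge _ (fun x => z x ^+ N * r x) (fun x =>
      z x ^+ N * (N%:R * (Y x * (3 * k * (X x / r x) - 2 * Y x)) * r x +
        (X x ^+ 2 - 4 * k * X x * Y x + 2 * r x * Y x ^+ 2)) / X x)) => //.
      move=> x hx; have [Xx _ rx zx [_ _ dr dz]] := pol x ltac:(rlra).
      der_eq; case: (N) => [|N']; rewrite ?expr0 /= ?exprS; field; rewrite gt_eqF //; rlra.
    move=> x hx; have x0 : 0 < x by rlra.
    have [Xx /andP[Y0 Y1] rx zx _] := pol x x0.
    rewrite pmulr_lle0 ?invr_gt0 //; apply: mulr_ge0_le0; first by rewrite exprn_ge0 //; rlra.
    have h1 := hX x ltac:(rlra); have h2 := hY x ltac:(rlra).
    have h3 : Y x * (3 * k * (X x / r x) - 2 * Y x) <= - e ^+ 2 by rnra.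
    have h4 : N%:R * (Y x * (3 * k * (X x / r x) - 2 * Y x)) <= - 4.
      by apply: (@le_trans _ _ (N%:R * - e ^+ 2)); [rewrite ler_wpM2l|rlra].
    have /andP[_ h5] := hq x ltac:(rlra).
    have h6 : 0 <= 4 * k * X x * Y x by rewrite !mulr_ge0 // ltW.
    have r0 : 0 <= r x by rlra.
    have h7 := ler_wpM2r r0 h4.
    have h8 : r x * Y x ^+ 2 <= r x by rewrite ler_piMr // expr_le1 // ltW.
    by rlra.
  have C0 : 0 <= z s1 ^+ N * r s1 + 1.
    have [_ _ r1 z1 _] := pol s1 ltac:(rlra).
    by rewrite addr_ge0 // mulr_ge0 ?exprn_ge0 //; rlra.
  have [s3 s3s hC] := hr _ C0.
  pose t := Num.max s1 s3.
  have t1 : s1 <= t by rewrite le_max lexx.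
  have t3 : s3 <= t by rewrite le_max lexx orbT.
  have [_ _ rt zt _] := pol t ltac:(rlra).
  have zN : 1 <= z t ^+ N by rewrite exprn_ege1.
  have := hm t t1; have := hC t t3; rnra.
exists s2; first by rlra.
move=> t st; apply: (@barrier_le _ Y (fun x => (1 - Y x ^+ 2) * (3 * k * (X x / r x) - 2 * Y x) / X x) _ s2 t) => //.
  by move=> x hx; have [_ _ _ _ []] := pol x ltac:(rlra).
move=> x hx hY; have [Xx /andP[Y0 Y1] _ _ _] := pol x ltac:(rlra).
rewrite pmulr_lle0 ?invr_gt0 //; apply: mulr_ge0_le0; first by rnra.
by have := hX x ltac:(rlra); rlra.
Qed.

(** On the cone [X^2 = r] and [Y = 0]. The defects [W = Y^2 r] and [V = X^2 - r] both obey equations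
    with a damping term, the one for [V] forced by [W], so each is bounded by a barrier. *)
Lemma polar_defects k X Y r z s q0 : polar k X Y r z -> 0 <= k -> 2 * k ^+ 2 < 1 ->
  0 < s -> 0 < q0 <= 1 -> (forall t, s <= t -> q0 * r t <= X t ^+ 2 <= 2 * r t) ->
  exists s' K, [/\ s <= s', 0 < K & forall t, s' <= t ->
    [/\ Y t <= 1 / 4, Y t ^+ 2 * r t <= K & `|X t ^+ 2 - r t| <= K]].
Proof.
move=> pol k0 kc s0 /andP[q00 q01] hq.
have [s' ss' hY] := polar_Y_small pol k0 kc s0 q00 hq (ltac:(rlra) : 0 < 1 / 4 :> R).
have s'0 : 0 < s' by rlra.
pose W t := Y t ^+ 2 * r t; pose V t := X t ^+ 2 - r t.
(* Above the level [72 k^2] the cross term satisfies [6 k X Y <= W], because [X^2 Y^2 <= 2 W]. With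
   [Y <= 1 / 4] the remaining positive terms are at most [3 W], and the damping [- 4 W] prevails. *)
pose Wm := Num.max (W s') 1 + 72 * k ^+ 2.
have Wm0 : 1 <= Wm.
  by have : 1 <= Num.max (W s') 1 by [rewrite le_max lexx orbT]; have := sqr_ge0 k; rewrite /Wm; rlra.
have hW t : s' <= t -> W t <= Wm.
  move=> st; apply: (@barrier_le _ W (fun x => 2 * Y x * ((1 - Y x ^+ 2) * (3 * k * (X x / r x) - 2 * Y x) / X x) * r x +
     Y x ^+ 2 * ((X x ^+ 2 - 4 * k * X x * Y x + 2 * r x * Y x ^+ 2) / X x)) _ s' t) => //.
  - move=> x hx; have [_ _ _ _ [_ dY dr _]] := pol x ltac:(rlra).
    by rewrite /W; der_eq; rewrite expr1.
  - have : W s' <= Num.max (W s') 1 by rewrite le_max lexx.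
    by have := sqr_ge0 k; rewrite /Wm; rlra.
  - move=> x hx hWx; have [Xx /andP[Y0 Y1] rx _ _] := pol x ltac:(rlra).
    have /andP[_ h2] := hq x ltac:(rlra); have Y4 := hY x ltac:(rlra).
    have -> : 2 * Y x * ((1 - Y x ^+ 2) * (3 * k * (X x / r x) - 2 * Y x) / X x) * r x +
      Y x ^+ 2 * ((X x ^+ 2 - 4 * k * X x * Y x + 2 * r x * Y x ^+ 2) / X x) =
      (Y x ^+ 2 * X x ^+ 2 + 6 * Y x ^+ 2 * W x - 4 * W x + 6 * k * (X x * Y x) - 10 * (k * (X x * Y x) * Y x ^+ 2)) / X x.
      by rewrite /W; field; rewrite !gt_eqF //; rlra.
    rewrite pmulr_lle0 ?invr_gt0 //.
    have h3 : Y x ^+ 2 * X x ^+ 2 <= 2 * W x by rewrite /W; have := sqr_ge0 (Y x); rnra.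
    have XY0 : 0 <= X x * Y x by rewrite mulr_ge0 // ltW.
    have W72 : 72 * k ^+ 2 <= W x.
      have : 1 <= Num.max (W s') 1 by rewrite le_max lexx orbT.
      by move: hWx; rewrite /Wm; rlra.
    have W0 : 0 <= W x by rewrite /W mulr_ge0 ?sqr_ge0 //; rlra.
    have h4 : 6 * k * (X x * Y x) <= W x.
      rewrite -ler_sqr ?nnegrE //; last by rewrite mulr_ge0 // mulr_ge0.
      have -> : (6 * k * (X x * Y x)) ^+ 2 = 36 * k ^+ 2 * (Y x ^+ 2 * X x ^+ 2) by ring.
      apply: (@le_trans _ _ (36 * k ^+ 2 * (2 * W x))); first by rewrite ler_wpM2l // mulr_ge0 ?sqr_ge0.
      by rnra.
    have h5 : 6 * Y x ^+ 2 * W x <= W x.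
      by have : Y x ^+ 2 <= 1 / 16 by [rnra]; rnra.
    have h6 : 0 <= k * (X x * Y x) * Y x ^+ 2 by rewrite mulr_ge0 ?sqr_ge0 // mulr_ge0.
    by rlra.
have dV t : 0 < t -> is_der V t ((- (X t ^+ 2 / r t) * V t + (4 * (X t ^+ 2 / r t) - 2) * W t
    - 4 * k * (X t ^+ 2 / r t - 1) * (X t * Y t)) / X t).
  move=> /pol [Xt _ rt _ [dX _ dr _]]; rewrite /V; der_eq; rewrite expr1 /W /V.
  by field; rewrite !gt_eqF //; rlra.
(* With [q = X^2 / r] in [[q0, 2]], the damping is [- q V] and the forcing [(4 q - 2) W] lies
   between [- 2 Wm] and [6 Wm]. The last term of [V'] has the sign of [1 - q], that is of [- V], and
   thus helps on both sides. *)
pose Vp := Num.max (V s') (6 * Wm); pose Vm := Num.min (V s') (- (2 * Wm / q0)).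
have hVp t : s' <= t -> V t <= Vp.
  move=> st; apply: (@barrier_le _ V _ _ s' t st (fun x hx => dV x (lt_le_trans s'0 (andP hx).1))).
    by rewrite le_max lexx.
  move=> x hx; rewrite gt_max => /andP[_ Vx].
  have [Xx /andP[Y0 Y1] rx _ _] := pol x ltac:(rlra); have hWx := hW x ltac:(rlra).
  have W0 : 0 <= W x by rewrite /W mulr_ge0 ?sqr_ge0 //; rlra.
  have /andP[_ h2] := hq x ltac:(rlra).
  have XY0 : 0 <= X x * Y x by rewrite mulr_ge0 // ltW.
  rewrite pmulr_lle0 ?invr_gt0 //.
  have q1 : 1 <= X x ^+ 2 / r x by rewrite ler_pdivlMr ?mul1r; [rewrite /V in Vx; rlra|rlra].
  have q2 : X x ^+ 2 / r x <= 2 by rewrite ler_pdivrMr //; rlra.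
  have h3 : 0 <= 4 * k * (X x ^+ 2 / r x - 1) * (X x * Y x).
    by rewrite mulr_ge0 // mulr_ge0 ?mulr_ge0 // subr_ge0.
  by rnra.
have hVm t : s' <= t -> Vm <= V t.
  move=> st; apply: (@barrier_ge _ V _ _ s' t st (fun x hx => dV x (lt_le_trans s'0 (andP hx).1))).
    by rewrite ge_min lexx.
  move=> x hx; rewrite lt_min => /andP[_ Vx].
  have [Xx /andP[Y0 Y1] rx _ _] := pol x ltac:(rlra); have hWx := hW x ltac:(rlra).
  have W0 : 0 <= W x by rewrite /W mulr_ge0 ?sqr_ge0 //; rlra.
  have /andP[h1 _] := hq x ltac:(rlra).
  have XY0 : 0 <= X x * Y x by rewrite mulr_ge0 // ltW.
  rewrite divr_ge0 ?(ltW Xx) //.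
  have p : 0 <= 2 * Wm / q0 by rewrite divr_ge0 ?(ltW q00) //; rlra.
  have q1 : X x ^+ 2 / r x <= 1 by rewrite ler_pdivrMr ?mul1r; [rewrite /V in Vx; rlra|rlra].
  have q2 : q0 <= X x ^+ 2 / r x by rewrite ler_pdivlMr //; rlra.
  have h3 : 0 <= 4 * k * (1 - X x ^+ 2 / r x) * (X x * Y x).
    by rewrite mulr_ge0 // mulr_ge0 ?mulr_ge0 // subr_ge0.
  have h4 : 2 * Wm <= q0 * - V x.
    have -> : 2 * Wm = q0 * (2 * Wm / q0) by field; rewrite gt_eqF.
    by rewrite ler_wpM2l ?(ltW q00) //; rlra.
  have h5 : q0 * - V x <= X x ^+ 2 / r x * - V x by rewrite ler_wpM2r //; rlra.
  by rnra.
exists s', (Wm + `|Vp| + `|Vm|); split => //.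
  by have := normr_ge0 Vp; have := normr_ge0 Vm; rlra.
move=> t st; split; first exact: hY.
  by apply: le_trans (hW t st) _; have := normr_ge0 Vp; have := normr_ge0 Vm; rlra.
rewrite ler_norml; have := hVp t st; have := hVm t st; rewrite /V.
have := ler_norm Vp; have := lerNnormlW (lexx `|Vm|); have := normr_ge0 Vp; have := normr_ge0 Vm.
by rlra.
Qed.

(** The derivative of [R_ = sqrt r] differs from [1 / 2] by a bounded numerator, by the defect
    bounds, over [2 X R_], which grows at least quadratically. This error is integrable, with
    primitive [- K3 / t] as a comparison function. *)
Lemma polar_sqrt_r_asymptotics k X Y r z s q0 : polar k X Y r z -> 0 <= k -> 2 * k ^+ 2 < 1 ->
  0 < s -> 0 < q0 <= 1 -> (forall t, s <= t -> q0 * r t <= X t ^+ 2 <= 2 * r t) ->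
  exists s' K, [/\ 0 < s', 0 < K & forall t, s' <= t ->
    [/\ Y t <= 1 / 4, Y t ^+ 2 * r t <= K, `|X t ^+ 2 - r t| <= K & `|Num.sqrt (r t) - t / 2| <= K]].
Proof.
move=> pol k0 kc s0 q0b hq; have /andP[q00 q01] := q0b.
have hq1 t : s <= t -> q0 * r t <= X t ^+ 2 by move=> /hq /andP[].
have [c c0 hc] := polar_r_quadratic pol kc s0 q00 hq1.
have [s1 [K [ss1 K0 hK]]] := polar_defects pol k0 kc s0 q0b hq.
pose R_ t := Num.sqrt (r t).
have rR t : 0 < t -> 1 <= R_ t /\ r t = R_ t ^+ 2.
  move=> /pol [_ _ rt _ _]; rewrite /R_ sqr_sqrtr; last by rlra.
  by split => //; rewrite -[X in X <= _]sqrtr1 ler_wsqrtr.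
pose dR t := (X t ^+ 2 - 4 * k * X t * Y t + 2 * r t * Y t ^+ 2) / X t / (2 * R_ t).
have hdR t : 0 < t -> is_der R_ t (dR t).
  by move=> /pol [_ _ rt _ [_ _ dr _]]; apply: (@der_sqrt _ r) => //; rlra.
pose s2 := Num.max s1 (2 * s).
have [s21 s22] : s1 <= s2 /\ 2 * s <= s2 by rewrite /s2 !le_max !lexx orbT.
pose K2 := 3 * K + 4 * k * (1 + 2 * K); pose K3 := K2 / (2 * q0 * c).
have K20 : 0 < K2 by rewrite /K2 ltr_wpDr ?mulr_ge0 ?mulr_gt0 //; rlra.
have K30 : 0 < K3 by rewrite /K3 divr_gt0 ?mulr_gt0.
have hbound t : s2 <= t -> `|dR t - 1 / 2| <= K3 / t ^+ 2.
  move=> st; have t0 : 0 < t by rlra.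
  have [Xt /andP[Y0 Y1] rt _ _] := pol t t0; have [R1 rRt] := rR t t0.
  have [Y4 WK VK] := hK t ltac:(rlra); have hqt := hq1 t ltac:(rlra); have hct := hc t ltac:(rlra).
  have Rp : 0 < R_ t by rlra.
  have -> : dR t - 1 / 2 = (X t ^+ 2 - 4 * k * (X t * Y t) + 2 * (Y t ^+ 2 * r t) - X t * R_ t) / (2 * (X t * R_ t)).
    by rewrite /dR; field; rewrite !gt_eqF.
  have XR0 : 0 < X t * R_ t by rewrite mulr_gt0.
  rewrite normrM normfV [X in _ / X]gtr0_norm ?mulr_gt0 //.
  have hXR : q0 * c * t ^+ 2 <= X t * R_ t.
    apply: (@le_trans _ _ (q0 * r t)); first by rewrite -mulrA ler_wpM2l // ltW.
    rewrite rRt expr2 mulrA ler_wpM2r ?(ltW Rp) //.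
    rewrite -ler_sqr ?nnegrE ?(ltW Xt) //; last by rewrite mulr_ge0 // ltW.
    apply: le_trans hqt; rewrite rRt exprMn ler_wpM2r ?sqr_ge0 // expr2.
    by rewrite ler_piMr // ltW.
  have -> : K3 / t ^+ 2 = K2 / (2 * (q0 * c * t ^+ 2)).
    by rewrite /K3; field; rewrite !gt_eqF ?exprn_gt0.
  apply: ler_pM => //; first by rewrite invr_ge0 mulr_ge0 // ltW.
  - have XY0 : 0 <= X t * Y t by rewrite mulr_ge0 // ltW.
    have XY1 : X t * Y t <= 1 + 2 * K.
      have /andP[_ h] := hq t ltac:(rlra).
      have h2 : (X t * Y t) ^+ 2 <= 2 * K.
        rewrite exprMn; apply: (@le_trans _ _ (2 * r t * Y t ^+ 2)); first by rewrite ler_wpM2r ?sqr_ge0.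
        by rlra.
      by rnra.
    have kXY : 4 * k * (X t * Y t) <= 4 * k * (1 + 2 * K) by rewrite ler_wpM2l // mulr_ge0.
    have kXY0 : 0 <= 4 * k * (X t * Y t) by rewrite mulr_ge0 // mulr_ge0.
    have W0 : 0 <= Y t ^+ 2 * r t by rewrite mulr_ge0 ?sqr_ge0 //; rlra.
    have XR : `|X t ^+ 2 - X t * R_ t| <= K.
      have -> : X t ^+ 2 - X t * R_ t = (X t ^+ 2 - r t) * (X t / (X t + R_ t)).
        by rewrite rRt; field; rewrite gt_eqF // addr_gt0.
      rewrite normrM -[K]mulr1; apply: ler_pM => //.
      rewrite ger0_norm; last by rewrite divr_ge0 // ltW // addr_gt0.
      by rewrite ler_pdivrMr ?addr_gt0 // mul1r lerDl ltW.
    move: XR; rewrite /K2 !ler_norml => /andP[h1 h2]; apply/andP; split; rlra.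
  - by rewrite lef_pV2 ?posrE ?mulr_gt0 ?exprn_gt0 // ler_wpM2l.
have s20 : 0 < s2 by rlra.
have hI t : 0 < t -> is_der (fun x : R => K3 / x) t (- (K3 / t ^+ 2)).
  move=> t0; have h : is_der (fun x : R => K3 * x^-1) t (0 * t^-1 + K3 * (- 1 / t ^+ 2)).
    by apply: derM; [exact: der_cst|apply: derV; [rewrite gt_eqF|exact: der_id]].
  by apply: (der_eq h); ring.
pose a := R_ s2 - s2 / 2.
exists s2, (K + `|a| + K3 / s2).
have K3s : 0 < K3 / s2 by rewrite divr_gt0.
split => //; first by have := normr_ge0 a; rlra.
move=> t st; have t0 : 0 < t by rlra.
have [Y4 WK VK] := hK t ltac:(rlra); have na := normr_ge0 a.
split; [exact: Y4|rlra|rlra|].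
have up : R_ t - t / 2 + K3 / t <= R_ s2 - s2 / 2 + K3 / s2.
  apply: (@le0_der_ge _ (fun x => R_ x - x / 2 + K3 / x) (fun x => dR x - 1 / 2 - K3 / x ^+ 2)) => // x hx.
    by have x0 : 0 < x by [rlra]; have h1 := hI x x0; have h2 := hdR x x0; der_eq; ring.
  by have := hbound x ltac:(rlra); rewrite ler_norml; rlra.
have lo : R_ s2 - s2 / 2 - K3 / s2 <= R_ t - t / 2 - K3 / t.
  apply: (@ge0_der_le _ (fun x => R_ x - x / 2 - K3 / x) (fun x => dR x - 1 / 2 + K3 / x ^+ 2)) => // x hx.
    by have x0 : 0 < x by [rlra]; have h1 := hI x x0; have h2 := hdR x x0; der_eq; ring.
  by have := hbound x ltac:(rlra); rewrite ler_norml; rlra.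
have K3t : 0 < K3 / t by rewrite divr_gt0.
have := ler_norm a; have := lerNnormlW (lexx `|a|).
by rewrite -/(R_ t) -/a in up lo *; rewrite ler_norml /a in up lo *; rlra.
Qed.

Lemma sqrt_close (F r C : R) : 0 <= F -> 0 < r -> `|F - r ^+ 2| <= C * r -> `|Num.sqrt F - r| <= C.
Proof.
move=> F0 r0 h; have s0 := sqrtr_ge0 F.
rewrite -(ler_pM2r r0); apply: le_trans h.
rewrite -{2}(sqr_sqrtr F0) subr_sqr normrM ler_wpM2l // ger0_norm; rlra.
Qed.

(** Put [Q = sqrt (A / z)] and [v = y / z]. As [z^2 (1 - v^2) = 1], the squares [A (z + y)] and
    [A (z - y)] are [Q^2 / (1 - v)] and [Q^2 / (1 + v)]. Since [Q v] is bounded, they differ from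
    [Q^2] by a multiple of [Q] only, and their square roots from [Q] by a constant. *)
Lemma closing_asymptotics k f A y z : closing_solution k +oo%E f A y z -> 2 * k ^+ 2 < 1 ->
  exists M K, 0 < M /\ forall t, M <= t ->
    [/\ `|f t - t / 2| <= K, `|Num.sqrt (A t * (z t + y t)) - t / 2| <= K &
        `|Num.sqrt (A t * (z t - y t)) - t / 2| <= K].
Proof.
move=> sol kc; have [k0 _ red [cf cA cy cz _]] := sol.
have pol := closing_polar sol (ltW kc).
pose X t := f t / z t; pose Y t := y t / z t; pose r t := A t / z t.
have cX : X t ^+ 2 @[t --> 0^'+] --> (0 : R).
  apply: (@cvg_right_lim _ _ ((0 * 1^-1) * (0 * 1^-1))); last by ring.
  rewrite /X; under eq_fun do rewrite expr2.
  by apply: cvgM; (apply: cvgM => //; apply: cvgV => //; exact: oner_neq0).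
have [s /andP[s0 _] hs] := pick_lim ltr01 cX ltr01.
have hs' : X s ^+ 2 <= 2 * r s by have [_ _ h _ _] := pol s s0; rewrite /r; rlra.
have [q0 [q0b hq]] := polar_q_bounds pol s0 hs'.
have [M [K [M0 K0 hM]]] := polar_sqrt_r_asymptotics pol k0 kc s0 q0b hq.
exists M, (3 * K + 2 * (1 + K) + K); split => // t Mt; have t0 : 0 < t by rlra.
have Dt : oitv (0%:E : \bar R) +oo%E t by rewrite /oitv /= lte_fin t0 ltry.
have [fx Ax zx zy _] := red t Dt; have [_ /andP[Y0 _] r1 _ _] := pol t t0.
have [Y4 WK VK RK] := hM t Mt.
have rE : A t / z t = Num.sqrt (A t / z t) ^+ 2 by rewrite sqr_sqrtr //; rlra.
have R1 : 1 <= Num.sqrt (A t / z t) by rewrite -[X in X <= _]sqrtr1 ler_wsqrtr.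
set Q := Num.sqrt (A t / z t) in RK R1 rE; set v := y t / z t in Y0 Y4 WK.
have Q0 : 0 < Q by rlra.
have Qv : Q * v <= 1 + K.
  have h : (Q * v) ^+ 2 <= K by rewrite exprMn -rE mulrC.
  by have := sqr_ge0 (Q * v - 1); have := mulr_ge0 (ltW Q0) Y0; rnra.
have zn : z t != 0 by rewrite gt_eqF.
have v1 : z t ^+ 2 * (1 - v ^+ 2) = 1.
  have -> : z t ^+ 2 * (1 - v ^+ 2) = z t ^+ 2 - y t ^+ 2 by rewrite /v; field.
  by rewrite zy addrK.
have close (F : R) : 0 <= F -> `|F - Q ^+ 2| <= (3 * K + 2 * (1 + K)) * Q ->
  `|Num.sqrt F - t / 2| <= 3 * K + 2 * (1 + K) + K.
  move=> F0 /(sqrt_close F0 Q0) h.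
  by have := ler_normD (Num.sqrt F - Q) (Q - t / 2); rewrite addrA subrK; rlra.
have e2 : (1 - v) * (A t * (z t + y t)) = Q ^+ 2.
  rewrite -rE; have -> : A t / z t = A t / z t * (z t ^+ 2 * (1 - v ^+ 2)) by rewrite v1 mulr1.
  by rewrite /v; field.
have e3 : (1 + v) * (A t * (z t - y t)) = Q ^+ 2.
  rewrite -rE; have -> : A t / z t = A t / z t * (z t ^+ 2 * (1 - v ^+ 2)) by rewrite v1 mulr1.
  by rewrite /v; field.
have yz : y t <= z t.
  by have : y t = v * z t by [rewrite /v divfK]; rnra.
have yz' : 0 <= y t + z t.
  by have : y t = v * z t by [rewrite /v divfK]; rnra.
have QQ : Q ^+ 2 * v <= Q * (1 + K) by rewrite expr2 -mulrA ler_wpM2l // ltW.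
split.
- have -> : f t = Num.sqrt (f t ^+ 2) by rewrite sqrtr_sqr ger0_norm // ltW.
  apply: close; first exact: sqr_ge0.
  have e1 : (1 - v ^+ 2) * (f t ^+ 2 - Q ^+ 2) = ((f t / z t) ^+ 2 - A t / z t) + v ^+ 2 * (A t / z t).
    rewrite rE; have -> : (f t / z t) ^+ 2 = f t ^+ 2 * (z t ^+ 2 * (1 - v ^+ 2)) / z t ^+ 2 by rewrite v1 mulr1 expr_div_n.
    by field.
  have h15 : 15 / 16 <= 1 - v ^+ 2 by rnra.
  have W0 : 0 <= v ^+ 2 * (A t / z t) by rewrite mulr_ge0 ?sqr_ge0 //; rlra.
  apply: (@le_trans _ _ (3 * K)); last by rnra.
  have h2 : `|(1 - v ^+ 2) * (f t ^+ 2 - Q ^+ 2)| <= 2 * K.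
    rewrite e1; move: VK; rewrite !ler_norml => /andP[h1 h2]; apply/andP; split; rlra.
  move: h2; rewrite normrM [`|1 - v ^+ 2|]ger0_norm; last by rlra.
  by have := normr_ge0 (f t ^+ 2 - Q ^+ 2); rnra.
- have F0 : 0 <= A t * (z t + y t) by rewrite mulr_ge0 ?(ltW Ax) //; rlra.
  apply: close => //; rewrite ger0_norm; last by rnra.
  have : 3 / 4 * (A t * (z t + y t)) <= Q ^+ 2 by rewrite -e2; rnra.
  have : A t * (z t + y t) - Q ^+ 2 = v * (A t * (z t + y t)) by rewrite -e2; ring.
  move=> -> h; apply: (@le_trans _ _ (4 / 3 * (Q ^+ 2 * v))); first by rnra.
  by rnra.
- have F0 : 0 <= A t * (z t - y t) by rewrite mulr_ge0 ?(ltW Ax) //; rlra.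
  apply: close => //; rewrite ler0_norm; last by rnra.
  have : - (A t * (z t - y t) - Q ^+ 2) = v * (A t * (z t - y t)) by rewrite -e3; ring.
  move=> ->; apply: (@le_trans _ _ (Q ^+ 2 * v)); first by rewrite -e3; rnra.
  by rnra.
Qed.

Lemma asymptotic_of_closing (c : 'I_3 -> R) k (g : 'I_3 -> R -> R) :
  soliton_ode c (oitv 0%:E +oo%E) g ->
  closing_solution k +oo%E (g 0) (red_A g) (red_y g) (red_z g) -> 2 * k ^+ 2 < 1 ->
  forall N i, decays N 0 (fun t => g i t - 1 / 2 * t).
Proof.
move=> ode sol kc; have [M [K [M0 hK]]] := closing_asymptotics sol kc.
apply: (ode_decays ode) => i; exists K, M => // t Mt; have t0 : 0 < t by rlra.
rewrite powRr0 mulr1.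
have Dt : oitv (0%:E : \bar R) +oo%E t by rewrite /oitv /= lte_fin t0 ltry.
have [gp _] := ode t Dt; have [h0 h1 h2] := hK t (ltW Mt).
have -> : 1 / 2 * t = t / 2 by field.
elim/I3P: i => //.
- by move: h1; rewrite -red_sq1 // sqrtr_sqr (ger0_norm (ltW (gp 1))).
- by move: h2; rewrite -red_sq2 // sqrtr_sqr (ger0_norm (ltW (gp 2))).
Qed.

End Conical.

(** * The conical solitons with nonzero torsion *)

Section NonCritical.
Context {R : realType}.
Implicit Types (c k t a b : R) (f g : 'I_3 -> R -> R) (u : R -> R).

Lemma S_soliton_nontrivial c (T : \bar R) f u : S_soliton 1 c T f u -> c != 0 ->
  ~ trivial_soliton 0%E T f u.
Proof.
move=> [[T0 _] _ _ [_ h _] _] c0 htriv; move/eqP: c0; apply.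
have [e e0 he] : exists2 e, 0 < e & forall t, 0 < t < e -> oitv 0%:E T t.
  case: T T0 htriv => [T||] //; first by rewrite lte_fin => T0 _; exists T => // t; rewrite /oitv /= !lte_fin.
  by move=> _ _; exists 1 => // t /andP[t0 _]; rewrite /oitv /= lte_fin t0 ltry.
apply: (cvg_right_uniq h); apply: (cvg_right_ext e0 (F := fun=> 0)); last exact: cvg_cst.
by move=> t /he ht; have [_ ->] := htriv t ht.
Qed.

Lemma asymptotic_of_decays f m t0 : (forall N i, decays N m (fun t => f i (t + t0) - 1 / 2 * t)) ->
  asymptotic_to (@C_tf R) (m - 1) f.
Proof.
move=> h; exists t0 => i n; have [K hK] := decays_derive1n (h^~ i) n.
by exists K; rewrite [1 + _]addrC subrK.
Qed.

Lemma noncritical_soliton c (T : \bar R) f u : 0 < c ^+ 2 -> c ^+ 2 < 9 / 2 -> S_soliton 1 c T f u ->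
  [/\ T = +oo%E, ~ trivial_soliton 0%E T f u & asymptotic_to (@C_tf R) (- 1) f].
Proof.
move=> c0 hc hS; have TE := subcritical_complete hS (ltW hc).
split => //.
  by apply: S_soliton_nontrivial hS _; apply/eqP => h; move: c0; rewrite h expr0n ltxx.
have [s [cc [g [[s0 gE] _ ode _ sol]]]] := S_closing_solution hS; rewrite TE in ode sol.
have kc : 2 * (`|c| / 3) ^+ 2 < 1 by rewrite expr_div_n -normrX ger0_norm ?sqr_ge0 //; rlra.
have h := asymptotic_of_closing ode sol kc.
rewrite -[-1]add0r; apply: (@asymptotic_of_decays _ _ 0) => N i.
have := h N (s^-1%g i); rewrite gE permKV.
by under [X in _ -> decays _ _ X]eq_fun do rewrite addr0.
Qed.

End NonCritical.

(** * The torsion-free soliton and the torsion-free cone *)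

Section TorsionFree.
Context {R : realType}.
Implicit Types (c k t a b : R) (f g : 'I_3 -> R -> R) (u : R -> R).

(* With [h = f_1] and [a = f_2 = f_3]. *)
Definition torsion_free_ode (h a : R -> R) : Prop := forall t, 0 < t ->
  [/\ 0 < h t, 0 < a t, a t ^+ 4 = 1 + (h t * a t) ^+ 2,
      is_der h t (1 - h t ^+ 2 / (2 * a t ^+ 2)) & is_der a t (h t / (2 * a t))].

Lemma S_soliton_zero (T : \bar R) f u : S_soliton 1 0 T f u ->
  [/\ T = +oo%E, trivial_soliton 0%E T f u, torsion_free_ode (f 0) (f 1) &
      forall t, 0 < t -> f 2 t = f 1 t].
Proof.
move=> hS; have TE : T = +oo%E by apply: subcritical_complete hS _; rewrite expr0n /=; rlra.
have [s [cc [g [[s0 gE] [c0 c1 c2] ode hu sol]]]] := S_closing_solution hS; rewrite TE in ode sol hu *.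
rewrite normr0 mul0r in c1 c2 sol; rewrite mulr0 in c1 c2; rewrite oppr0 in c2.
have cc0 i : cc i = 0 by elim/I3P: i.
have u0 x : soliton_u cc x = 0 by rewrite /soliton_u !cc0; ring.
have Dt t : 0 < t -> oitv (0%:E : \bar R) +oo%E t by move=> t0; rewrite /oitv /= lte_fin t0 ltry.
have fE i : f i = g (s^-1%g i) by rewrite gE permKV.
have odef : soliton_ode (fun=> 0) (oitv (0%:E : \bar R) +oo%E) f.
  have := soliton_ode_perm s^-1%g ode.
  have -> : (fun i => cc (s^-1%g i)) = (fun=> 0) by apply/funext => i.
  by have -> : (fun i => g (s^-1%g i)) = f by apply/funext => i; rewrite fE.
have u0' x : soliton_u (fun=> 0) x = 0 :> R by rewrite /soliton_u; ring.
have [_ _ red [cf cA cy cz _]] := sol.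
have g12 t : 0 < t -> g 1 t = g 2 t.
  move=> /Dt ht; have [gp _] := ode t ht; have y0 := closing_y_zero sol ht.
  have h1 := red_sq1 (gp 1) (gp 2); have h2 := red_sq2 (gp 1) (gp 2).
  apply/eqP; rewrite -(@eqrXn2 _ 2) ?(ltW (gp _)) //; apply/eqP.
  by rewrite h1 h2 y0 addr0 subr0.
have f0 : f 0 = g 0 by rewrite gE s0.
have f12 i t : i != 0 -> 0 < t -> f i t = g 1 t.
  move=> i0 t0; rewrite fE; have : s^-1%g i != 0.
    by apply: contra i0 => /eqP h; rewrite -(permKV s i) h s0.
  by elim/I3P: (s^-1%g i) => //; rewrite -g12.
split => //.
- move=> t ht; split; first by rewrite hu.
  by move=> i; rewrite (ode_tau i odef ht) u0' mul0r addr0.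
(* For [y = 0] and [z = 1] the expression [A^2 - f_1^2 A] is a first integral, with limit 1 at the
   zero section. In terms of [r = f_1 f_3] it is the Bryant-Salamon relation [f_2^4 = 1 + r^2]. *)
- have A1 t : 0 < t -> red_A g t ^+ 2 - g 0 t ^+ 2 * red_A g t = 1.
    move=> t0.
    have dB x : 0 < x -> is_der (fun x => red_A g x ^+ 2 - g 0 x ^+ 2 * red_A g x) x 0.
      move=> /Dt hx; have [f0x A0 z0 zy [df dA _ _]] := red x hx.
      have y0 := closing_y_zero sol hx.
      have z1 : red_z g x = 1.
        have := zy; rewrite y0 expr0n /= addr0 => /eqP; rewrite sqrf_eq1 => /orP[/eqP //|/eqP h].
        by move: z0; rewrite h; rlra.
      der_eq; rewrite expr1 /fdot y0 z1; field; exact: lt0r_neq0.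
    apply: (@cvg_right_uniq _ (fun x => red_A g x ^+ 2 - g 0 x ^+ 2 * red_A g x)).
      apply: (cvg_right_ext t0 (F := fun=> red_A g t ^+ 2 - g 0 t ^+ 2 * red_A g t)); last exact: cvg_cst.
      move=> x /andP[x0 xt]; apply/esym; apply: (@der0_eq _ (fun x => red_A g x ^+ 2 - g 0 x ^+ 2 * red_A g x) x t (ltW xt)).
      by move=> y hy; apply: dB; rlra.
    apply: (@cvg_right_lim _ _ (1 * 1 - 0 * 0 * 1)); last by ring.
    under eq_fun do rewrite !expr2.
    by apply: cvgB; apply: cvgM => //; exact: cvgM.
  move=> t t0; have ht := Dt t t0; have [fp hd] := odef t ht.
  have e1 : f 2 t = f 1 t by rewrite !f12.
  have n0 : f 0 t != 0 by exact: lt0r_neq0.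
  have n1 : f 1 t != 0 by exact: lt0r_neq0.
  split => //.
  + have := A1 t t0; rewrite /red_A -g12 // -(f12 1) // -f0 => h.
    by rewrite exprMn -h; ring.
  + move/der_eq: (hd 0); apply; rewrite /soliton_field u0' e1; field.
    by rewrite n0 n1.
  + move/der_eq: (hd 1); apply; rewrite /soliton_field u0' e1; field.
    by rewrite n0 n1.
- by move=> t t0; rewrite !f12.
Qed.

Lemma S_soliton_bryant_salamon (T : \bar R) f u : S_soliton 1 0 T f u -> bryant_salamon 1 0%E T f.
Proof.
move=> hS; have [_ _ ode f12] := S_soliton_zero hS; split; first exact: oner_neq0.
move=> t /andP[]; rewrite lte_fin => t0 _; have [h0 a0 ha _ _] := ode t t0.
rewrite /= (f12 t t0) expr1n.
have -> : (f 0 t * f 1 t) ^+ 2 + 1 = f 1 t `^ 4%:R by rewrite powR_mulrn ?(ltW a0) // ha addrC.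
have e : (f 1 t `^ 4%:R) `^ (1 / 4) = f 1 t.
  by rewrite -powRrM mul1r divff ?pnatr_eq0 // powRr1 // ltW.
by split => //; rewrite powRN e mulfK // gt_eqF.
Qed.

(** Here [a' = h / (2 a)], and the algebraic relation gives [1 - (2 a')^2 = a^-4], so [a' - 1 / 2]
    is of order -4 and [a - t / 2] converges with an error of order -3. Derivatives follow because
    [a'' = a^-5 / 2] involves [a] alone, and [h = 2 a a'] is recovered algebraically. *)
Lemma torsion_free_ode_asymptotics (h a : R -> R) K : torsion_free_ode h a ->
  ev (fun t => `|a t - t / 2| <= K) ->
  exists t0, forall N, decays N (- 3) (fun t => a (t + t0) - 1 / 2 * t) /\
    decays N (- 3) (fun t => h (t + t0) - 1 / 2 * t).
Proof.
move=> ode hK.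
have da' t : 0 < t -> - (a t ^- 4) / 2 <= h t / (2 * a t) - 1 / 2 <= 0.
  move=> /ode [h0 a0 ha _ _]; set p := h t / (2 * a t).
  have p0 : 0 < p by rewrite divr_gt0 // mulr_gt0.
  have e : (1 - 2 * p) * (1 + 2 * p) = a t ^- 4.
    have -> : (1 - 2 * p) * (1 + 2 * p) = (a t ^+ 4 - (h t * a t) ^+ 2) / a t ^+ 4.
      by rewrite /p; field; exact: lt0r_neq0.
    by rewrite ha addrK mul1r.
  have w0 : 0 < a t ^- 4 by rewrite invr_gt0 exprn_gt0.
  by apply/andP; split; rnra.
have [M [M0 M1 hM]] : exists M, [/\ 0 < M, 4 * K < M & forall t, M < t -> `|a t - t / 2| <= K].
  have [M M0 hM] := evI hK (ev_gt (4 * K)).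
  exists (Num.max M (4 * K + 1)); rewrite !lt_max M0; split => //; first by apply/orP; right; rlra.
  by move=> t; rewrite gt_max => /andP[/hM []].
have a4 t : M < t -> t / 4 <= a t by move=> Mt; have := hM t Mt; rewrite ler_norml; rlra.
have [B B0 aV] : exists2 B, 0 < B & forall t, M < t -> a t ^- 4 <= B / t ^+ 4.
  exists (4 ^+ 4) => [|t Mt]; first by rewrite exprn_gt0.
  have t0 : 0 < t by rlra.
  rewrite -expr_div_n -[4 / t]invf_div exprVn.
  rewrite lef_pV2 ?posrE ?exprn_gt0 ?divr_gt0 //; last by have := a4 t Mt; rlra.
  by rewrite lerXn2r ?nnegrE; have := a4 t Mt; rlra.
pose e t := a t - t / 2.
have de t : 0 < t -> is_der e t (h t / (2 * a t) - 1 / 2).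
  by move=> /ode [_ _ _ _ d]; rewrite /e; der_eq; ring.
have e_dec s t : M < s -> s <= t -> e t <= e s.
  move=> Ms st; apply: (@le0_der_ge _ e (fun x => h x / (2 * a x) - 1 / 2) s t st) => x hx.
    by apply: de; rlra.
  by have /andP[] := da' x ltac:(rlra).
have e_inc s t : M < s -> s <= t -> e s - B / s ^+ 3 <= e t - B / t ^+ 3.
  move=> Ms st; apply: (@ge0_der_le _ (fun x => e x - B / x ^+ 3)
    (fun x => h x / (2 * a x) - 1 / 2 + 3 * B / x ^+ 4)) => // x hx.
    have x0 : 0 < x by rlra.
    have d1 := de x x0.
    have n0 : x != 0 by exact: lt0r_neq0.
    have d2 : is_der (fun x : R => x * x * x) x (3 * x ^+ 2) by der_eq; ring.
    have n3 : x * x * x != 0 by rewrite !mulf_neq0.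
    have d3 : is_der (fun x : R => (x * x * x)^-1) x (- (3 * x ^+ 2) / (x * x * x) ^+ 2) := @derV _ (fun v => v * v * v) x _ n3 d2.
    have -> : (fun x1 : R => e x1 - B / x1 ^+ 3) = (fun x1 : R => e x1 - B * (x1 * x1 * x1)^-1).
      by apply/funext => v; rewrite !exprS expr0 mulr1 mulrA.
    have [_ /lt0r_neq0 an _ _ _] := ode x x0.
    by der_eq; field; rewrite n0 an.
  have /andP[h1 _] := da' x ltac:(rlra); have h2 := aV x ltac:(rlra).
  have h3 : 0 < (x ^+ 4)^-1 by rewrite invr_gt0 exprn_gt0; rlra.
  by have := mulr_gt0 B0 h3; rlra.
pose E := [set e t | t in [set t | M < t]].
have E_lb : has_lbound E.
  exists (- K) => _ [t Mt <-]; have := hM t Mt; rewrite /e ler_norml; rlra.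
pose L := inf E.
have L_le t : M < t -> L <= e t by move=> Mt; apply: ge_inf => //; exists t.
have L_ge t : M < t -> e t - B / t ^+ 3 <= L.
  move=> Mt; apply: lb_le_inf; first by exists (e t), t.
  move=> _ [s Ms <-]; have t3 : 0 < B / t ^+ 3 by rewrite divr_gt0 // exprn_gt0; rlra.
  have s3 : 0 < B / s ^+ 3 by rewrite divr_gt0 // exprn_gt0; move: Ms => /=; rlra.
  have [st|ts] := leP s t; first by have := e_dec s t Ms st; rlra.
  by have := e_inc t s Mt (ltW ts); rlra.
(* [L] is the limit of [a - t / 2]; translating by [- 2 L] removes it, so that order -3, hence rate
   -4, is reached. *)
exists (- 2 * L); pose t0 := - 2 * L; rewrite -/t0.
have sh : ev (fun t => [/\ 0 < t, M < t + t0, t / 2 <= t + t0 & 0 < t + t0]).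
  by apply: evS (evI (ev_gt (M + 2 * `|t0|)) (ev_gt M)) => t tp [h1 h2]; have := ler_norm (- t0); rewrite normrN; have := normr_ge0 t0; split; rlra.
have shV n t : [/\ 0 < t, M < t + t0, t / 2 <= t + t0 & 0 < t + t0] ->
    (t + t0) ^- n <= 2 ^+ n * t `^ (- n%:R).
  move=> [tp _ h1 h2]; rewrite powRN powR_mulrn ?(ltW tp) //.
  have -> : 2 ^+ n * t ^- n = (t / 2) ^- n by rewrite expr_div_n invf_div.
  by rewrite lef_pV2 ?posrE ?exprn_gt0 ?divr_gt0 // lerXn2r // nnegrE ltW // divr_gt0.
have der_shift (F : R -> R) d t : is_der F (t + t0) d -> is_der (fun x => F (x + t0)) t d.
  move=> hF; rewrite -[d]mulr1; apply: der_comp => //.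
  by apply: der_eq; [apply: derD; [exact: der_id|exact: der_cst]|rewrite addr0].
pose d t := a (t + t0) - 1 / 2 * t.
pose p t := h (t + t0) / (2 * a (t + t0)) - 1 / 2.
have d_der : ev (fun t => is_der d t (p t)).
  apply: evS sh => t _ [_ _ _ st].
  have [_ _ _ _ d1] := ode (t + t0) st; have d2 := der_shift a _ _ d1.
  by rewrite /d /p; der_eq; ring.
have p_der : ev (fun t => is_der p t (1 / 2 * (a (t + t0))^-1 ^+ 5)).
  apply: evS sh => t _ [_ _ _ st].
  have [h0 a0 ha dh1 da1] := ode (t + t0) st.
  have dh2 := der_shift h _ _ dh1; have da2 := der_shift a _ _ da1.
  have an : a (t + t0) != 0 by exact: lt0r_neq0.
  rewrite /p; der_eq; first by rewrite mulf_neq0 // pnatr_eq0.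
  have -> : 1 / 2 * (a (t + t0))^-1 ^+ 5 = 1 / 2 * (a (t + t0))^-1 ^+ 5 * (a (t + t0) ^+ 4 - (h (t + t0) * a (t + t0)) ^+ 2).
    by rewrite ha addrK mulr1.
  by field.
have d_b : bounded_by (- 3) d.
  exists (B * 2 ^+ 3); apply: evS sh => t _ hs; have [tp h1 h2 h3] := hs.
  have := L_le _ h1; have := L_ge _ h1; have := shV 3%N t hs.
  have -> : d t = e (t + t0) - L by rewrite /d /e /t0; field.
  move=> /(ler_wpM2l (ltW B0)); rewrite mulrA => k1 k2 k3; rewrite ger0_norm; rlra.
have p_b : bounded_by (- 4) p.
  exists (B * 2 ^+ 4); apply: evS sh => t _ hs; have [tp h1 h2 h3] := hs.
  have := da' _ h3; have := aV _ h1; have := shV 4%N t hs.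
  move=> /(ler_wpM2l (ltW B0)); rewrite -/(p t) mulrA => k1 k2 /andP[k3 k4].
  have w0 : 0 < a (t + t0) ^- 4 by rewrite invr_gt0 exprn_gt0 //; have [] := ode _ h3.
  by rewrite ler0_norm //; rlra.
have aE N : decays N (- 3) d -> decays N 1 (fun t => a (t + t0)).
  move=> hd; apply: (@decays_eq _ _ _ (fun t => d t + 1 / 2 * t)); first by exists 1 => // t _; rewrite /d; ring.
  apply: decaysD; first by apply: decays_le hd; rlra.
  by apply: decaysZ; exact: decays_id.
have a8 : ev (fun t => 1 / 8 * t `^ 1 <= a (t + t0)).
  apply: evS sh => t _ [tp h1 h2 h3]; rewrite powRr1 ?(ltW tp) //.
  by have := a4 _ h1; rlra.
have p_dec N : decays N (- 3) d -> decays N (- 4) p.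
  move=> hd; apply: decaysW; apply: (decays_der p_der p_b).
  have -> : - 4 - 1 = - 1 *+ 5 :> R by ring.
  apply: decaysZ; apply: decaysX; apply: (@decaysV _ _ 1 (1 / 8)) => //; try exact: aE; rlra.
have d_dec N : decays N (- 3) d.
  elim: N => [|N IH]; first by split.
  apply: (decays_der d_der d_b); have -> : - 3 - 1 = - 4 :> R by ring.
  exact: p_dec.
move=> N; split; first exact: d_dec.
(* After the translation [h = 2 a (p + 1 / 2)] and [a = t / 2 + d]. *)
apply: (@decays_eq _ _ _ (fun t => d t + t * p t + 2 * (d t * p t))).
  apply: evS sh => t _ [_ _ _ st]; have [h0 a0 _ _ _] := ode (t + t0) st.
  by rewrite /d /p; field; exact: lt0r_neq0.
apply: decaysD; first apply: decaysD => //.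
  by have -> : - 3 = 1 + - 4 :> R by [ring]; apply: decaysM; [exact: decays_id|exact: p_dec].
apply: decaysZ; apply: (@decays_le _ _ (- 3 + - 4)); first by rlra.
by apply: decaysM => //; exact: p_dec.
Qed.

Lemma S_soliton_zero_asymptotic (T : \bar R) f u : S_soliton 1 0 T f u -> asymptotic_to (@C_tf R) (- 4) f.
Proof.
move=> hS; have [TE _ ode f12] := S_soliton_zero hS.
have [s [cc [g [[s0 gE] _ odeg _ sol]]]] := S_closing_solution hS; rewrite TE in odeg sol.
have kc : 2 * (`|0 : R| / 3) ^+ 2 < 1 by rewrite normr0 mul0r expr0n mulr0.
have [K hK] : bounded_by 0 (fun t => f 1 t - 1 / 2 * t).
  by have := asymptotic_of_closing odeg sol kc 0%N (s^-1%g 1); rewrite gE permKV => -[].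
have hK' : ev (fun t => `|f 1 t - t / 2| <= K).
  by apply: evS hK => t _; rewrite powRr0 mulr1; have -> : 1 / 2 * t = t / 2 by field.
have [t0 ht0] := torsion_free_ode_asymptotics ode hK'.
have -> : -4 = -3 - 1 :> R by ring.
apply: (@asymptotic_of_decays _ _ _ t0) => N i; have [h1 h2] := ht0 N.
elim/I3P: i => //; apply: decays_eq h1.
by apply: evS (ev_gt (- t0)) => t _ tt; rewrite f12 //; rlra.
Qed.

(** On a cone [tau_i = 0] reads [2 k_1 k_2 k_3 + 2 k_i^2 = k_1^2 + k_2^2 + k_3^2]. Subtracting two
    of these equations makes the [k_i] equal, and then [k^2 (2 k - 1) = 0]. *)
Lemma torsion_free_cone (k : 'I_3 -> R) : (forall i, 0 < k i) ->
  torsion_free 0%:E +oo%E (cone k) <-> cone k = @C_tf R.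
Proof.
move=> k0.
have dsq (l : 'I_3 -> R) i t : is_der (fun s => cone l i s ^+ 2) t (2 * l i ^+ 2 * t).
  by rewrite /cone; der_eq; rewrite expr1; ring.
split=> [[_ htau]|->].
  have D1 : oitv (0%:E : \bar R) +oo%E 1 by rewrite /oitv /= lte_fin ltr01 (ltry 1).
  have htau1 i : 2 * (k 0 * k 1 * k 2) + 2 * k i ^+ 2 = k 0 ^+ 2 + k 1 ^+ 2 + k 2 ^+ 2.
    have := htau i 1 D1; rewrite /tau (der_val (dsq k i 1)) /prodf /sumsq prod3 sum3 /cone !mulr1.
    have n j : k j != 0 by exact: lt0r_neq0.
    set P := k 0 * k 1 * k 2; have nP : P != 0 by rewrite !mulf_neq0.
    move=> h; apply/eqP; rewrite -subr_eq0; apply/eqP.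
    apply: (mulfI (_ : k i ^+ 2 / P != 0)); first by rewrite mulf_neq0 ?expf_neq0 // invr_eq0.
    by rewrite mulr0 -h; field.
  have e i j : k i = k j.
    apply/eqP; rewrite -(@eqrXn2 _ 2) ?(ltW (k0 _)) //; apply/eqP.
    by have := htau1 i; have := htau1 j; rlra.
  have hk : k 0 = 1 / 2.
    have := htau1 0; rewrite (e 1 0) (e 2 0) => h; have := k0 0.
    by have : k 0 ^+ 2 * (2 * k 0 - 1) = 0 by [rlra]; move=> /eqP; rewrite mulf_eq0 sqrf_eq0 => /orP[/eqP ->|/eqP]; rlra.
  by apply/funext => i; rewrite /C_tf /cone (e i 0) hk.
have cE i (t : R) : C_tf i t = 1 / 2 * t by [].
split; first split.
- by move=> i t /andP[]; rewrite lte_fin cE => t0 _; rewrite mulr_gt0.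
- move=> i; apply/smooth_onP => n; have o := @open_oitv R 0%:E +oo%E.
  by apply: CnM => //; [exact: Cn_cst|exact: Cn_id].
- move=> t _; have -> : prodf (@C_tf R) = (fun s => (1 / 2 * s) * (1 / 2 * s) * (1 / 2 * s)).
    by apply/funext => s; rewrite /prodf prod3.
  have d : is_der (fun s : R => (1 / 2 * s) * (1 / 2 * s) * (1 / 2 * s)) t (3 / 8 * t ^+ 2).
    by der_eq; field.
  by rewrite (der_val d) /sumsq sum3 !cE; field.
move=> i t /andP[]; rewrite lte_fin => t0 _.
by rewrite /tau (der_val (dsq (fun=> 1 / 2) i t)) /prodf /sumsq prod3 sum3 !cE; field; rewrite gt_eqF.
Qed.

End TorsionFree.

(** * The critical soliton *)

Section Critical.
Context {R : realType}.
Implicit Types (c t a b : R) (f g : 'I_3 -> R -> R) (u : R -> R).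

Lemma cvg_infty_ext (F G : R -> R) (l : R) : (forall t, 0 < t -> F t = G t) ->
  F t @[t --> +oo] --> l -> G t @[t --> +oo] --> l.
Proof.
move=> FG; apply: cvg_trans; apply: near_eq_cvg; near=> t.
by apply: FG; near: t; apply: nbhs_pinfty_gt; exact: num_real.
Unshelve. all: by end_near. Qed.

Lemma cvg_infty_lim (F : R -> R) (l m : R) : F t @[t --> +oo] --> l -> l = m -> F t @[t --> +oo] --> m.
Proof. by move=> h <-. Qed.

Definition critical_k : R := Num.sqrt (1 / 2).
Local Notation k := critical_k.

(** Here [A = z = cosh (k t)] and [y = sinh (k t)] with [2 k^2 = 1], so that [f_1 = 2 k sinh (k t)],
    [f_2^2 = A e^(k t)] and [f_3^2 = A e^(- k t)]. *)
Definition critical_f (i : 'I_3) t : R :=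
  if i == 0 then k * (expR (k * t) - expR (- (k * t)))
  else if i == 1 then Num.sqrt ((expR (k * t) ^+ 2 + 1) / 2)
  else Num.sqrt ((1 + expR (- (k * t)) ^+ 2) / 2).

Lemma critical_k_gt0 : 0 < k.
Proof. by rewrite sqrtr_gt0 divr_gt0. Qed.

Lemma critical_k_sqr : k ^+ 2 = 1 / 2.
Proof. by rewrite sqr_sqrtr // divr_ge0. Qed.

Lemma S_soliton_critical c (T : \bar R) f u : c ^+ 2 = 9 / 2 -> S_soliton 1 c T f u ->
  exists (s : 'S_3) (cc : 'I_3 -> R),
  [/\ forall i t, 0 <= t -> f (s i) t = critical_f i t,
      [/\ cc (s 0) = 0, cc (s 1) = 3 * k & cc (s 2) = - (3 * k)] &
      forall i t, 0 < t -> tau f i t = soliton_u cc (f^~ t) * f i t ^+ 2 + cc i].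
Proof.
move=> hc hS; have TE := subcritical_complete hS (_ : c ^+ 2 <= 9 / 2); rewrite {}TE ?hc // in hS *.
have [s [cc [g [[s0 gE] [c0 c1 c2] ode _ sol]]]] := S_closing_solution hS.
have kE : `|c| / 3 = k.
  rewrite /k -[LHS]ger0_norm ?divr_ge0 // -sqrtr_sqr; congr Num.sqrt.
  by rewrite expr_div_n -normrX ger0_norm ?sqr_ge0 // hc; field.
rewrite kE in c1 c2 sol.
have kc : 2 * k ^+ 2 = 1 by rewrite critical_k_sqr; field.
have Dt t : 0 < t -> oitv (0%:E : \bar R) +oo%E t by move=> t0; rewrite /oitv /= lte_fin t0 ltry.
have fE i : f i = g (s^-1%g i) by rewrite gE permKV.
have odef : soliton_ode (fun i => cc (s^-1%g i)) (oitv (0%:E : \bar R) +oo%E) f.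
  have := soliton_ode_perm s^-1%g ode.
  by have -> : (fun i => g (s^-1%g i)) = f by apply/funext => i; rewrite fE.
exists s, (fun i => cc (s^-1%g i)); split; [|by rewrite !permK|]; last first.
  by move=> i t /Dt ht; exact: ode_tau odef ht.
have [_ _ [f00 f10 f20 _] _ _] := hS.
have k0 := critical_k_gt0.
move=> i t; rewrite le_eqVlt => /predU1P[<-|t0].
  rewrite /critical_f mulr0 oppr0 expR0 subrr mulr0 expr1n.
  have -> : (1 + 1) / 2 = 1 :> R by field.
  have fs j : j != 0 -> f (s j) 0 = 1.
    move=> j0; have : s j != 0 by rewrite -[X in _ != X]s0 (inj_eq perm_inj).
    by elim/I3P: (s j).
  by rewrite sqrtr1; elim/I3P: i => /=; rewrite ?s0 ?f00 ?fs.
have ht := Dt t t0; have [gp _] := ode t ht; have [_ _ red _] := sol.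
have [_ _ z0 zy _] := red t ht.
have [hf hA] := critical_relations sol kc ht; have he := critical_exp sol kc ht.
have kV : t / (2 * k) = k * t.
  have -> : (2 * k)^-1 = k; last by rewrite mulrC.
  apply: (mulfI (_ : 2 * k != 0)); first by rewrite mulf_neq0 ?pnatr_eq0 // gt_eqF.
  by rewrite divff ?mulf_neq0 ?pnatr_eq0 ?gt_eqF // -mulrA -expr2 kc.
rewrite kV in he; rewrite kc mul1r in hA.
have he' : red_z g t - red_y g t = expR (- (k * t)).
  rewrite expRN -he; apply: (mulIf (_ : red_z g t + red_y g t != 0)).
    by rewrite he gt_eqF ?expR_gt0.
  rewrite mulVf; last by rewrite he gt_eqF ?expR_gt0.
  by rewrite -subr_sqr zy addrK.
have ee : expR (k * t) * expR (- (k * t)) = 1 by rewrite expRN divff // gt_eqF ?expR_gt0.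
have gs j : g j t = Num.sqrt (g j t ^+ 2) by rewrite sqrtr_sqr ger0_norm // ltW.
have zE : red_z g t = (expR (k * t) + expR (- (k * t))) / 2 by rewrite -he -he'; field.
rewrite -gE /critical_f; elim/I3P: i => /=.
- by rewrite hf -he -he'; ring.
- rewrite gs (red_sq1 (gp 1) (gp 2)) hA he zE; congr Num.sqrt.
  by field: ee.
- rewrite gs (red_sq2 (gp 1) (gp 2)) hA he' zE; congr Num.sqrt.
  by field: ee.
Qed.

Lemma cvg_critical_exp : expR (- (k * t)) @[t --> +oo] --> (0 : R).
Proof.
apply: (@cvg_comp _ _ _ (fun t => k * t) (fun x => expR (- x))); last exact: cvgr_expR.
apply/cvgryPge => A; near=> t; rewrite mulrC -ler_pdivrMr ?critical_k_gt0 //.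
Unshelve. all: by end_near. Qed.

Lemma critical_fE t : let E := expR (- (k * t)) in
  [/\ critical_f 0 t = expR (k * t) * (k * (1 - E ^+ 2)),
      critical_f 1 t = expR (k * t) * Num.sqrt ((1 + E ^+ 2) / 2) &
      critical_f 2 t = Num.sqrt ((1 + E ^+ 2) / 2)].
Proof.
have e0 := expR_gt0 (k * t).
have ee : expR (k * t) * expR (- (k * t)) = 1 by rewrite expRN divff // gt_eqF.
split => //.
- rewrite /critical_f /= -[in RHS](mulr1 (expR (k * t))) .
  have -> : expR (- (k * t)) ^+ 2 = expR (- (k * t)) * expR (- (k * t)) by [].
  by rewrite mulrBr mulrBr mulrA; ring: ee.
- rewrite /critical_f /= -[in RHS](ger0_norm (ltW e0)) -sqrtr_sqr -sqrtrM ?sqr_ge0 //; congr Num.sqrt.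
  by ring: ee.
Qed.

Lemma critical_scalar_curvature (s : 'S_3) (cc : 'I_3 -> R) f t : 0 < t ->
  (forall i t, 0 <= t -> f (s i) t = critical_f i t) ->
  cc (s 0) = 0 -> cc (s 1) = 3 * k -> cc (s 2) = - (3 * k) ->
  (forall i t, 0 < t -> tau f i t = soliton_u cc (f^~ t) * f i t ^+ 2 + cc i) ->
  let w := expR (- (k * t)) ^+ 2 in
  scalar_curvature f t = - 6 * ((1 + w + w ^+ 2) / (1 + w) ^+ 2).
Proof.
move=> t0 fE c0 c1 c2 htau; rewrite /scalar_curvature /norm_tau_sq sum3.
rewrite -(perm_sum3 s (fun i => tau f i t ^+ 2 / f i t ^+ 4)) !htau //.
rewrite -(soliton_u_perm s) /soliton_u c0 c1 c2 !fE ?(ltW t0) //.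
have [-> -> ->] := critical_fE t; set E := expR (- (k * t)).
have ee : expR (k * t) = E^-1 by rewrite /E expRN invrK.
have E0 : 0 < E by exact: expR_gt0.
have E1 : E ^+ 2 < 1 by rewrite expr_lt1 ?(ltW E0) // /E -expR0 ltr_expR oppr_lt0 mulr_gt0 ?critical_k_gt0.
have q0 : 0 <= (1 + E ^+ 2) / 2 by rewrite divr_ge0 // addr_ge0 // ltW // exprn_gt0.
have q1 : 1 + E ^+ 2 != 0 by rewrite gt_eqF // addr_gt0 // exprn_gt0.
have q2 : 1 - E ^+ 2 != 0 by rewrite gt_eqF // subr_gt0.
set Q := Num.sqrt _; have Q2 : Q ^+ 2 = (1 + E ^+ 2) / 2 by rewrite sqr_sqrtr.
have Q4 : Q ^+ 4 = ((1 + E ^+ 2) / 2) ^+ 2 by rewrite -Q2 -exprM.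
have k4 : k ^+ 4 = (1 / 2) ^+ 2 :> R by rewrite -critical_k_sqr -exprM.
rewrite ee !exprMn Q2 Q4 k4 critical_k_sqr.
have kn : k != 0 :> R by rewrite gt_eqF ?critical_k_gt0.
(* With even powers of [k] replaced by their values, [k] survives only through its inverse, and
   finally as [k^-2]; [field] can treat it as free, and [k^2 = 1 / 2] is used once more at the
   end. *)
have -> : 3 * k = 3 * k ^+ 2 / k :> R by field.
rewrite critical_k_sqr.
apply: (@eq_trans _ _ (- 12 * k ^- 2 * (1 / 2) ^+ 1 * ((1 + E ^+ 2 + E ^+ 2 ^+ 2) / (1 + E ^+ 2) ^+ 2) / 2)).
  by field; rewrite kn q1 q2 gt_eqF.
by rewrite critical_k_sqr; field.
Qed.

Lemma critical_growth i : i != 2 -> grows_exponentially (fun t => (critical_f i t)%:E).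
Proof.
have k0 := critical_k_gt0.
move=> i2; exists k, (k / 2), 1; split; [exact: k0|exact: divr_gt0|exact: ltr01|].
have h := @cvgr_dist_lt _ _ _ _ _ _ _ cvg_critical_exp (1 / 2) ltac:(rlra).
near=> t.
have E0 := expR_gt0 (- (k * t)); have e0 := expR_gt0 (k * t).
have E1 : expR (- (k * t)) < 1 / 2.
  by have : `|0 - expR (- (k * t))| < 1 / 2 by [near: t]; rewrite sub0r normrN gtr0_norm.
have [h0 h1 _] := critical_fE t; rewrite !lee_fin ![_ * expR (k * t)]mulrC.
have k1 : k <= 1 by have := critical_k_sqr; rnra.
have w : expR (- (k * t)) ^+ 2 <= 1 / 2 by rnra.
move: i2; elim/I3P: i => // _; rewrite ?h0 ?h1 !ler_pM2l //.
- by have w0 := sqr_ge0 (expR (- (k * t))); apply/andP; split; rnra.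
- have w0 := sqr_ge0 (expR (- (k * t))); apply/andP; split.
    apply: (@le_trans _ _ k); first by rlra.
    by rewrite /critical_k ler_wsqrtr //; rlra.
  by rewrite -[X in _ <= X]sqrtr1 ler_wsqrtr //; rlra.
Unshelve. all: by end_near. Qed.

Lemma cvg_critical_sqrt : Num.sqrt ((1 + expR (- (k * t)) ^+ 2) / 2) @[t --> +oo] --> k.
Proof.
apply: (@cvg_infty_lim _ (Num.sqrt ((1 + 0 * 0) / 2))); last by rewrite mulr0 addr0.
apply: (@cvg_comp _ _ _ (fun t => (1 + expR (- (k * t)) ^+ 2) / 2) (@Num.sqrt R)); last exact: sqrt_continuous.
apply: cvgM; last exact: cvg_cst.
by apply: cvgD; [exact: cvg_cst|apply: cvgM; exact: cvg_critical_exp].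
Qed.

Lemma cvg_critical_ratio : critical_f 0 t / critical_f 1 t @[t --> +oo] --> (1 : R).
Proof.
have k0 := critical_k_gt0; have kn : k != 0 :> R by rewrite gt_eqF.
have -> : (fun t => critical_f 0 t / critical_f 1 t) =
    (fun t => k * (1 - expR (- (k * t)) ^+ 2) / Num.sqrt ((1 + expR (- (k * t)) ^+ 2) / 2)).
  apply/funext => t; have [-> -> _] := critical_fE t.
  by rewrite -mulf_div divff ?mul1r // gt_eqF ?expR_gt0.
apply: (@cvg_infty_lim _ (k * (1 - 0 * 0) / k)); last by rewrite mulr0 subr0 mulr1 divff.
apply: cvgM; last exact: (cvgV kn cvg_critical_sqrt).
apply: cvgM; first exact: cvg_cst.
by apply: cvgB; [exact: cvg_cst|apply: cvgM; exact: cvg_critical_exp].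
Qed.

End Critical.

Section CriticalSoliton.
Context {R : realType}.
Implicit Types (c t a b : R) (f g : 'I_3 -> R -> R) (u : R -> R).

Lemma critical_soliton_curvature c (T : \bar R) f u : c ^+ 2 = 9 / 2 -> S_soliton 1 c T f u ->
  scalar_curvature f t @[t --> +oo] --> (- 6 : R).
Proof.
move=> hc hS; have [s [cc [fE [c0 c1 c2] htau]]] := S_soliton_critical hc hS.
apply: (cvg_infty_ext (F := fun t => - 6 * ((1 + expR (- (critical_k * t)) ^+ 2 + (expR (- (critical_k * t)) ^+ 2) ^+ 2) /
  (1 + expR (- (critical_k * t)) ^+ 2) ^+ 2))).
  by move=> t t0; rewrite (critical_scalar_curvature t0 fE c0 c1 c2 htau).
have hE : expR (- (critical_k * t)) ^+ 2 @[t --> +oo] --> (0 : R).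
  by rewrite -[0](mulr0 (0 : R)); apply: cvgM; exact: cvg_critical_exp.
apply: (@cvg_infty_lim _ _ (- 6 * ((1 + 0 + 0 * 0) / ((1 + 0) * (1 + 0))))); last by field.
apply: cvgM; first exact: cvg_cst.
have h1 : 1 + expR (- (critical_k * t)) ^+ 2 @[t --> +oo] --> (1 + 0 : R) by apply: cvgD => //; exact: cvg_cst.
apply: cvgM; first by apply: cvgD => //; exact: cvgM.
by apply: cvgV; [rewrite addr0 mulr1 oner_neq0|exact: cvgM].
Qed.

Lemma critical_soliton_asymptotics c (T : \bar R) f u : c ^+ 2 = 9 / 2 -> S_soliton 1 c T f u ->
  exists k : 'I_3, (exists2 l : R, 0 < l & f k t @[t --> +oo] --> l) /\
    forall i j : 'I_3, i != k -> j != k -> i != j ->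
      grows_exponentially (fun t => (f i t)%:E) /\ f i t / f j t @[t --> +oo] --> (1 : R).
Proof.
move=> hc hS; have [s [cc [fE _ _]]] := S_soliton_critical hc hS.
exists (s 2); split.
  exists critical_k; first exact: critical_k_gt0.
  apply: cvg_infty_ext cvg_critical_sqrt => t t0.
  by rewrite fE ?(ltW t0) //; have [_ _ ->] := critical_fE t.
move=> i j; rewrite -(permKV s i) -(permKV s j) !(inj_eq perm_inj).
set i' := s^-1%g i; set j' := s^-1%g j => i2 j2 ij; split.
  have [l [K1 [K2 [l0 K10 K20 h]]]] := @critical_growth R _ i2.
  exists l, K1, K2; split => //; near=> t; rewrite fE; first by near: t.
  by near: t; apply: nbhs_pinfty_ge; exact: num_real.
apply: (cvg_infty_ext (F := fun t => critical_f i' t / critical_f j' t)).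
  by move=> t t0; rewrite !fE // ltW.
have ij' : i' != j' by rewrite (inj_eq perm_inj).
move: i2 j2 ij'; clearbody i' j'; elim/I3P: i' => // _; elim/I3P: j' => // _ _; first exact: cvg_critical_ratio.
have -> : (fun t => critical_f 1 t / critical_f 0 t) = (fun t => (critical_f 0 t / critical_f 1 t)^-1 : R).
  by apply/funext => t; rewrite invf_div.
by apply: (@cvg_infty_lim _ _ 1^-1); [apply: cvgV; [exact: oner_neq0|exact: cvg_critical_ratio]|rewrite invr1].
Unshelve. all: by end_near. Qed.

End CriticalSoliton.

(** * Classification of complete solitons *)

Section Classification.
Context {R : realType}.
Implicit Types (c t a b : R) (f g : 'I_3 -> R -> R) (u : R -> R).

(* [(prodf f)^(1/3)] has derivative at least 1/6, so it vanishes in finite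
   backward time. *)
Lemma soliton_left_bounded (c : 'I_3 -> R) (b : \bar R) f : (-oo < b)%E ->
  ~ soliton_ode c (oitv -oo%E b) f.
Proof.
move=> b0 ode.
have [t1 D1] : exists t1, forall t, t <= t1 -> oitv -oo%E b t.
  case: b b0 {ode} => [b||] // _; last by exists 0 => t _; rewrite /oitv /= ltNyr ltry.
  by exists (b - 1) => t tb; rewrite /oitv /= ltNyr lte_fin; rlra.
pose w t := expR (ln (prodf f t) / 3).
have pE t : prodf f t = f 0 t * f 1 t * f 2 t by rewrite /prodf prod3.
have p0 t : t <= t1 -> 0 < prodf f t.
  by move=> /D1 /ode [fp _]; rewrite pE !mulr_gt0.
have dw t : t <= t1 -> is_der w t (sumsq f t / 2 / prodf f t / 3 * w t).
  move=> tt; have h1 := soliton_prodf_der ode (D1 t tt).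
  have h2 : is_der (fun x => ln (prodf f x)) t (sumsq f t / 2 / prodf f t).
    rewrite mulrC; apply: (@der_comp _ (@ln R) (prodf f) t (prodf f t)^-1) => //.
    by apply/is_derP; exact: is_derive1_ln (p0 t tt).
  by apply: der_expR; der_eq; ring.
have w3 t : t <= t1 -> w t ^+ 3 = prodf f t.
  move=> tt; rewrite /w -expRM_natl -[RHS](lnK (p0 t tt)); congr expR.
  by rewrite -mulr_natr; field.
have w0 t : 0 < w t by exact: expR_gt0.
have hS t : t <= t1 -> w t ^+ 2 <= sumsq f t.
  move=> tt; have [fp _] := ode t (D1 t tt); have h := w3 t tt.
  (* Some [f i] is at least the geometric mean [w], whence [w^2 <= sumsq f]; as
     [w' = sumsq f / (6 w^2)], this is the bound [1 / 6]. *)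
  have [i hi] : exists i, w t <= f i t.
    apply/not_existsP => hN; have lt i : f i t < w t by rewrite ltNge; exact/negP/hN.
    suff : prodf f t < w t ^+ 3 by rewrite h ltxx.
    rewrite pE (exprSr _ 2) expr2; apply: ltr_pM; [by rewrite mulr_ge0 // ltW|exact: ltW| |exact: lt].
    by apply: ltr_pM => //; exact: ltW.
  apply: (@le_trans _ _ (f i t ^+ 2)); first by rewrite lerXn2r // nnegrE ltW.
  rewrite /sumsq sum3; have := sqr_ge0 (f 0 t); have := sqr_ge0 (f 1 t); have := sqr_ge0 (f 2 t).
  by elim/I3P: i {hi}; rlra.
pose N := 6 * w t1 + 1.
have N0 : 0 <= N by rewrite /N; have := w0 t1; rlra.
have h : w (t1 - N) - 1 / 6 * (t1 - N) <= w t1 - 1 / 6 * t1.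
  apply: (@ge0_der_le _ (fun x => w x - 1 / 6 * x) (fun x => sumsq f x / 2 / prodf f x / 3 * w x - 1 / 6)).
  - by rlra.
  - by move=> t tt; have h1 := dw t ltac:(rlra); der_eq; ring.
  - move=> t tt; have tt1 : t <= t1 by rlra.
    rewrite -(w3 t tt1) subr_ge0; have wt := w0 t.
    have -> : sumsq f t / 2 / w t ^+ 3 / 3 * w t = 1 / 6 * (sumsq f t / w t ^+ 2).
      by field; exact: lt0r_neq0.
    by rewrite ler_peMr // ler_pdivlMr ?mul1r ?hS // exprn_gt0.
by have := w0 (t1 - N); rewrite /N in h *; rlra.
Qed.

Lemma der_affine (F : R -> R) (a m t d : R) : is_der F (a + m * t) d ->
  is_der (fun t => F (a + m * t)) t (d * m).
Proof. by move=> h; apply: der_comp => //; der_eq; ring. Qed.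

Lemma Cn_scale (D : set R) (F : R -> R) (m : R) n : open D ->
  Cn D n F -> Cn [set t | D (m * t)] n (fun t => F (m * t)).
Proof.
move=> oD; have oE : open [set t | D (m * t)].
  by apply: (@open_comp _ _ (fun t => m * t)) => // t _; exact: mulrl_continuous.
elim: n F => // n IH F [h1 h2]; apply: (@Cn_der _ _ _ _ (fun t => (F^`())%classic (m * t) * m)) => //.
  move=> t /h1 /derivable_der hd.
  have := @der_affine F 0 m t _; rewrite add0r => /(_ _ hd).
  by have -> : (fun t => F (0 + m * t)) = (fun t => F (m * t)) by apply/funext => x; rewrite add0r.
by apply: CnM => //; [exact: IH|exact: Cn_cst].
Qed.

Lemma smooth_on_scale (F : R -> R) (e m l : R) : 0 < m -> smooth_on (- e)%:E e%:E F ->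
  smooth_on (- (e / m))%:E (e / m)%:E (fun t => l * F (m * t)).
Proof.
move=> m0 /smooth_onP h; apply/smooth_onP => n.
have o := @open_oitv R (- (e / m))%:E (e / m)%:E.
apply: CnM => //; first exact: Cn_cst.
have -> : oitv (- (e / m))%:E (e / m)%:E = [set t | oitv (- e)%:E e%:E (m * t)].
  apply/seteqP; split => t; rewrite /oitv /= !lte_fin -mulNr ltr_pdivrMr // ltr_pdivlMr // ![t * _]mulrC //.
by apply: Cn_scale => //; exact: open_oitv.
Qed.

Lemma smoothly_closing_scale (m : R) f u f' u' (d : R) : 0 < m -> 0 < d ->
  (forall t, 0 < t < d -> (forall i, f' i t = f i (m * t) / m) /\ u' t = m * u (m * t)) ->
  smoothly_closing m f u -> smoothly_closing 1 f' u'.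
Proof.
move=> m0 d0 fE [_ [e [F [U [e0 [smF smU] FE odd [F0 F1 F2]]]]]].
split; first exact: ltr01.
have mn : m != 0 by exact: lt0r_neq0.
pose e' := Num.min (e / m) d.
have em0 : 0 < e / m by rewrite divr_gt0.
have e'0 : 0 < e' by rewrite lt_min em0.
have [e'1 e'2] : e' <= e / m /\ e' <= d by rewrite /e' !ge_min !lexx orbT.
have me t : - e' < t < e' -> - e < m * t < e.
  move=> ht; have [h1 h2] : - (e / m) < t /\ t < e / m by split; rlra.
  by move: h1 h2; rewrite -mulNr ltr_pdivrMr // ltr_pdivlMr // ![t * _]mulrC => -> ->.
have sm (G : R -> R) l : smooth_on (- e)%:E e%:E G -> smooth_on (- e')%:E e'%:E (fun t => l * G (m * t)).
  move=> hG n t ht; apply: (@smooth_on_scale G e m l m0 hG); move: ht; rewrite !lte_fin => ht.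
  by apply/andP; split; rlra.
exists e', (fun i t => m^-1 * F i (m * t)), (fun t => m * U (m * t)); split => //.
- by split => [i|]; [exact: sm (smF i)|exact: sm smU].
- move=> t ht; have [h1 h2] := fE t ltac:(rlra).
  have /andP[_ me1] := me t ltac:(rlra); have mt0 : 0 < m * t by rewrite mulr_gt0 //; rlra.
  have [h3 h4] := FE (m * t) ltac:(rlra).
  by split => [i|]; rewrite ?h1 ?h2 ?h3 ?h4 // mulrC.
- move=> t ht; have [h1 h2 h3] := odd (m * t) (me t ht).
  by rewrite mulrN h1 h3 !exprMn h2 !mulrN.
- have D0 : oitv (- e)%:E e%:E 0 by rewrite /oitv /= !lte_fin; rlra.
  split; rewrite ?mulr0 ?F1 ?F2 ?mulVf //.
  have h := smooth_on_derivable (smF 0) D0.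
  have h' : is_der (fun t => F 0 (0 + m * t)) 0 ((F 0)^`()%classic 0 * m).
    by apply: der_affine; rewrite mulr0 addr0.
  have -> : (fun t => m^-1 * F 0 (m * t)) = (fun t => m^-1 * F 0 (0 + m * t)).
    by apply/funext => t; rewrite add0r.
  by apply: der_val; der_eq; rewrite F0; field.
Qed.

Lemma soliton_ode_scale (c : 'I_3 -> R) (a m : R) f : 0 < m ->
  soliton_ode c (oitv a%:E +oo%E) f ->
  soliton_ode (fun i => c i / m) (oitv 0%:E +oo%E) (fun i t => f i (a + m * t) / m).
Proof.
move=> m0 ode t /andP[]; rewrite lte_fin => t0 _.
have mn : m != 0 by exact: lt0r_neq0.
have Dt : oitv (a%:E : \bar R) +oo%E (a + m * t) by rewrite /oitv /= lte_fin ltry ltrDl mulr_gt0.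
have [fp hd] := ode _ Dt; split => i; first exact: divr_gt0.
have h := der_affine (hd i); der_eq; rewrite /soliton_field /soliton_u.
by field; rewrite mn !lt0r_neq0.
Qed.

(** Smooth closing alone makes [tau f 0] tend to 0, so [c 0 = 0], and the parameter of the family
    can only be [c 1]. The maximality clause is void because the end is [+oo]. *)
Lemma S_soliton_of_ode (c : 'I_3 -> R) f u : c 0 + c 1 + c 2 = 0 ->
  soliton_ode c (oitv 0%:E +oo%E) f -> (forall t, 0 < t -> u t = soliton_u c (f^~ t)) ->
  [/\ f 0 0 = 0, f 1 0 = 1, f 2 0 = 1 & u 0 = 0] -> smoothly_closing 1 f u ->
  S_soliton 1 (c 1) +oo%E f u.
Proof.
move=> csum ode hu h0 hcl.
have Dt t : 0 < t -> oitv (0%:E : \bar R) +oo%E t by move=> t0; rewrite /oitv /= lte_fin t0 ltry.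
have hst : steady_soliton 0%:E +oo%E f u.
  by apply: (ode_steady_soliton csum ode) => t /andP[]; rewrite lte_fin => /hu.
have tE i t : 0 < t -> tau f i t = u t * f i t ^+ 2 + c i.
  by move=> t0; rewrite (ode_tau i ode (Dt t t0)) hu.
have [_ [e0 [F [U [e00 [smF smU] FE odd [_ F1 _]]]]]] := hcl.
have D0 : oitv (- e0)%:E e0%:E 0 by rewrite /oitv /= !lte_fin; rlra.
have U0 : U 0 = 0 by have [|_ _] := odd 0; [rlra|rewrite oppr0; rlra].
have cu : u t @[t --> 0^'+] --> (0 : R).
  apply: (cvg_right_ext e00 (F := U)); first by move=> t /FE [].
  by apply: (cvg_right_lim (cvg_right_cont (der_cont (smooth_on_derivable smU D0)))).
have cf1 : f 1 t @[t --> 0^'+] --> (1 : R).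
  apply: (cvg_right_ext e00 (F := F 1)); first by move=> t /FE [].
  by apply: (cvg_right_lim (cvg_right_cont (der_cont (smooth_on_derivable (smF 1) D0)))).
have ct i (l : R) : f i t @[t --> 0^'+] --> l -> tau f i t @[t --> 0^'+] --> c i.
  move=> cf; apply: (cvg_right_ext ltr01 (F := fun t => u t * f i t ^+ 2 + c i)).
    by move=> t /andP[t0 _]; rewrite tE.
  apply: (@cvg_right_lim _ _ (0 * (l * l) + c i)); last by rewrite mul0r add0r.
  by apply: cvgD; [apply: cvgM => //; exact: cvgM|exact: cvg_cst].
have hpos : exists2 e, 0 < e & forall t, 0 < t < e -> forall i, 0 < f i t.
  by exists 1 => // t /andP[/Dt /ode []].
have [[cf0 _ cf2 _] _ ct0] := smoothly_closing_limits hcl hpos (ct 1 1 cf1).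
have c0 : c 0 = 0 by apply: cvg_right_uniq (ct 0 0 cf0) ct0.
split => //; last by case.
split => //; [exact: ct cf1|].
by apply: (cvg_right_lim (ct 2 1 cf2)); rlra.
Qed.

Lemma complete_soliton_classification (a b : \bar R) f u : complete_soliton a b f u ->
  b = +oo%E /\ exists (c m t0 : R) (s : 'S_3) (f' : 'I_3 -> R -> R) (u' : R -> R),
    [/\ c ^+ 2 <= 9 / 2, S_soliton 1 c +oo%E f' u', 0 < m, a = t0%:E &
      forall t, t0 < t -> (forall i, f (s i) t = m * f' i ((t - t0) / m)) /\
        u t = m^-1 * u' ((t - t0) / m)].
Proof.
move=> [ab hst hl hr]; have [c [csum ode hu _]] := steady_soliton_ode ab hst.
have bE : b = +oo%E.
  case: hr => [|[a0 [s [b0 [bE hcl]]]]]; first by case: b {ab hst ode hu}.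
  case: b bE ab hst {ode hu} => [b||] // [bE] ab hst.
  by rewrite -bE in hcl; case: (no_right_closing ab hst hcl).
split => //; rewrite {}bE in ab hst ode hu {hr}.
case: hl => [aE|[t0 [s [m [aE hcl]]]]].
  by rewrite aE in ode ab; case: (soliton_left_bounded ab ode).
rewrite {}aE in ab hst ode hu *.
have m0 : 0 < m by case: hcl.
have mn : m != 0 by exact: lt0r_neq0.
(* [S_soliton] prescribes values at [t = 0], whereas [f] and [u] are arbitrary at the end [t0] of
   their interval; hence the case distinction. *)
pose f' (i : 'I_3) t : R := if t == 0 then (if i == 0 then 0 else 1) else f (s i) (t0 + m * t) / m.
pose u' t : R := if t == 0 then 0 else m * u (t0 + m * t).
have f'E i t : 0 < t -> f' i t = f (s i) (t0 + m * t) / m by move=> tp; rewrite /f' gt_eqF.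
have u'E t : 0 < t -> u' t = m * u (t0 + m * t) by move=> tp; rewrite /u' gt_eqF.
have odes := soliton_ode_scale m0 (soliton_ode_perm s ode).
have ode' : soliton_ode (fun i => c (s i) / m) (oitv 0%:E +oo%E) f'.
  move=> t Dt; have tp := oitv0_gt0 Dt; have [fp hd] := odes t Dt.
  have e : f'^~ t = (fun i => f (s i) (t0 + m * t) / m) by apply/funext => i; rewrite f'E.
  split => i; rewrite ?f'E //; rewrite e.
  apply: der_near (hd i); apply: filterS (oitv_near Dt) => x Dx.
  by rewrite f'E // (oitv0_gt0 Dx).
have hS : S_soliton 1 (c (s 1) / m) +oo%E f' u'.
  apply: (@S_soliton_of_ode (fun i => c (s i) / m)) => //.
  - by rewrite -!mulrDl (perm_sum3 s c) csum mul0r.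
  - move=> t tp; rewrite u'E //; have Dt : oitv (t0%:E : \bar R) +oo%E (t0 + m * t).
      by rewrite /oitv /= lte_fin ltry ltrDl mulr_gt0.
    have [fp _] := ode _ Dt; rewrite hu // -(soliton_u_perm s) /soliton_u !f'E //.
    by field; rewrite mn !lt0r_neq0.
  - by rewrite /f' /u' !eqxx.
  - apply: (smoothly_closing_scale m0 ltr01 _ hcl) => t /andP[tp _].
    by split => [i|]; rewrite ?f'E ?u'E.
exists (c (s 1) / m), m, t0, s, f', u'; split => //.
(* The rescaled soliton exists for all time, which the dichotomy excludes when [c^2 > 9 / 2]. *)
- rewrite leNgt; apply/negP => hc; have [_ /(_ hc) [_ [ts []]]] := completeness_dichotomy hS.
  by [].
- move=> t tt; have tp : 0 < (t - t0) / m by rewrite divr_gt0 // subr_gt0.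
  have e : t0 + m * ((t - t0) / m) = t by field.
  by split => [i|]; rewrite ?f'E ?u'E // e; [rewrite mulrC divfK|rewrite mulKf].
Qed.

Lemma complete_invariant_soliton_classification rev (a b : \bar R) f u :
  complete_invariant_soliton rev a b f u ->
  exists (c : R) (f' : 'I_3 -> R -> R) (u' : R -> R),
    [/\ c ^+ 2 <= 9 / 2, S_soliton 1 c +oo%E f' u' & equivalent_to rev a b f u f' u'].
Proof.
case: rev => /= /complete_soliton_classification [bE [c [m [t0 [s [f' [u' [hc hS m0 aE hf]]]]]]]];
  exists c, f', u'; split => //.
- exists m, (- t0), s; split => // t; rewrite expr1.
  have [bE' aE'] : b = (- t0)%:E /\ a = -oo%E.
    by split; [case: b aE {bE} => //= x [<-]; rewrite opprK|case: a bE].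
  have e : -1 * (t - - t0) / m = (- t - t0) / m by congr (_ / _); ring.
  rewrite e bE' aE'; split.
    by rewrite ltNyr lte_fin; split => [h|]; [rewrite divr_gt0 //; rlra|rewrite pmulr_lgt0 ?invr_gt0 //; rlra].
  rewrite pmulr_lgt0 ?invr_gt0 // subr_gt0 => tt; have [h1 h2] := hf (- t) tt.
  split => [i|]; first by rewrite -h1 /reverse_f opprK.
  by move: h2; rewrite /reverse_u opprK => h2; rewrite -mulrA -h2; ring.
- exists m, t0, s; split => // t; rewrite expr0 !mul1r bE aE; split.
    by rewrite ltry andbT lte_fin pmulr_lgt0 ?invr_gt0 // subr_gt0.
  by rewrite pmulr_lgt0 ?invr_gt0 // subr_gt0 => /hf.
Qed.

End Classification.

(** * Geodesic balls *)

Section SU2Blocks.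
Context {R : realType}.
Local Notation C := (R[i]%C).
Local Notation Re := complex.Re.
Local Notation Im := complex.Im.
Implicit Types (a b z : C) (x t : R).

Lemma ReM a b : Re (a * b) = Re a * Re b - Im a * Im b.
Proof. by case: a b => [? ?] [? ?]. Qed.

Lemma ImM a b : Im (a * b) = Re a * Im b + Im a * Re b.
Proof. by case: a b => [? ?] [? ?]. Qed.

Lemma ReD a b : Re (a + b) = Re a + Re b.
Proof. by case: a b => [? ?] [? ?]. Qed.

Lemma ImD a b : Im (a + b) = Im a + Im b.
Proof. by case: a b => [? ?] [? ?]. Qed.

Lemma ReN a : Re (- a) = - Re a.
Proof. by case: a. Qed.

Lemma ImN a : Im (- a) = - Im a.
Proof. by case: a. Qed.

Lemma ReJ a : Re (a^*) = Re a.
Proof. by case: a. Qed.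

Lemma ImJ a : Im (a^*) = - Im a.
Proof. by case: a. Qed.

Lemma Re0 : Re (0 : C) = 0. Proof. by []. Qed.
Lemma Im0 : Im (0 : C) = 0. Proof. by []. Qed.
Lemma Re1 : Re (1 : C) = 1. Proof. by []. Qed.
Lemma Im1 : Im (1 : C) = 0. Proof. by []. Qed.

Definition reimE := (ReM, ImM, ReD, ImD, ReN, ImN, ReJ, ImJ, Re0, Im0, Re1, Im1).

Lemma complex_ext a b : Re a = Re b -> Im a = Im b -> a = b.
Proof. by case: a b => [? ?] [? ?] /= -> ->. Qed.

Lemma sum3C (h : 'I_3 -> C) : \sum_(i < 3) h i = h 0 + h 1 + h 2.
Proof.
rewrite !big_ord_recl big_ord0 addr0 addrA.
by congr (_ + h _ + h _); apply/val_inj.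
Qed.

Lemma ord3_01 : 0 + 1 = 1 :> 'I_3. Proof. exact/val_inj. Qed.
Lemma ord3_02 : 0 + 2 = 2 :> 'I_3. Proof. exact/val_inj. Qed.
Lemma ord3_11 : 1 + 1 = 2 :> 'I_3. Proof. exact/val_inj. Qed.
Lemma ord3_12 : 1 + 2 = 0 :> 'I_3. Proof. exact/val_inj. Qed.
Lemma ord3_21 : 2 + 1 = 0 :> 'I_3. Proof. exact/val_inj. Qed.
Lemma ord3_22 : 2 + 2 = 1 :> 'I_3. Proof. exact/val_inj. Qed.

Definition ord3E := (ord3_01, ord3_02, ord3_11, ord3_12, ord3_21, ord3_22).

(* The complex matrix ((a, b), (- conj b, conj a)) in the plane [(i + 1, i + 2)]. *)
Definition block (i : 'I_3) a b : 'M[C]_3 := \matrix_(p, q)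
  if p == i + 1 then (if q == i + 1 then a else if q == i + 2 then b else 0)
  else if p == i + 2 then (if q == i + 1 then - b^* else if q == i + 2 then a^* else 0)
  else 0.

Definition su2 i a b : 'M[C]_3 := delta_mx i i + block i a b.

Lemma blockM i a b a' b' : block i a b *m block i a' b' = block i (a * a' - b * b'^*) (a * b' + b * a'^*).
Proof.
apply/matrixP => p q; rewrite mxE sum3C !mxE.
have e1 : a * a' + b * - b'^* = a * a' - b * b'^* by rewrite mulrN.
have e2 : - b^* * a' + a^* * - b'^* = - (a * b' + b * a'^*)^*.
  by rewrite rmorphD !rmorphM /= conjCK; ring.
have e3 : - b^* * b' + a^* * a'^* = (a * a' - b * b'^*)^*.
  by rewrite rmorphB !rmorphM /= conjCK; ring.
by elim/I3P: i; elim/I3P: p; elim/I3P: q; rewrite !ord3E /= ?mulr0 ?mul0r ?addr0 ?add0r //;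
  first [exact: e1 | exact: e2 | exact: e3 | rewrite addrC; first [exact: erefl | exact: e1 | exact: e2 | exact: e3]].
Qed.

Lemma delta_block i a b : delta_mx i i *m block i a b = 0.
Proof.
apply/matrixP => p q; rewrite mxE sum3C !mxE.
by elim/I3P: i; elim/I3P: p; elim/I3P: q; rewrite !ord3E /=; rewrite ?mulr0 ?mul0r ?addr0 ?add0r.
Qed.

Lemma block_delta i a b : block i a b *m delta_mx i i = 0.
Proof.
apply/matrixP => p q; rewrite mxE sum3C !mxE.
by elim/I3P: i; elim/I3P: p; elim/I3P: q; rewrite !ord3E /=; rewrite ?mulr0 ?mul0r ?addr0 ?add0r.
Qed.

Lemma su2M i a b a' b' : su2 i a b *m su2 i a' b' = su2 i (a * a' - b * b'^*) (a * b' + b * a'^*).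
Proof.
by rewrite /su2 mulmxDl !mulmxDr blockM delta_block block_delta mul_delta_mx addr0 add0r.
Qed.

Lemma su2_1 i : su2 i 1 0 = 1%:M.
Proof.
apply/matrixP => p q; rewrite !mxE.
by elim/I3P: i; elim/I3P: p; elim/I3P: q; rewrite !ord3E /=; rewrite ?conjC0 ?conjC1 ?oppr0 ?addr0 ?add0r.
Qed.

Local Notation "M ^t*" := (map_mx Num.conj (M ^T)).

Lemma su2_adj i a b : (su2 i a b)^t* = su2 i (a^*) (- b).
Proof.
apply/matrixP => p q; rewrite !mxE.
by elim/I3P: i; elim/I3P: p; elim/I3P: q; rewrite !ord3E /= ?mulr1n ?mulr0n; apply: complex_ext; rewrite !reimE; ring.
Qed.

Lemma det3 (A : 'M[C]_3) : \det A =
  A 0 0 * (A 1 1 * A 2 2 - A 1 2 * A 2 1) - A 0 1 * (A 1 0 * A 2 2 - A 1 2 * A 2 0) +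
  A 0 2 * (A 1 0 * A 2 1 - A 1 1 * A 2 0).
Proof.
have det2 (M : 'M[C]_2) : \det M = M 0 0 * M 1 1 - M 0 1 * M 1 0.
  rewrite (expand_det_row _ 0) !big_ord_recl big_ord0 addr0 /cofactor !det_mx11 !mxE /=.
  rewrite expr0 expr1 mul1r mulN1r mulrN.
  by congr (M _ _ * M _ _ - M _ _ * M _ _); apply/val_inj.
rewrite (expand_det_row _ 0) sum3C /cofactor !det2 !mxE /=.
rewrite expr0 expr1 sqrrN expr1n !mul1r mulN1r mulrN.
by congr (_ * (A _ _ * A _ _ - A _ _ * A _ _) - _ * (A _ _ * A _ _ - A _ _ * A _ _) +
  _ * (A _ _ * A _ _ - A _ _ * A _ _)); apply/val_inj.
Qed.

Lemma su2_SU3 i a b : a * a^* + b * b^* = 1 -> SU3 (su2 i a b).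
Proof.
move=> ab; split.
  apply/unitarymxP; rewrite su2_adj su2M -(su2_1 i); congr su2; last by rewrite conjCK; ring.
  by rewrite -ab rmorphN /=; ring.
rewrite det3 !mxE.
by elim/I3P: i; rewrite !ord3E /= -[RHS]ab; ring.
Qed.

Lemma SU3_mul (A B : 'M[C]_3) : SU3 A -> SU3 B -> SU3 (A *m B).
Proof.
by move=> [uA dA] [uB dB]; split; [exact: mul_unitarymx|rewrite det_mulmx dA dB mul1r].
Qed.

Lemma SU3_adj (A : 'M[C]_3) : SU3 A -> SU3 (A ^t*).
Proof.
move=> [uA dA]; split; first by rewrite trmxC_unitary.
by rewrite det_map_mx det_tr dA rmorph1.
Qed.

Lemma SU3_adjK (A : 'M[C]_3) : SU3 A -> A ^t* *m A = 1%:M /\ A *m A ^t* = 1%:M.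
Proof.
move=> [uA _]; have /unitarymxP h := uA; split => //.
by rewrite -(invmx_unitary uA) mulVmx // unitarymx_unit.
Qed.

Definition nsq (a : C) : R := Re a ^+ 2 + Im a ^+ 2.

Lemma nsqE a : a * a^* = (nsq a)%:C%C.
Proof. by apply: complex_ext; rewrite !reimE /nsq /=; ring. Qed.

Lemma nsqM a b : nsq (a * b) = nsq a * nsq b.
Proof. by rewrite /nsq !reimE; ring. Qed.

Lemma su2_SU3_nsq i a b : nsq a + nsq b = 1 -> SU3 (su2 i a b).
Proof. by move=> h; apply: su2_SU3; rewrite !nsqE; apply: complex_ext => /=; rewrite ?addr0. Qed.

(** Translates of the one-parameter subgroups used below have this form, their generator [J] having
    as square minus a projection. The entries are then explicit trigonometric functions. *)
Definition trig_path (M0 M1 M2 : 'M[C]_3) (th s : R) : 'M[C]_3 :=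
  M0 + (cos (th * s))%:C%C *: M1 + (sin (th * s))%:C%C *: M2.

Lemma C1_trig (c0 c1 c2 th : R) : C1 (fun s => c0 + cos (th * s) * c1 + sin (th * s) * c2) /\
  forall s, derive1 (fun s => c0 + cos (th * s) * c1 + sin (th * s) * c2) s =
    th * (cos (th * s) * c2 - sin (th * s) * c1).
Proof.
have dc s : is_der (fun s => cos (th * s)) s (- sin (th * s) * th).
  apply: (@der_comp _ cos (fun s => th * s) s (- sin (th * s)) th); last by der_eq; ring.
  by apply/is_derP; exact: is_derive_cos.
have ds s : is_der (fun s => sin (th * s)) s (cos (th * s) * th).
  apply: (@der_comp _ sin (fun s => th * s) s (cos (th * s)) th); last by der_eq; ring.
  by apply/is_derP; exact: is_derive_sin.
have d s : is_der (fun s => c0 + cos (th * s) * c1 + sin (th * s) * c2) s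
    (th * (cos (th * s) * c2 - sin (th * s) * c1)).
  by have := dc s; have := ds s => h1 h2; der_eq; ring.
split; last by move=> s; exact: der_val.
split; first by move=> s; exact: der_derivable (d s).
have -> : derive1 (fun s => c0 + cos (th * s) * c1 + sin (th * s) * c2) =
    (fun s => th * (cos (th * s) * c2 - sin (th * s) * c1)).
  by apply/funext => s; exact: der_val.
move=> s; apply: (@der_cont _ _ _ (th * ((- sin (th * s) * th) * c2 - (cos (th * s) * th) * c1))).
by have := dc s; have := ds s => h1 h2; der_eq; ring.
Qed.

Lemma trig_path_ReIm M0 M1 M2 th i j :
  (fun s => Re (trig_path M0 M1 M2 th s i j)) =
    (fun s => Re (M0 i j) + cos (th * s) * Re (M1 i j) + sin (th * s) * Re (M2 i j)) /\
  (fun s => Im (trig_path M0 M1 M2 th s i j)) =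
    (fun s => Im (M0 i j) + cos (th * s) * Im (M1 i j) + sin (th * s) * Im (M2 i j)).
Proof.
by split; apply/funext => s; rewrite /trig_path !mxE !reimE /= !mul0r ?subr0 ?addr0.
Qed.

Lemma trig_path_C1 M0 M1 M2 th : C1_mx (trig_path M0 M1 M2 th).
Proof.
move=> i j; have [-> ->] := trig_path_ReIm M0 M1 M2 th i j.
by split; exact: (C1_trig _ _ _ th).1.
Qed.

Lemma trig_path_derive M0 M1 M2 th s : derive1_mx (trig_path M0 M1 M2 th) s =
  th%:C%C *: ((cos (th * s))%:C%C *: M2 - (sin (th * s))%:C%C *: M1).
Proof.
apply/matrixP => i j; rewrite !mxE; have [-> ->] := trig_path_ReIm M0 M1 M2 th i j.
have [_ ->] := C1_trig (Re (M0 i j)) (Re (M1 i j)) (Re (M2 i j)) th.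
have [_ ->] := C1_trig (Im (M0 i j)) (Im (M1 i j)) (Im (M2 i j)) th.
by apply: complex_ext; rewrite !reimE /=; ring.
Qed.

Lemma su2_path (B : 'M[C]_3) i (x th s : R) z :
  B *m su2 i (cos (th * s) +i* (x * sin (th * s)))%C ((sin (th * s))%:C%C * z) =
  trig_path (B *m delta_mx i i) (B *m block i 1 0) (B *m block i (x *i)%C z) th s.
Proof.
rewrite /trig_path !scalemxAr -!mulmxDr; congr (_ *m _).
rewrite /su2 -addrA; congr (_ + _); apply/matrixP => p q; rewrite !mxE.
have [Ja Jb] : 0^* = 0 :> C /\ 1^* = 1 :> C by rewrite rmorph0 rmorph1.
by case: (p == i + 1); case: (p == i + 2); case: (q == i + 1); case: (q == i + 2);
  rewrite ?Ja ?Jb ?mulr0 ?add0r //; apply: complex_ext; rewrite !reimE /=; ring.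
Qed.

Lemma C1_cst (c : R) : C1 (fun=> c).
Proof.
split; first by move=> s; exact: der_derivable (der_cst c s).
have -> : derive1 (fun=> c) = (fun=> 0 : R) by apply/funext => s; exact: der_val (der_cst c s).
by move=> s; exact: cvg_cst.
Qed.

Lemma curve_length_cst f (t : R -> R) A (l : R) : (forall s, 0 <= s <= 1 -> speed f t A s = l) ->
  curve_length f t A = l.
Proof.
move=> h; rewrite /curve_length (@eq_Rintegral _ _ _ _ _ (cst l)); last first.
  by move=> s; rewrite inE /= in_itv /= => /h.
rewrite Rintegral_cst //.
have := @lebesgue_measure_itv R `[0, 1]; rewrite /= lte_fin ltr01 /= oppr0 adde0 => ->.
by rewrite mulr1.
Qed.

(** The curve is [B exp (s th J)], where [J] is the block with entries [i x] and [z] and has square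
    [- block i 1 0]. Its left-invariant velocity is the constant [th J]. Only the entry [z] is
    measured by the metric, with the factor 4 of [speed]; the torus part [x] costs nothing. *)
Lemma su2_curve f t (B : 'M[C]_3) i x z th : 0 <= t -> SU3 B -> x ^+ 2 + nsq z = 1 ->
  0 <= f i t -> 0 <= th ->
  joined f (t, B) (t, B *m su2 i (cos th +i* (x * sin th))%C ((sin th)%:C%C * z))
    (2 * th * f i t * Num.sqrt (nsq z)).
Proof.
move=> t0 hB xz fi0 th0.
pose A := trig_path (B *m delta_mx i i) (B *m block i 1 0) (B *m block i (x *i)%C z) th.
have AE s : A s = B *m su2 i (cos (th * s) +i* (x * sin (th * s)))%C ((sin (th * s))%:C%C * z).
  by rewrite su2_path.
have hA s : SU3 (A s).
  rewrite AE; apply: SU3_mul => //; apply: su2_SU3_nsq.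
  rewrite nsqM /nsq /= -/(nsq z) -(cos2Dsin2 (th * s)) exprMn.
  have -> : nsq z = 1 - x ^+ 2 by rewrite -xz addrAC subrr add0r.
  by ring.
have wE s : invmx (A s) *m derive1_mx A s = th%:C%C *: block i (x *i)%C z.
  rewrite trig_path_derive -scalemxAr; congr (_ *: _).
  have -> : (cos (th * s))%:C%C *: (B *m block i (x *i)%C z) - (sin (th * s))%:C%C *: (B *m block i 1 0) =
      A s *m block i (x *i)%C z.
    have PJ : block i 1 0 *m block i (x *i)%C z = block i (x *i)%C z.
      by rewrite blockM !mul1r !mul0r subr0 addr0.
    have JJ : block i (x *i)%C z *m block i (x *i)%C z = - block i 1 0.
      rewrite blockM; have -> : (x *i)%C * (x *i)%C - z * z^* = -1 :> C.
        by rewrite nsqE; apply: complex_ext; rewrite !reimE /= -?xz; ring.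
      have -> : (x *i)%C * z + z * ((x *i)%C)^* = 0 :> C by apply: complex_ext; rewrite !reimE /=; ring.
      clear; apply/matrixP => p q; rewrite !mxE.
      by elim/I3P: i; elim/I3P: p; elim/I3P: q; rewrite !ord3E /=;
        rewrite ?rmorphN ?rmorph1 ?rmorph0 ?oppr0.
    rewrite /A /trig_path !mulmxDl -!scalemxAl -!mulmxA delta_block PJ JJ mulmx0 add0r.
    by rewrite mulmxN scalerN.
  by rewrite mulKmx // unitarymx_unit //; case: (hA s).
have hl : curve_length f (fun=> t) A = 2 * th * f i t * Num.sqrt (nsq z).
  apply: curve_length_cst => s _; rewrite /speed wE derive1_cst expr0n add0r.
  have p0 : 0 <= 2 * th * f i t * Num.sqrt (nsq z) by rewrite !mulr_ge0 // sqrtr_ge0.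
  rewrite -[RHS](ger0_norm p0) -sqrtr_sqr; congr Num.sqrt.
  have n0 : 0 <= nsq z by rewrite /nsq addr_ge0 ?sqr_ge0.
  rewrite [RHS]exprMn sqr_sqrtr // sum3 !mxE /nsq.
  by elim/I3P: i {fi0 A AE hA wE p0}; rewrite !ord3E /= !reimE /=; ring.
have := @joined_C1 R f (fun=> t) A (C1_cst t) (trig_path_C1 _ _ _ _) (fun s _ => conj t0 (hA s)).
rewrite hl !AE mulr0 mulr1 cos0 sin0 mulr0 mul0r.
by have -> : (1 +i* 0)%C = 1 :> C by []; rewrite su2_1 mulmx1.
Qed.

End SU2Blocks.

(** * Curves joining the points of a level *)

Section Decomposition.
Context {R : realType}.
Local Notation C := (R[i]%C).
Local Notation Re := complex.Re.
Local Notation Im := complex.Im.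
Local Notation "M ^t*" := (map_mx Num.conj (M ^T)).
Implicit Types (a b z : C) (x t : R) (U B : 'M[C]_3) (f : 'I_3 -> R -> R).

Definition cabs a : R := Num.sqrt (nsq a).

Lemma nsq_ge0 a : 0 <= nsq a.
Proof. by rewrite addr_ge0 ?sqr_ge0. Qed.

Lemma cabs_ge0 a : 0 <= cabs a.
Proof. exact: sqrtr_ge0. Qed.

Lemma cabsM a b : cabs (a * b) = cabs a * cabs b.
Proof. by rewrite /cabs nsqM sqrtrM ?nsq_ge0. Qed.

Lemma cabsN a : cabs (- a) = cabs a.
Proof. by rewrite /cabs /nsq !reimE !sqrrN. Qed.

Lemma cabsJ a : cabs (a^*) = cabs a.
Proof. by rewrite /cabs /nsq !reimE !sqrrN. Qed.

Lemma cabs_real x : cabs x%:C%C = `|x|.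
Proof. by rewrite /cabs /nsq /= expr0n addr0 sqrtr_sqr. Qed.

Lemma cabsE a : cabs a = Normc.normc a.
Proof. by case: a. Qed.

Lemma cabsD a b : cabs (a + b) <= cabs a + cabs b.
Proof. by rewrite !cabsE; exact: le_normcD. Qed.

Lemma Re_le_cabs a : `|Re a| <= cabs a.
Proof. by rewrite -sqrtr_sqr ler_wsqrtr // lerDl sqr_ge0. Qed.

Lemma Im_le_cabs a : `|Im a| <= cabs a.
Proof. by rewrite -sqrtr_sqr ler_wsqrtr // lerDr sqr_ge0. Qed.

Lemma cabs_le_ReIm a : cabs a <= `|Re a| + `|Im a|.
Proof.
rewrite -[leRHS]ger0_norm ?addr_ge0 // -sqrtr_sqr ler_wsqrtr //.
rewrite /nsq -(real_normK (num_real (Re a))) -(real_normK (num_real (Im a))).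
by have := mulr_ge0 (normr_ge0 (Re a)) (normr_ge0 (Im a)); rlra.
Qed.

Lemma nsq_eq0 a : nsq a = 0 -> a = 0.
Proof.
move=> h; have := sqr_ge0 (Re a); have := sqr_ge0 (Im a) => h1 h2.
have /eqP : Re a ^+ 2 = 0 by rewrite /nsq in h; rlra.
have /eqP : Im a ^+ 2 = 0 by rewrite /nsq in h; rlra.
by rewrite !sqrf_eq0 => /eqP i0 /eqP r0; exact: complex_ext.
Qed.

Lemma angle_le_sin (th : R) : 0 <= th <= pi -> th * cos th <= sin th.
Proof.
move=> /andP[th0 thpi]; rewrite -subr_ge0.
have h : sin 0 - 0 * cos 0 <= sin th - th * cos th.
  apply: (@ge0_der_le _ (fun x => sin x - x * cos x) (fun x => x * sin x)) => // x hx.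
    have dc : is_der cos x (- sin x) by apply/is_derP; exact: is_derive_cos.
    have ds : is_der sin x (cos x) by apply/is_derP; exact: is_derive_sin.
    by der_eq; ring.
  by rewrite mulr_ge0 ?sin_ge0_pi ?in_itv /=; rlra.
by move: h; rewrite sin0 mul0r subr0.
Qed.

(** With [cos th = Re a], the right factor is the exponential of some [th J], reached by a curve of
    length [2 th f_i |b| / sin th]. This is at most [2 pi f_i] as [|b| <= sin th]. If
    [Re a >= 1 / 2], then [th cos th <= sin th] gives [th <= 2 sin th] and the bound linear in
    [|b|]. *)
Lemma su2_step f t B i a b : 0 <= t -> SU3 B -> nsq a + nsq b = 1 -> 0 <= f i t ->
  exists l, [/\ joined f (t, B) (t, B *m su2 i a b) l, l <= 2 * pi * f i t &
    1 / 2 <= Re a -> l <= 4 * f i t * cabs b].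
Proof.
move=> t0 hB ab f0.
have nb := nsq_ge0 b; have Im2 := sqr_ge0 (Im a); have Re2 := sqr_ge0 (Re a).
have abE : Re a ^+ 2 + Im a ^+ 2 + nsq b = 1 by [].
have Re1 : -1 <= Re a <= 1 by apply/andP; split; rnra.
pose th := acos (Re a).
have c : cos th = Re a by rewrite acosK // in_itv /=.
have s : sin th = Num.sqrt (1 - Re a ^+ 2) by exact: sin_acos.
have th0 : 0 <= th by exact: acos_ge0.
have thpi : th <= pi by exact: acos_lepi.
have s0 : 0 <= sin th by rewrite s sqrtr_ge0.
have s2 : sin th ^+ 2 = 1 - Re a ^+ 2 by rewrite s sqr_sqrtr //; rlra.
have pif : 0 <= 2 * pi * f i t by rewrite mulr_ge0 // mulr_ge0 // pi_ge0.
(* If [sin th = 0] then [b = 0] and [a] is 1 or -1; both are reached inside the torus, at no cost,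
   with [x = 1] and [z = 0]. *)
move: s0; rewrite le_eqVlt => /predU1P[s0|s0].
  have := su2_curve (z := 0) (x := 1) t0 hB _ f0 th0.
  have n00 : nsq (0 : C) = 0 by rewrite /nsq /= expr0n addr0.
  rewrite n00 expr1n addr0 sqrtr0 mulr0 -s0 mulr0 mulr0 => /(_ erefl) h.
  exists 0; split => //; last by rewrite mulr_ge0 ?cabs_ge0 // mulr_ge0.
  have sz : Re a ^+ 2 = 1 by rewrite -s0 expr0n /= in s2; rlra.
  have /nsq_eq0 b0 : nsq b = 0 by rlra.
  have /eqP : Im a ^+ 2 = 0 by rlra.
  rewrite sqrf_eq0 => /eqP Im0.
  have aE : a = (cos th +i* 0)%C by apply: complex_ext => //=; rewrite c.
  by rewrite aE b0.
have sn : sin th != 0 by rewrite gt_eqF.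
pose z : C := ((sin th)^-1)%:C%C * b; pose x := Im a / sin th.
have nz : nsq z = nsq b / sin th ^+ 2 by rewrite /z nsqM /nsq /=; field.
have xz : x ^+ 2 + nsq z = 1.
  rewrite nz /x; have -> : (Im a / sin th) ^+ 2 + nsq b / sin th ^+ 2 = (Im a ^+ 2 + nsq b) / sin th ^+ 2 by field.
  by have -> : Im a ^+ 2 + nsq b = sin th ^+ 2; [rlra|rewrite divff // expf_neq0].
have := su2_curve t0 hB xz f0 th0.
have -> : (cos th +i* (x * sin th))%C = a by apply: complex_ext; rewrite //= /x divfK.
have -> : (sin th)%:C%C * z = b.
  by rewrite /z mulrA; apply: complex_ext; rewrite !reimE /=; field.
move=> h; exists (2 * th * f i t * Num.sqrt (nsq z)); split => //.
  have z1 : Num.sqrt (nsq z) <= 1.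
    by rewrite -[leRHS]sqrtr1 ler_wsqrtr //; have := sqr_ge0 x; rlra.
  have e0 : 0 <= 2 * th * f i t by rewrite !mulr_ge0.
  apply: (@le_trans _ _ (2 * th * f i t)); first by rewrite ler_piMr.
  by rewrite ler_wpM2r // ler_wpM2l.
move=> Re2'; have h1 := angle_le_sin (_ : 0 <= th <= pi); rewrite th0 thpi c in h1.
have th2 : th <= 2 * sin th by have := h1 isT; rnra.
have zE : Num.sqrt (nsq z) = cabs b / sin th.
  by rewrite nz sqrtrM ?nsq_ge0 // sqrtrV ?exprn_ge0 ?(ltW s0) // sqrtr_sqr ger0_norm // ltW.
rewrite zE; have -> : 4 * f i t * cabs b = 2 * (2 * sin th) * f i t * (cabs b / sin th) by field.
have p : 0 <= cabs b / sin th by rewrite divr_ge0 ?cabs_ge0 // ltW.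
by rewrite ler_wpM2r // ler_wpM2r // ler_wpM2l.
Qed.

Lemma SU3_row U i : SU3 U -> nsq (U i 0) + nsq (U i 1) + nsq (U i 2) = 1.
Proof.
move=> /SU3_adjK [_ /matrixP/(_ i i)]; rewrite !mxE sum3C !mxE eqxx !nsqE => /(congr1 (@complex.Re R)).
by rewrite !reimE.
Qed.

Lemma SU3_col U i : SU3 U -> nsq (U 0 i) + nsq (U 1 i) + nsq (U 2 i) = 1.
Proof. by move=> /SU3_adj/(SU3_row i); rewrite !mxE /nsq !reimE !sqrrN. Qed.

Lemma SU3_entry U i j : SU3 U -> cabs (U i j) <= 1.
Proof.
move=> /(SU3_row i) h; rewrite /cabs -[leRHS]sqrtr1 ler_wsqrtr //.
have := nsq_ge0 (U i 0); have := nsq_ge0 (U i 1); have := nsq_ge0 (U i 2).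
by elim/I3P: j; rlra.
Qed.

(** Unit norm of the last column makes it [(0, 0, 1)]. The second row is then determined by
    orthogonality to the first one together with the determinant. *)
Lemma SU3_last_row U : SU3 U -> U 2 0 = 0 -> U 2 1 = 0 -> U 2 2 = 1 ->
  U = su2 2 (U 0 0) (U 0 1) /\ nsq (U 0 0) + nsq (U 0 1) = 1.
Proof.
move=> hU u20 u21 u22.
have n1 : nsq (1 : C) = 1 by rewrite /nsq /= expr1n expr0n addr0.
have [u02 u12] : U 0 2 = 0 /\ U 1 2 = 0.
  have := SU3_col 2 hU; rewrite u22 n1; have := nsq_ge0 (U 0 2); have := nsq_ge0 (U 1 2).
  by move=> h1 h2 h3; split; apply: nsq_eq0; rlra.
have n0 : nsq (0 : C) = 0 by rewrite /nsq /= expr0n addr0.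
have ab : nsq (U 0 0) + nsq (U 0 1) = 1 by have := SU3_row 0 hU; rewrite u02 n0 addr0.
have ab' : U 0 0 * (U 0 0)^* + U 0 1 * (U 0 1)^* = 1.
  by rewrite !nsqE; apply: complex_ext; rewrite !reimE /= ?addr0.
have [_ dU] := hU; rewrite det3 u20 u21 u22 u02 u12 in dU.
have [_ /matrixP/(_ 1 0)] := SU3_adjK hU; rewrite !mxE sum3C !mxE u12 mul0r addr0 /= => orth.
have u11 : U 1 1 = (U 0 0)^*.
  rewrite -[LHS]mulr1 -ab' -[RHS]mulr1 -dU.
  have : U 0 1 * (U 1 0 * (U 0 0)^* + U 1 1 * (U 0 1)^*) = 0 by rewrite orth mulr0.
  by move=> h; apply/eqP; rewrite -subr_eq0; apply/eqP; rewrite -[RHS]h; ring.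
have u10 : U 1 0 = - (U 0 1)^*.
  rewrite -[LHS]mulr1 -ab' -[RHS]mulr1 -dU.
  have : U 0 0 * (U 1 0 * (U 0 0)^* + U 1 1 * (U 0 1)^*) = 0 by rewrite orth mulr0.
  by move=> h; apply/eqP; rewrite -subr_eq0; apply/eqP; rewrite -[RHS]h; ring.
split => //; apply/matrixP => p q; rewrite !mxE.
by elim/I3P: p; elim/I3P: q; rewrite !ord3E /= ?mulr1n ?mulr0n ?add0r ?addr0.
Qed.

(* Three rotations bring [U] to the identity: the first two turn its last row
   into [(0, 0, 1)], which leaves a block in the plane of the first two indices. *)
Lemma connect_SU3 f t B U : 0 <= t -> SU3 B -> SU3 U -> (forall i, 0 <= f i t) ->
  exists l, [/\ joined f (t, B *m U) (t, B) l,
    l <= 2 * pi * (f 0 t + f 1 t + f 2 t) &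
    forall e, e <= 1 / 8 -> (forall p q, cabs (U p q - (p == q)%:R) <= e) ->
      l <= 8 * e * (f 0 t + f 1 t + f 2 t)].
Proof.
move=> t0 hB hU f0.
set v0 := U 2 0; set v1 := U 2 1; set v2 := U 2 2.
pose rho := Num.sqrt (nsq v0 + nsq v2).
have rho0 : 0 <= rho by exact: sqrtr_ge0.
have nv := SU3_row 2 hU; rewrite -/v0 -/v1 -/v2 in nv.
have rho2 : rho ^+ 2 = nsq v0 + nsq v2 by rewrite sqr_sqrtr // addr_ge0 ?nsq_ge0.
have rho1 : rho ^+ 2 + nsq v1 = 1 by rlra.
have rho_le1 : rho <= 1 by have := nsq_ge0 v1; rnra.
(* The first rotation combines columns 2 and 0: it annihilates [v0] and turns [v2] into [rho >= 0].
   For [rho = 0] both entries vanish already and the identity serves. *)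
have [a1 [b1 [ab1 z1 r1 ha1]]] : exists a1 b1 : C, [/\ nsq a1 + nsq b1 = 1,
    v0 * a1^* + v2 * b1 = 0, v2 * a1 - v0 * b1^* = rho%:C%C &
    0 < rho -> a1 = (rho^-1)%:C%C * v2^* /\ cabs b1 = cabs v0 / rho].
  move: rho0; rewrite le_eqVlt => /predU1P[r0|r0].
    have [/nsq_eq0 -> /nsq_eq0 ->] : nsq v0 = 0 /\ nsq v2 = 0.
      have := nsq_ge0 v0; have := nsq_ge0 v2; move: rho2; rewrite -r0 expr0n /=.
      by move=> h1 h2 h3; split; rlra.
    exists 1, 0; rewrite -r0 ltxx; split => //.
    - by rewrite /nsq /= expr1n expr0n !addr0.
    - by rewrite !mul0r addr0.
    - by rewrite !mul0r subr0.
  have rn : rho != 0 by rewrite gt_eqF.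
  have rE (w : R) : w = rho * (rho^-1 * w) by rewrite mulVKf.
  exists ((rho^-1)%:C%C * v2^*), (- ((rho^-1)%:C%C * v0)); split.
  - have n (w : C) : nsq ((rho^-1)%:C%C * w) = nsq w / rho ^+ 2 by rewrite nsqM /nsq /=; field.
    have nN (w : C) : nsq (- w) = nsq w by rewrite /nsq !reimE !sqrrN.
    have nJ (w : C) : nsq (w^*) = nsq w by rewrite /nsq !reimE sqrrN.
    by rewrite nN !n nJ -mulrDl addrC -rho2 divff // expf_neq0.
  - by apply: complex_ext; rewrite !reimE /=; ring.
  - have : rho = rho^-1 * (nsq v0 + nsq v2) by rewrite -rho2 expr2 mulKf.
    move=> h; apply: complex_ext; rewrite !reimE /=; last by ring.
    by rewrite [RHS]h /nsq; ring.
  - by move=> _; split => //; rewrite cabsN cabsM cabs_real gtr0_norm ?invr_gt0 // mulrC.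
pose U1 := U *m su2 1 a1 b1.
have hU1 : SU3 U1 by apply: SU3_mul => //; exact: su2_SU3_nsq.
have U1E p : [/\ U1 p 0 = U p 0 * a1^* + U p 2 * b1, U1 p 1 = U p 1 &
    U1 p 2 = U p 2 * a1 - U p 0 * b1^*].
  by split; rewrite mxE sum3C !mxE !ord3E /= ?mulr1n ?mulr0n; ring.
have [u20 u21 u22] := U1E 2; rewrite -/v0 -/v1 -/v2 z1 r1 in u20 u21 u22.
have ab2 : nsq (rho%:C%C) + nsq (v1^*) = 1.
  by rewrite -rho1 /nsq !reimE /=; ring.
pose U2 := U1 *m su2 0 (rho%:C%C) (v1^*).
have hU2 : SU3 U2 by apply: SU3_mul => //; exact: su2_SU3_nsq.
have U2E p : [/\ U2 p 0 = U1 p 0, U2 p 1 = U1 p 1 * rho%:C%C - U1 p 2 * v1 &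
    U2 p 2 = U1 p 1 * v1^* + U1 p 2 * rho%:C%C].
  split; rewrite mxE sum3C !mxE !ord3E /= ?mulr1n ?mulr0n ?conjCK; try by ring.
  by apply: complex_ext; rewrite !reimE /=; ring.
have [w20 w21 w22] := U2E 2; rewrite u20 u21 u22 in w20 w21 w22.
have [U2b ab3] : U2 = su2 2 (U2 0 0) (U2 0 1) /\ nsq (U2 0 0) + nsq (U2 0 1) = 1.
  apply: SU3_last_row => //; first by rewrite w21; ring.
  by rewrite w22 nsqE; apply: complex_ext; rewrite !reimE /= -?rho1; ring.
set a3 := U2 0 0 in U2b ab3; set b3 := U2 0 1 in U2b ab3.
have U3 : U2 *m su2 2 (a3^*) (- b3) = 1%:M.
  rewrite U2b su2M -(su2_1 2); congr su2; last by rewrite conjCK; ring.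
  by rewrite rmorphN mulrN opprK !nsqE; apply: complex_ext; rewrite !reimE /= ?addr0.
have ab3' : nsq (a3^*) + nsq (- b3) = 1 by rewrite -ab3 /nsq !reimE; ring.
have [l1 [j1 c1 s1]] := su2_step t0 (SU3_mul hB hU) ab1 (f0 1).
have [l2 [j2 c2 s2]] := su2_step t0 (SU3_mul hB hU1) ab2 (f0 0).
have [l3 [j3 c3 s3]] := su2_step t0 (SU3_mul hB hU2) ab3' (f0 2).
rewrite -mulmxA -/U1 in j1; rewrite -mulmxA -/U2 in j2; rewrite -mulmxA U3 mulmx1 in j3.
exists (l1 + l2 + l3); split.
- exact: joined_cat (joined_cat j1 j2) j3.
- by rlra.
(* Near the identity each of the three rotations has an off-diagonal entry at most [2 e] and a
   diagonal one of real part at least [1 / 2], so by [su2_step] its length is at most [4 f_i] times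
   [2 e]. *)
move=> e e8 he; have e0 : 0 <= e by apply: le_trans (he 0 0); exact: cabs_ge0.
have hoff p q : p != q -> cabs (U p q) <= e.
  by move=> pq; have := he p q; rewrite (negPf pq) subr0.
have hRe p : 1 - e <= Re (U p p).
  have := le_trans (Re_le_cabs _) (he p p); rewrite eqxx !reimE ler_norml; rlra.
have hIm p : `|Im (U p p)| <= e.
  by have := le_trans (Im_le_cabs _) (he p p); rewrite eqxx !reimE oppr0 addr0.
have v2e := hRe 2; rewrite -/v2 in v2e.
have rho_ge : 1 - e <= rho.
  have h : 1 - e <= Num.sqrt (Re v2 ^+ 2).
    by rewrite sqrtr_sqr; apply: le_trans v2e _; exact: ler_norm.
  apply: le_trans h _; rewrite ler_wsqrtr // /nsq.
  by have := nsq_ge0 v0; have := sqr_ge0 (Im v2); rewrite /nsq; rlra.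
have rp : 0 < rho by rlra.
have [a1E b1E] := ha1 rp.
have b1e : cabs b1 <= 2 * e.
  rewrite b1E ler_pdivrMr //; apply: le_trans (hoff 2 0 isT) _; rnra.
have rV : 1 <= rho^-1 by rewrite invf_ge1.
have Rea1 : 1 - e <= Re a1.
  by rewrite a1E !reimE /= mul0r subr0; rnra.
have cU2 : cabs v1 <= e by exact: hoff.
have Ima1 : `|Im a1| <= 1.
  have h : Im a1 ^+ 2 <= 1 by have := nsq_ge0 b1; have := sqr_ge0 (Re a1); rewrite /nsq in ab1 *; rlra.
  by rewrite -[leRHS]sqrtr1 -sqrtr_sqr ler_wsqrtr.
have b3e : cabs b3 <= 2 * e.
  have [_ b3E _] := U2E 0; have [_ u01 _] := U1E 0.
  rewrite /b3 b3E; apply: le_trans (cabsD _ _) _; rewrite cabsN !cabsM u01 cabs_real (ger0_norm rho0).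
  have k1 := hoff 0 1 isT; have k2 := SU3_entry 0 2 hU1.
  have k3 := cabs_ge0 (U 0 1); have k4 := cabs_ge0 (U1 0 2); have k5 := cabs_ge0 v1.
  by rnra.
have Rea3 : 1 / 2 <= Re a3.
  have [a3E _ _] := U2E 0; have [u00 _ _] := U1E 0.
  rewrite /a3 a3E u00 ReD.
  have k1 : - (e * (2 * e)) <= Re (U 0 2 * b1).
    have := Re_le_cabs (U 0 2 * b1); rewrite cabsM ler_norml => /andP[k _].
    apply: le_trans k; rewrite lerN2; apply: ler_pM; rewrite ?cabs_ge0 //; exact: hoff.
  have k2 : (1 - e) * (1 - e) <= Re (U 0 0) * Re a1 by have := hRe 0; rnra.
  have k3 : - e <= Im (U 0 0) * Im a1.
    have : `|Im (U 0 0) * Im a1| <= e.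
      by rewrite normrM -[e]mulr1; apply: ler_pM.
    by rewrite ler_norml => /andP[].
  rewrite !reimE in k1 *; rnra.
have t1 := s1 ltac:(rlra).
have t2 := s2 ltac:(rewrite /=; rlra).
have t3 := s3 ltac:(rewrite ReJ; rlra).
rewrite cabsJ in t2; rewrite cabsN in t3.
have := f0 0; have := f0 1; have := f0 2 => g2 g1 g0.
have q1 : 4 * f 1 t * cabs b1 <= 4 * f 1 t * (2 * e) by rewrite ler_wpM2l // mulr_ge0.
have q2 : 4 * f 0 t * cabs v1 <= 4 * f 0 t * (2 * e) by rewrite ler_wpM2l ?mulr_ge0 //; rlra.
have q3 : 4 * f 2 t * cabs b3 <= 4 * f 2 t * (2 * e) by rewrite ler_wpM2l // mulr_ge0.
by rlra.
Qed.

End Decomposition.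

(** * Borel sets of matrices *)

Section Measurability.
Context {R : realType}.
Local Notation C := (R[i]%C).
Local Notation Re := complex.Re.
Local Notation Im := complex.Im.
Local Notation B := (borel_mx R).
Local Notation "M ^t*" := (map_mx Num.conj (M ^T)).
Implicit Types (f : 'I_3 -> R -> R).

Lemma measurable_Re_entry i j : measurable_fun [set: B] (fun A : B => Re ((A : 'M[C]_3) i j) : R).
Proof.
apply: (measurability _ (RGenInftyO.measurableE R)) => //.
move=> /= _ [_ [x ->] <-]; rewrite setTI; apply: sub_sigma_algebra.
exists i, j, x; left; apply/seteqP; split => A /=; by rewrite in_itv.
Qed.

Lemma measurable_Im_entry i j : measurable_fun [set: B] (fun A : B => Im ((A : 'M[C]_3) i j) : R).
Proof.
apply: (measurability _ (RGenInftyO.measurableE R)) => //.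
move=> /= _ [_ [x ->] <-]; rewrite setTI; apply: sub_sigma_algebra.
exists i, j, x; right; apply/seteqP; split => A /=; by rewrite in_itv.
Qed.

Definition cmeas (g : B -> C) : Prop :=
  measurable_fun [set: B] (fun A => Re (g A) : R) /\ measurable_fun [set: B] (fun A => Im (g A) : R).

Lemma cmeas_entry i j : cmeas (fun A => (A : 'M[C]_3) i j).
Proof. by split; [exact: measurable_Re_entry|exact: measurable_Im_entry]. Qed.

Lemma cmeas_cst (c : C) : cmeas (fun=> c).
Proof. by split; exact: measurable_cst. Qed.

Lemma cmeasD g h : cmeas g -> cmeas h -> cmeas (fun A => g A + h A).
Proof.
move=> [g1 g2] [h1 h2]; split.
- have -> : (fun A => Re (g A + h A) : R) = (fun A => Re (g A)) \+ (fun A => Re (h A)).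
    by apply/funext => A; rewrite ReD.
  exact: measurable_funD.
- have -> : (fun A => Im (g A + h A) : R) = (fun A => Im (g A)) \+ (fun A => Im (h A)).
    by apply/funext => A; rewrite ImD.
  exact: measurable_funD.
Qed.

Lemma cmeasM g h : cmeas g -> cmeas h -> cmeas (fun A => g A * h A).
Proof.
move=> [g1 g2] [h1 h2]; split.
- have -> : (fun A => Re (g A * h A) : R) =
     ((fun A => Re (g A)) \* (fun A => Re (h A))) \- ((fun A => Im (g A)) \* (fun A => Im (h A))).
    by apply/funext => A; rewrite reimE.
  by apply: measurable_funB; exact: measurable_funM.
- have -> : (fun A => Im (g A * h A) : R) =
     ((fun A => Re (g A)) \* (fun A => Im (h A))) \+ ((fun A => Im (g A)) \* (fun A => Re (h A))).
    by apply/funext => A; rewrite reimE.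
  by apply: measurable_funD; exact: measurable_funM.
Qed.

Lemma cmeasN g : cmeas g -> cmeas (fun A => - g A).
Proof.
move=> hg; have -> : (fun A => - g A) = (fun A => -1 * g A) by apply/funext => A; rewrite mulN1r.
by apply: cmeasM => //; exact: cmeas_cst.
Qed.

Lemma cmeasJ g : cmeas g -> cmeas (fun A => (g A)^*).
Proof.
move=> [g1 g2]; split; first by under eq_fun do rewrite ReJ.
have -> : (fun A => Im ((g A)^*) : R) = cst 0 \- (fun A => Im (g A)).
  by apply/funext => A; rewrite ImJ /= sub0r.
by apply: measurable_funB => //; exact: measurable_cst.
Qed.

Lemma cmeas_nsq g : cmeas g -> measurable_fun [set: B] (fun A => nsq (g A)).
Proof. by move=> [g1 g2]; apply: measurable_funD; exact: measurable_funX. Qed.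

(** SU(3) is the zero set of [h], a sum of squared moduli of polynomials in the real and imaginary
    parts of the entries. *)
Lemma measurable_SU3 : measurable (@SU3 R : set B).
Proof.
pose gram i j (A : B) : C := ((A : 'M[C]_3) *m (A : 'M[C]_3) ^t*) i j - (i == j)%:R.
pose dt (A : B) : C := \det (A : 'M[C]_3) - 1.
pose h (A : B) : R := \sum_(p : 'I_3 * 'I_3) nsq (gram p.1 p.2 A) + nsq (dt A).
have mgram i j : cmeas (gram i j).
  have -> : gram i j = (fun A : B => (A : 'M[C]_3) i 0 * ((A : 'M[C]_3) j 0)^* +
    (A : 'M[C]_3) i 1 * ((A : 'M[C]_3) j 1)^* + (A : 'M[C]_3) i 2 * ((A : 'M[C]_3) j 2)^* + - (i == j)%:R).
    by apply/funext => A; rewrite /gram mxE sum3C !mxE.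
  apply: cmeasD; last exact: cmeas_cst.
  by apply: cmeasD; [apply: cmeasD|]; apply: cmeasM; try apply: cmeasJ; exact: cmeas_entry.
have mdt : cmeas dt.
  have -> : dt = (fun A : B => (A : 'M[C]_3) 0 0 * ((A : 'M[C]_3) 1 1 * (A : 'M[C]_3) 2 2 + - ((A : 'M[C]_3) 1 2 * (A : 'M[C]_3) 2 1)) +
    - ((A : 'M[C]_3) 0 1 * ((A : 'M[C]_3) 1 0 * (A : 'M[C]_3) 2 2 + - ((A : 'M[C]_3) 1 2 * (A : 'M[C]_3) 2 0))) +
    (A : 'M[C]_3) 0 2 * ((A : 'M[C]_3) 1 0 * (A : 'M[C]_3) 2 1 + - ((A : 'M[C]_3) 1 1 * (A : 'M[C]_3) 2 0)) + -1).
    by apply/funext => A; rewrite /dt det3.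
  have minor i j k l p q r s m n : cmeas (fun A : B => (A : 'M[C]_3) i j *
      ((A : 'M[C]_3) k l * (A : 'M[C]_3) p q + - ((A : 'M[C]_3) r s * (A : 'M[C]_3) m n))).
    have e := cmeas_entry.
    exact: cmeasM (e i j) (cmeasD (cmeasM (e k l) (e p q)) (cmeasN (cmeasM (e r s) (e m n)))).
  apply: cmeasD; last exact: cmeas_cst.
  exact: cmeasD (cmeasD (minor _ _ _ _ _ _ _ _ _ _) (cmeasN (minor _ _ _ _ _ _ _ _ _ _)))
    (minor _ _ _ _ _ _ _ _ _ _).
have mh : measurable_fun [set: B] h.
  apply: measurable_funD; last exact: cmeas_nsq.
  by apply: measurable_sum => p; exact: cmeas_nsq.
have -> : (@SU3 R : set B) = [set: B] `&` h @^-1` [set 0].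
  rewrite setTI; apply/seteqP; split => A /=.
    move=> [/unitarymxP uA dA]; rewrite /h big1 ?add0r; last first.
      by move=> p _; rewrite /gram uA mxE subrr /nsq /= expr0n addr0.
    by rewrite /dt dA subrr /nsq /= expr0n addr0.
  have sum0 : 0 <= \sum_(p : 'I_3 * 'I_3) nsq (gram p.1 p.2 A).
    by apply: sumr_ge0 => p _; exact: nsq_ge0.
  rewrite /h => hA; have d0 := nsq_ge0 (dt A).
  have /nsq_eq0/eqP : nsq (dt A) = 0 by rlra.
  rewrite subr_eq0 => /eqP dA; split => //.
  have s0 : \sum_(p : 'I_3 * 'I_3) nsq (gram p.1 p.2 A) = 0 by rlra.
  apply/unitarymxP/matrixP => i j; rewrite [RHS]mxE; apply/eqP; rewrite -subr_eq0; apply/eqP.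
  apply: nsq_eq0; move/eqP: s0; rewrite psumr_eq0; last by move=> p _; exact: nsq_ge0.
  by move=> /allP/(_ (i, j)); rewrite mem_index_enum => /(_ isT) /eqP.
by apply: mh => //; exact: measurable_set1.
Qed.

Definition mx_dist (A A' : 'M[C]_3) : R :=
  \sum_(p : 'I_3 * 'I_3) (`|Re (A p.1 p.2) - Re (A' p.1 p.2)| + `|Im (A p.1 p.2) - Im (A' p.1 p.2)|).

Lemma mx_dist_triangle A A' A'' : mx_dist A A'' <= mx_dist A' A + mx_dist A' A''.
Proof.
rewrite /mx_dist -big_split /=; apply: ler_sum => p _.
have := ler_normB (Re (A' p.1 p.2) - Re (A'' p.1 p.2)) (Re (A' p.1 p.2) - Re (A p.1 p.2)).
have := ler_normB (Im (A' p.1 p.2) - Im (A'' p.1 p.2)) (Im (A' p.1 p.2) - Im (A p.1 p.2)).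
have e (a b c : R) : a - b - (a - c) = c - b by ring.
by rewrite !e; rlra.
Qed.

Lemma measurable_mx_dist A' : measurable_fun [set: B] (fun A : B => mx_dist A' A).
Proof.
apply: measurable_sum => p; apply: measurable_funD.
- apply: (@measurableT_comp _ _ _ _ _ _ (@Num.norm _ R) _ (fun A : B => Re (A' p.1 p.2) - Re ((A : 'M[C]_3) p.1 p.2))); first exact: normr_measurable.
  by apply: measurable_funB; [exact: measurable_cst|exact: measurable_Re_entry].
- apply: (@measurableT_comp _ _ _ _ _ _ (@Num.norm _ R) _ (fun A : B => Im (A' p.1 p.2) - Im ((A : 'M[C]_3) p.1 p.2))); first exact: normr_measurable.
  by apply: measurable_funB; [exact: measurable_cst|exact: measurable_Im_entry].
Qed.

Definition rat_mx (q : {ffun 'I_3 * 'I_3 -> rat * rat}) : 'M[C]_3 :=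
  \matrix_(i, j) Complex (ratr (q (i, j)).1) (ratr (q (i, j)).2).

Lemma rat_mx_dense (A : 'M[C]_3) (e : R) : 0 < e -> exists q, mx_dist (rat_mx q) A < e.
Proof.
(* There are 18 real coordinates; an error of [e / 19] in each leaves a strict inequality for the
   sum. *)
move=> e0; have e18 : 0 < e / 19 by rewrite divr_gt0.
have approx (x : R) : exists q : rat, `|ratr q - x| < e / 19.
  have [|q] := @rat_in_itvoo R (x - e / 19) (x + e / 19); first by rlra.
  by rewrite in_itv /= => hq; exists q; rewrite ltr_distl.
have [q hq] := choice approx.
exists [ffun p => (q (Re (A p.1 p.2)), q (Im (A p.1 p.2)))].
apply: (@le_lt_trans _ _ (\sum_(p : 'I_3 * 'I_3) (e / 19 + e / 19))).
  apply: ler_sum => p _; rewrite !mxE !ffunE /=.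
  by apply: lerD; apply: ltW; exact: hq.
by rewrite sumr_const card_prod !card_ord -mulr_natr /=; rlra.
Qed.

(* A relatively open subset of SU(3) is a countable union of traces of balls. *)
Lemma measurable_rel_open (S : set B) : (S `<=` @SU3 R) ->
  (forall A, S A -> exists2 d : R, 0 < d & forall A', SU3 A' -> mx_dist A A' < d -> S A') ->
  measurable S.
Proof.
move=> SSU hS.
pose ball (i : {ffun 'I_3 * 'I_3 -> rat * rat} * nat) : set B :=
  [set A | mx_dist (rat_mx i.1) A < i.2.+1%:R^-1].
have mball i : measurable (ball i).
  have -> : ball i = [set: B] `&` (fun A : B => mx_dist (rat_mx i.1) A) @^-1` `]-oo, i.2.+1%:R^-1[%classic.
    by rewrite setTI; apply/seteqP; split => A /=; rewrite in_itv.
  by apply: (measurable_mx_dist (rat_mx i.1)) => //; exact: measurable_itv.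
have -> : S = @SU3 R `&` \bigcup_i (if `[< ball i `&` @SU3 R `<=` S >] then ball i else set0).
  apply/seteqP; split => A; last by move=> [hA [i _]]; case: asboolP => // h hi; apply: h.
  move=> SA; split; first exact: SSU.
  have [d d0 hd] := hS A SA.
  pose n := Num.truncn (2 / d).
  have n0 : (0 : R) < n.+1%:R^-1 by rewrite invr_gt0.
  have n2 : 2 * n.+1%:R^-1 < d.
    by rewrite ltr_pdivrMr // mulrC -ltr_pdivrMr //; exact: truncnS_gt.
  have [q hq] := rat_mx_dense A n0.
  exists (q, n) => //; case: asboolP => // h; exfalso; apply: h => A' [hA' A'SU].
  apply: hd => //; apply: le_lt_trans (mx_dist_triangle A (rat_mx q) A') _.
  have hA'' : mx_dist (rat_mx q) A' < n.+1%:R^-1 := hA'.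
  by apply: lt_trans n2; rewrite mulr_natl mulr2n; exact: ltrD.
apply: measurableI; first exact: measurable_SU3.
apply: countable_bigcupT_measurable; first exact: countableP.
by move=> i; case: asboolP.
Qed.

End Measurability.

(** * Slices of balls and lengths of curves *)

Section Balls.
Context {R : realType}.
Local Notation C := (R[i]%C).
Local Notation Re := complex.Re.
Local Notation Im := complex.Im.
Local Notation "M ^t*" := (map_mx Num.conj (M ^T)).
Implicit Types (f : 'I_3 -> R -> R) (t r : R) (A B : 'M[C]_3).

Lemma joined_SU3 f p q l : joined f p q l -> 0 <= q.1 /\ SU3 q.2.
Proof.
elim=> {p q l} [t A _ _ h|p q r l l' _ _ _ h] //=.
by apply: h; rewrite ler01 lexx.
Qed.

(* The slices of a ball are relatively open in SU(3), since nearby points of a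
   level are joined by short curves in that level. *)
Lemma measurable_ball_slice f p r t : 0 <= t -> (forall i, 0 <= f i t) ->
  measurable ([set A | geodesic_ball f p r (t, A)] : set (borel_mx R)).
Proof.
move=> t0 f0; apply: measurable_rel_open => [A [l hl _]|A [l hl lr]].
  by have [] := joined_SU3 hl.
pose F := f 0 t + f 1 t + f 2 t.
have F0 : 0 <= F by rewrite !addr_ge0.
have SA : SU3 (A : 'M[C]_3) by have [] := joined_SU3 hl.
pose d := Num.min (1 / 8) ((r - l) / (8 * F + 1)).
have d1 : 0 < (r - l) / (8 * F + 1) by rewrite divr_gt0 ?subr_gt0 //; rlra.
have d0 : 0 < d by rewrite lt_min d1; rlra.
have [d8 dr] : d <= 1 / 8 /\ d <= (r - l) / (8 * F + 1) by rewrite /d !ge_min !lexx orbT.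
exists d => // A' hA' hd.
have hU : SU3 (A' ^t* *m A) by apply: SU3_mul => //; exact: SU3_adj.
have [l' [hl' _ hs]] := connect_SU3 t0 hA' hU f0.
have [_ AA'] := SU3_adjK hA'; rewrite mulmxA AA' mul1mx in hl'.
exists (l + l'); first exact: joined_cat hl hl'.
pose e := mx_dist A A'.
have e0 : 0 <= e by apply: sumr_ge0 => x _; rewrite addr_ge0.
have e8 : e <= 1 / 8 by apply: le_trans d8; exact: ltW.
have entry i j : cabs (A i j - A' i j) <= `|Re (A i j) - Re (A' i j)| + `|Im (A i j) - Im (A' i j)|.
  by apply: le_trans (cabs_le_ReIm _) _; rewrite !reimE.
have he i j : cabs ((A' ^t* *m A) i j - (i == j)%:R) <= e.
  have [A'A _] := SU3_adjK hA'.
  have -> : (A' ^t* *m A) i j - (i == j)%:R = (A' ^t* *m (A - A')) i j.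
    by rewrite mulmxBr A'A !mxE.
  rewrite mxE sum3C !mxE.
  have b k : cabs ((A' k i)^* * (A k j - A' k j)) <= `|Re (A k j) - Re (A' k j)| + `|Im (A k j) - Im (A' k j)|.
    rewrite cabsM cabsJ; apply: le_trans (entry k j).
    by rewrite ler_piMl ?cabs_ge0 // SU3_entry.
  apply: (@le_trans _ _ (\sum_(k < 3) (`|Re (A k j) - Re (A' k j)| + `|Im (A k j) - Im (A' k j)|))).
    rewrite sum3; apply: le_trans (cabsD _ _) _; apply: lerD => //.
    by apply: le_trans (cabsD _ _) _; exact: lerD.
  rewrite /e /mx_dist.
  rewrite -(pair_bigA _ (fun k j => `|Re (A k j) - Re (A' k j)| + `|Im (A k j) - Im (A' k j)|)) /=.
  apply: ler_sum => k _; rewrite (bigD1 j) //= lerDl.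
  by apply: sumr_ge0 => x _; rewrite addr_ge0.
have := hs e e8 he; rewrite -/F => hl8.
have : e * (8 * F + 1) < r - l.
  by rewrite -ltr_pdivlMr; [exact: lt_le_trans dr|rlra].
by rlra.
Qed.

Lemma C1_mx_cst A : C1_mx (fun=> A).
Proof. by move=> i j; split; exact: C1_cst. Qed.

Lemma joined_radial f t0 t1 A : 0 <= t0 -> 0 <= t1 -> SU3 A -> joined f (t0, A) (t1, A) `|t1 - t0|.
Proof.
move=> h0 h1 hA; pose t s : R := t0 + s * (t1 - t0).
have dt s : is_der t s (t1 - t0) by rewrite /t; der_eq; ring.
have dtE : derive1 t = (fun=> t1 - t0) by apply/funext => s; exact: der_val.
have Ct : C1 t.
  by split; [move=> s; exact: der_derivable (dt s)|rewrite dtE => s; exact: cvg_cst].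
have dA s : derive1_mx (fun=> A) s = 0.
  by apply/matrixP => i j; rewrite !mxE !derive1_cst; apply: complex_ext.
have hl : curve_length f t (fun=> A) = `|t1 - t0|.
  apply: curve_length_cst => s _; rewrite /speed dtE dA mulmx0.
  by rewrite big1 ?addr0 ?sqrtr_sqr // => i _; rewrite !mxE /= expr0n !addr0 !mulr0.
have e0 : t 0 = t0 by rewrite /t mul0r addr0.
have e1 : t 1 = t1 by rewrite /t; ring.
have := @joined_C1 R f t (fun=> A) Ct (C1_mx_cst A); rewrite hl e0 e1; apply.
by move=> s hs; split => //; rewrite /t; rnra.
Qed.

(** The motion along the fibre is made in the level of the centre, at a cost that depends on neither
    [t] nor [r], and is followed by a radial segment. *)
Lemma ball_slice_full f t0 A0 t r : 0 <= t0 -> 0 <= t -> SU3 A0 -> (forall i, 0 <= f i t0) ->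
  2 * pi * (f 0 t0 + f 1 t0 + f 2 t0) + `|t - t0| < r ->
  [set A | geodesic_ball f (t0, A0) r (t, A)] = @SU3 R.
Proof.
move=> h0 h hA0 f0 hr; apply/seteqP; split => A.
  by move=> [l hl _]; have [] := joined_SU3 hl.
move=> hA; have hU : SU3 (A ^t* *m A0) by apply: SU3_mul => //; exact: SU3_adj.
have [l [hl l1 _]] := connect_SU3 h0 hA hU f0.
have [_ AA] := SU3_adjK hA; rewrite mulmxA AA mul1mx in hl.
exists (l + `|t - t0|); last by rlra.
exact: joined_cat hl (joined_radial f h0 h hA).
Qed.

Lemma continuous_sum3 (h : 'I_3 -> R -> R) : (forall i, continuous (h i)) ->
  continuous (fun s => \sum_(i < 3) h i s).
Proof.
move=> ch; have -> : (fun s => \sum_(i < 3) h i s) = (fun s => h 0 s + h 1 s + h 2 s).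
  by apply/funext => s; rewrite sum3.
by move=> s; apply: cvgD; [apply: cvgD|]; exact: ch.
Qed.

(** The speed is at least [|t'|]; the work lies in its continuity, which makes the integrals
    comparable. As [f] is arbitrary at negative times, [F] supplies a continuous function on the
    line that agrees with it where the curve runs. *)
Lemma curve_length_ge f (F : 'I_3 -> R -> R) (t : R -> R) (A : R -> 'M[C]_3) :
  (forall i, continuous (F i)) -> (forall i t, 0 <= t -> f i t = F i t) ->
  C1 t -> C1_mx A -> (forall s, 0 <= s <= 1 -> 0 <= t s /\ SU3 (A s)) ->
  `|t 1 - t 0| <= curve_length f t A.
Proof.
move=> cF fF [dt ct] CA hA.
have cont_t : continuous t by move=> s; exact: der_cont (derivable_der (dt s)).
have cA i j : continuous (fun s => Re (A s i j)) /\ continuous (fun s => Im (A s i j)) /\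
    continuous (fun s => Re (derive1_mx A s i j)) /\ continuous (fun s => Im (derive1_mx A s i j)).
  have [[d1 c1] [d2 c2]] := CA i j; split; last split; last split.
  - by move=> s; exact: der_cont (derivable_der (d1 s)).
  - by move=> s; exact: der_cont (derivable_der (d2 s)).
  - have -> : (fun s => Re (derive1_mx A s i j)) = derive1 (fun x => Re (A x i j)).
      by apply/funext => s; rewrite mxE.
    exact: c1.
  - have -> : (fun s => Im (derive1_mx A s i j)) = derive1 (fun x => Im (A x i j)).
      by apply/funext => s; rewrite mxE.
    exact: c2.
(* On SU(3) the inverse is the adjoint, whose entries are continuous at all times, also outside
   [[0, 1]] where [A s] need not be invertible. *)
pose w s := (A s) ^t* *m derive1_mx A s.
have adjE s i j : ((A s) ^t*) i j = (A s j i)^* by rewrite !mxE.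
have cw i j : continuous (fun s => Re (w s i j)) /\ continuous (fun s => Im (w s i j)).
  split.
  - have -> : (fun s => Re (w s i j)) = (fun s => \sum_(k < 3)
        (Re (A s k i) * Re (derive1_mx A s k j) + Im (A s k i) * Im (derive1_mx A s k j))).
      by apply/funext => s; rewrite /w mxE sum3C sum3 !adjE !reimE; ring.
    apply: continuous_sum3 => k s; have [a1 [a2 _]] := cA k i; have [_ [_ [a3 a4]]] := cA k j.
    by apply: cvgD; apply: cvgM; [exact: a1|exact: a3|exact: a2|exact: a4].
  - have -> : (fun s => Im (w s i j)) = (fun s => \sum_(k < 3)
        (Re (A s k i) * Im (derive1_mx A s k j) - Im (A s k i) * Re (derive1_mx A s k j))).
      by apply/funext => s; rewrite /w mxE sum3C sum3 !adjE !reimE; ring.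
    apply: continuous_sum3 => k s; have [a1 [a2 _]] := cA k i; have [_ [_ [a3 a4]]] := cA k j.
    by apply: cvgB; apply: cvgM; [exact: a1|exact: a4|exact: a2|exact: a3].
pose rad s : R := derive1 t s ^+ 2 + \sum_(i < 3) F i (t s) ^+ 2 *
      (4 * (Re (w s (i + 1) (i + 2)) ^+ 2 + Im (w s (i + 1) (i + 2)) ^+ 2)).
pose sp s : R := Num.sqrt (rad s).
have csp : continuous sp.
  move=> s; apply: (@continuous_comp _ _ _ rad (@Num.sqrt R) s); last exact: sqrt_continuous.
  apply: (@cvgD _ _ _ _ _ (fun s => derive1 t s ^+ 2)); first by apply: cvgM; exact: ct.
  apply: (@continuous_sum3 (fun i s => F i (t s) ^+ 2 *
      (4 * (Re (w s (i + 1) (i + 2)) ^+ 2 + Im (w s (i + 1) (i + 2)) ^+ 2)))) => i x.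
  have cFt : {for x, continuous (fun s => F i (t s))}.
    by apply: (@continuous_comp _ _ _ t (F i) x); [exact: cont_t|exact: cF].
  have [c1 c2] := cw (i + 1) (i + 2).
  apply: cvgM; first by apply: cvgM; exact: cFt.
  apply: cvgM; first exact: cvg_cst.
  by apply: cvgD; apply: cvgM; [exact: c1|exact: c1|exact: c2|exact: c2].
have -> : curve_length f t A = Rintegral (@lebesgue_measure R) `[0, 1] sp.
  apply: eq_Rintegral => s; rewrite inE /= in_itv /= => hs; have [ts [uA _]] := hA s hs.
  by rewrite /speed invmx_unitary // /sp /rad /w; congr (Num.sqrt (_ + _)); apply: eq_bigr => i _; rewrite fF.
have sp_ge s : `|derive1 t s| <= sp s.
  rewrite -sqrtr_sqr ler_wsqrtr // lerDl; apply: sumr_ge0 => i _.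
  by rewrite mulr_ge0 ?sqr_ge0 // mulr_ge0 // addr_ge0 ?sqr_ge0.
have integ (h : R -> R) : continuous h -> (@lebesgue_measure R).-integrable `[0, 1]%classic (EFin \o h).
  move=> ch; apply: continuous_compact_integrable; first exact: segment_compact.
  by apply: continuous_subspaceT.
have ftc : Rintegral (@lebesgue_measure R) `[0, 1] (derive1 t) = t 1 - t 0.
  have lr : derivable_oo_LRcontinuous t 0 1.
    split; first by move=> x _; exact: dt.
    - by apply: cvg_at_right_filter; exact: cont_t.
    - by apply: cvg_at_left_filter; exact: cont_t.
  have cw01 : {within `[0, 1], continuous (derive1 t)} by exact: continuous_subspaceT.
  by have h := @continuous_FTC2 R (derive1 t) t 0 1 ltr01 cw01 lr (fun x _ => erefl); rewrite /Rintegral h.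
have m01 : measurable (`[0, 1]%classic : set R) by exact: measurable_itv.
rewrite -ftc ler_norml; apply/andP; split.
- rewrite lerNl -[X in X <= _]mulN1r -RintegralZl //; last exact: integ.
  apply: le_Rintegral => //; [|exact: integ|].
    by apply: (integ (fun x => -1 * derive1 t x)) => s; apply: cvgM; [exact: cvg_cst|exact: ct].
  move=> s _; apply: le_trans (sp_ge s); rewrite mulN1r -normrN; exact: ler_norm.
- apply: le_Rintegral => //; [exact: integ|exact: integ|].
  by move=> s _; apply: le_trans (sp_ge s); exact: ler_norm.
Qed.

Lemma joined_length_ge f (F : 'I_3 -> R -> R) p q l : (forall i, continuous (F i)) ->
  (forall i t, 0 <= t -> f i t = F i t) -> joined f p q l -> `|q.1 - p.1| <= l.
Proof.
move=> cF fF; elim=> {p q l} [t A Ct CA hA|p q r l l' _ h1 _ h2] /=.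
  exact: curve_length_ge cF fF Ct CA hA.
have := ler_normD (r.1 - q.1) (q.1 - p.1); rewrite addrA subrK; rlra.
Qed.

End Balls.

(** * Volume growth of the critical soliton *)

Section VolumeGrowth.
Context {R : realType}.
Implicit Types (c t r : R) (f : 'I_3 -> R -> R) (u : R -> R).
Local Notation k := (@critical_k R).

(* No measurability is required, the integral of a nonnegative function being a
   supremum over the simple functions below it. *)
Lemma ge0_integral_mono d (T : measurableType d) (mu : {measure set T -> \bar R})
    (D E : set T) (f g : T -> \bar R) :
  (forall x, D x -> (0 <= f x)%E) -> (forall x, E x -> (0 <= g x)%E) ->
  (forall x, D x -> E x /\ (f x <= g x)%E) ->
  (\int[mu]_(x in D) f x <= \int[mu]_(x in E) g x)%E.
Proof.
move=> f0 g0 fg; rewrite !ge0_integralE //; apply: ereal_sup_le => _ /= [h hf <-]; exists h => //.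
move=> x; apply: le_trans (hf x) _; rewrite /patch.
case: ifPn => [|_]; first by rewrite inE => /fg [Ex fgx]; rewrite mem_set.
by case: ifPn => //; rewrite inE => /g0.
Qed.

Lemma continuous_critical_f i : continuous (@critical_f R i).
Proof.
have dE (m : R) t : is_der (fun t => expR (m * t)) t (m * expR (m * t)).
  by have := @expR_affine_der R m 0 t; under eq_fun do rewrite subr0; rewrite subr0.
have c1 t : {for t, continuous (fun t => expR (k * t))} by exact: der_cont (dE k t).
have c2 t : {for t, continuous (fun t => expR (- (k * t)))}.
  have -> : (fun t => expR (- (k * t))) = (fun t => expR (- k * t)).
    by apply/funext => x; rewrite mulNr.
  exact: der_cont (dE (- k) t).
elim/I3P: i => t.
- by rewrite /critical_f /=; apply: cvgM; [exact: cvg_cst|apply: cvgB; [exact: c1|exact: c2]].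
- apply: (@continuous_comp _ _ _ (fun t => (expR (k * t) ^+ 2 + 1) / 2) (@Num.sqrt R) t); last exact: sqrt_continuous.
  apply: cvgM; last exact: cvg_cst.
  by apply: cvgD; [apply: cvgM; exact: c1|exact: cvg_cst].
- apply: (@continuous_comp _ _ _ (fun t => (1 + expR (- (k * t)) ^+ 2) / 2) (@Num.sqrt R) t); last exact: sqrt_continuous.
  apply: cvgM; last exact: cvg_cst.
  by apply: cvgD; [exact: cvg_cst|apply: cvgM; exact: c2].
Qed.

Lemma critical_f_ge0 i t : 0 <= t -> 0 <= critical_f i t :> R.
Proof.
move=> t0; elim/I3P: i; rewrite /critical_f /= ?sqrtr_ge0 //.
apply: mulr_ge0; first exact: ltW critical_k_gt0.
have h : 0 <= k * t by rewrite mulr_ge0 // ltW // critical_k_gt0.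
by rewrite subr_ge0 ler_expR; rlra.
Qed.

(** The volume density up to a constant, with its leading exponential factored out: [4 k] will be
    the rate of growth. *)
Lemma critical_prod_sqr t : (critical_f 0 t * critical_f 1 t * critical_f 2 t) ^+ 2 =
  1 / 8 * expR (4 * k * t) * (1 - expR (- (k * t)) ^+ 4) ^+ 2.
Proof.
have [-> -> ->] := critical_fE t; set E := expR (- (k * t)).
have E0 : 0 < E by exact: expR_gt0.
have q0 : 0 <= (1 + E ^+ 2) / 2 by rewrite divr_ge0 // addr_ge0 // ltW // exprn_gt0.
set Q := Num.sqrt _; have Q2 : Q ^+ 2 = (1 + E ^+ 2) / 2 by rewrite sqr_sqrtr.
have e4 : expR (4 * k * t) = expR (k * t) ^+ 4.
  by rewrite -expRM_natl; congr expR; rewrite -mulr_natl; ring.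
have -> : (expR (k * t) * (k * (1 - E ^+ 2)) * (expR (k * t) * Q) * Q) ^+ 2 =
   expR (k * t) ^+ 4 * (k ^+ 2 * (1 - E ^+ 2) ^+ 2 * (Q ^+ 2) ^+ 2) by ring.
by rewrite Q2 critical_k_sqr e4; field.
Qed.

Lemma critical_volume_growth f (s : 'S_3) : (forall i t, 0 <= t -> f (s i) t = critical_f i t) ->
  exponential_volume_growth f.
Proof.
move=> fE nu [nuSU _] t0 A0 t00 hA0.
have k0 : 0 < k := critical_k_gt0; pose l := 4 * k; have l0 : 0 < l by rewrite mulr_gt0.
pose F i := @critical_f R (s^-1%g i).
have fF i t : 0 <= t -> f i t = F i t by move=> tp; rewrite -{1}(permKV s i) fE.
have cF i : continuous (F i) by exact: continuous_critical_f.
have f0 i t : 0 <= t -> 0 <= f i t by move=> tp; rewrite fF //; exact: critical_f_ge0.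
have pE t : 0 <= t -> prodf f t ^+ 2 = 1 / 8 * expR (l * t) * (1 - expR (- (k * t)) ^+ 4) ^+ 2.
  by move=> tp; rewrite /prodf prod3 -(perm_prod3 s (f^~ t)) !fE // critical_prod_sqr.
have E1 t : 0 <= t -> 0 <= expR (- (k * t)) ^+ 4 <= 1.
  move=> tp; rewrite exprn_ge0 ?expR_ge0 // expr_le1 ?expR_ge0 // -expR0 ler_expR oppr_le0.
  by rewrite mulr_ge0 // ltW.
have p_up t : 0 <= t -> prodf f t ^+ 2 <= 1 / 8 * expR (l * t).
  move=> tp; rewrite pE // ler_piMr ?mulr_ge0 ?expR_ge0 //; have := E1 t tp; rnra.
(* Beyond [N] the factor [(1 - E^4)^2] of the density is at least [1 / 4], whence the constant
   [1 / 32] in [p_lo]. *)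
have [N hN] : exists N, forall t, N < t -> expR (- (k * t)) < 1 / 2.
  have h := @cvgr_dist_lt _ _ _ _ _ _ _ (@cvg_critical_exp R) (1 / 2) ltac:(rlra).
  case: h => N [_ hN]; exists N => t Nt; have := hN t Nt.
  by rewrite sub0r normrN gtr0_norm ?expR_gt0.
have p_lo t : 0 <= t -> N < t -> 1 / 32 * expR (l * t) <= prodf f t ^+ 2.
  move=> tp Nt; rewrite pE //; have E2 := hN t Nt; have e0 := expR_ge0 (- (k * t)).
  have E4 : expR (- (k * t)) ^+ 4 <= 1 / 2.
    rewrite (_ : 4%N = (2 * 2)%N) // exprM; have : expR (- (k * t)) ^+ 2 <= 1 / 2 by rnra.
    by have := sqr_ge0 (expR (- (k * t))); rnra.
  have : 1 / 4 <= (1 - expR (- (k * t)) ^+ 4) ^+ 2 by rnra.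
  by have := expR_gt0 (l * t); rnra.
pose ball r := geodesic_ball f (t0, A0) r.
have mslice r t : 0 <= t -> measurable ([set A | ball r (t, A)] : set (borel_mx R)).
  by move=> tp; apply: measurable_ball_slice => // i; exact: f0.
have slice0 r t : t0 + r <= t -> [set A | ball r (t, A)] = set0.
  move=> h; apply/seteqP; split => A //= [l' /(joined_length_ge cF fF) /=].
  by have := ler_norm (t - t0); rlra.
(* The bounded error of the lower estimate: levels [t <= r - Ct] lie entirely in the ball, the cost
   of a motion inside the level [t0] and the distance [|t - t0|] being accounted for. The 1 makes
   the inequality strict. *)
pose Ct := 2 * pi * (f 0 t0 + f 1 t0 + f 2 t0) + t0 + 1.
have Ct0 : t0 + 1 <= Ct.
  have : 0 <= 2 * pi * (f 0 t0 + f 1 t0 + f 2 t0).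
    by rewrite mulr_ge0 ?mulr_ge0 ?pi_ge0 // !addr_ge0 ?f0.
  by rewrite /Ct; rlra.
pose C0 := (4 * pi) ^+ 3 / 2 : R.
have C00 : 0 < C0 by rewrite divr_gt0 // exprn_gt0 // mulr_gt0 // pi_gt0.
pose I r t : \bar R := ((prodf f t ^+ 2)%:E * nu [set A | ball r (t, A)])%E.
have nu0 r t : (0 <= nu [set A | ball r (t, A)])%E by exact: measure_ge0.
have I0 r t : (0 <= I r t)%E by rewrite mule_ge0 // lee_fin sqr_ge0.
have I_up r t : 0 <= t -> (I r t <= (1 / 8 * expR (l * t))%:E)%E.
  move=> tp; rewrite -[leRHS]mule1; apply: lee_pmul => //.
  - by rewrite lee_fin sqr_ge0.
  - by rewrite lee_fin p_up.
  - by apply: probability_le1; exact: mslice.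
have upper r : 0 < r -> (\int[@lebesgue_measure R]_(t in `[0%R, +oo[) I r t <=
    (1 / (8 * l) * expR (l * (t0 + r)))%:E)%E.
  move=> r0; pose M := t0 + r; have M0 : 0 < M by rewrite /M; rlra.
  have -> : (\int[@lebesgue_measure R]_(t in `[0%R, +oo[) I r t = \int[@lebesgue_measure R]_(t in `[0%R, M]) I r t)%E.
    rewrite integral_mkcond [RHS]integral_mkcond; apply: eq_integral => t _; rewrite /patch.
    have e : (t \in `[0, +oo[%classic) = (0 <= t) by rewrite mem_setE in_itv /= andbT.
    have e' : (t \in `[0, M]%classic) = (0 <= t <= M) by rewrite mem_setE in_itv.
    rewrite e e'; case: leP => //= tp; case: leP => // Mt.
    by rewrite /I slice0 ?measure0 ?mule0 // ltW.
  apply: (@le_trans _ _ (\int[@lebesgue_measure R]_(t in `[0%R, M]) (1 / 8 * expR (l * t))%:E)%E).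
    apply: ge0_integral_mono => [t _|t _|t /= ht].
    - exact: I0.
    - by rewrite lee_fin mulr_ge0 ?expR_ge0.
    - by split => //; apply: I_up; move: ht; rewrite in_itv /= => /andP[].
  have dexp t : is_der (fun t => 1 / (8 * l) * expR (l * t)) t (1 / 8 * expR (l * t)).
    have h : is_der (fun t => expR (l * t)) t (l * expR (l * t)).
      by have := @expR_affine_der R l 0 t; under eq_fun do rewrite subr0; rewrite subr0.
    by der_eq; field; rewrite gt_eqF.
  have ch : continuous (fun t => 1 / 8 * expR (l * t)).
    move=> t; apply: cvgM; first exact: cvg_cst.
    have h : is_der (fun t => expR (l * t)) t (l * expR (l * t)).
      by have := @expR_affine_der R l 0 t; under eq_fun do rewrite subr0; rewrite subr0.
    exact: der_cont h.
  rewrite (@continuous_FTC2 R (fun t => 1 / 8 * expR (l * t)) (fun t => 1 / (8 * l) * expR (l * t)) 0 M M0).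
  - by rewrite -EFinB lee_fin lerBlDr lerDl mulr_ge0 ?expR_ge0 // divr_ge0 // mulr_ge0 // ltW.
  - exact: continuous_subspaceT.
  - split; first by move=> t _; exact: der_derivable (dexp t).
    + by apply: cvg_at_right_filter; exact: der_cont (dexp 0).
    + by apply: cvg_at_left_filter; exact: der_cont (dexp M).
  - by move=> t _; exact: der_val.
have lower r : Ct + 1 + `|N| < r -> ((1 / 32 * expR (l * (r - Ct - 1)))%:E <=
    \int[@lebesgue_measure R]_(t in `[0%R, +oo[) I r t)%E.
  move=> hr; pose M := r - Ct; have nN := normr_ge0 N; have NN := ler_norm N.
  apply: (@le_trans _ _ (\int[@lebesgue_measure R]_(t in `[(M - 1)%R, M]) (1 / 32 * expR (l * (M - 1)))%:E)%E).
    rewrite integral_cst //=; have := @lebesgue_measure_itv R `[M - 1, M].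
    rewrite /= lte_fin ltrBlDr ltrDl ltr01 => ->.
    have -> : (M%:E + (- (M - 1))%:E = 1%:E)%E by rewrite -EFinD; congr EFin; ring.
    by rewrite mule1.
  apply: ge0_integral_mono => [t _|t _|t /=].
  - by rewrite lee_fin mulr_ge0 ?expR_ge0.
  - exact: I0.
  rewrite !in_itv /= => /andP[t1 t2]; rewrite /M in t1 t2.
  have tp : 0 <= t by rlra.
  split; first by rewrite tp.
  have -> : I r t = (prodf f t ^+ 2)%:E.
    rewrite /I /ball (ball_slice_full (A0 := A0) t00 tp hA0 (fun i => f0 i t0 t00)) ?nuSU ?mule1 //.
    have [tt|tt] := leP t t0.
      by rewrite ler0_norm ?subr_le0 //; rewrite /Ct in hr t2 *; rlra.
    by rewrite gtr0_norm ?subr_gt0 //; rewrite /Ct in hr t2 *; rlra.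
  rewrite lee_fin; apply: le_trans (p_lo t tp _); last by rlra.
  by rewrite ler_wpM2l // ler_expR ler_wpM2l ?(ltW l0) // /M.
exists l, (C0 * (1 / 32 * expR (- l * (Ct + 1)))), (C0 * (1 / (8 * l) * expR (l * t0))).
have l8 : 0 < 1 / (8 * l) by rewrite divr_gt0 // mulr_gt0.
split; [exact: l0| | |].
- by apply: mulr_gt0 => //; apply: mulr_gt0; rewrite ?expR_gt0.
- by apply: mulr_gt0 => //; apply: mulr_gt0; rewrite ?expR_gt0.
exists (Ct + 1 + `|N|); split; first exact: num_real.
move=> r hr; have nN := normr_ge0 N; have r0 : 0 < r by rlra.
rewrite /riemannian_volume -/C0; apply/andP; split.
- have -> : C0 * (1 / 32 * expR (- l * (Ct + 1))) * expR (l * r) = C0 * (1 / 32 * expR (l * (r - Ct - 1))).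
    have -> : l * (r - Ct - 1) = - l * (Ct + 1) + l * r by ring.
    by rewrite expRD !mulrA.
  by rewrite EFinM; apply: lee_wpmul2l; [rewrite lee_fin ltW|exact: lower].
- have -> : C0 * (1 / (8 * l) * expR (l * t0)) * expR (l * r) = C0 * (1 / (8 * l) * expR (l * (t0 + r))).
    by rewrite mulrDr expRD !mulrA.
  by rewrite [leRHS]EFinM; apply: lee_wpmul2l; [rewrite lee_fin ltW|exact: upper].
Qed.

End VolumeGrowth.

Lemma critical_soliton (R : realType) (c : R) (T : \bar R) (f : 'I_3 -> R -> R) (u : R -> R) :
  c ^+ 2 = 9 / 2 -> S_soliton 1 c T f u ->
  [/\ T = +oo%E /\ complete_soliton 0%E T f u,
      ~ trivial_soliton 0%E T f u,
      exponential_volume_growth f,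
      exists2 L : R, L < 0 & scalar_curvature f t @[t --> +oo] --> L &
      exists k : 'I_3,
        (exists2 l : R, 0 < l & f k t @[t --> +oo] --> l) /\
        forall i j : 'I_3, i != k -> j != k -> i != j ->
          grows_exponentially (fun t => (f i t)%:E) /\
          f i t / f j t @[t --> +oo] --> (1 : R)].
Proof.
move=> hc hS; have [s [cc [fE _ _]]] := S_soliton_critical hc hS; split.
- by have [h _] := completeness_dichotomy hS; apply: h; rewrite hc.
- by apply: S_soliton_nontrivial hS _; rewrite -sqrf_eq0 hc gt_eqF // divr_gt0.
- exact: critical_volume_growth fE.
- by exists (- 6); [rewrite oppr_lt0|exact: critical_soliton_curvature hc hS].
- exact: critical_soliton_asymptotics hc hS.
Qed.

Theorem theorem7 (R : realType) :
  (* completeness dichotomy *)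
  (forall (c : R) (T : \bar R) (f : 'I_3 -> R -> R) (u : R -> R),
     S_soliton 1 c T f u ->
     (c ^+ 2 <= 9 / 2 -> T = +oo%E /\ complete_soliton 0%E T f u) /\
     (9 / 2 < c ^+ 2 ->
        ~ complete_soliton 0%E T f u /\
        exists ts : R, T = ts%:E /\
        exists k : 'I_3,
          [/\ \forall t \near ts^'-, forall j, f k t <= f j t,
              f k t @[t --> ts^'-] --> (0 : R) &
              exists K : R, \forall t \near ts^'-,
                `| f k t | <= K * Num.sqrt (ts - t)])) /\
  (* (i) *)
  (forall (rev : bool) (a b : \bar R) (f : 'I_3 -> R -> R) (u : R -> R),
     complete_invariant_soliton rev a b f u ->
     exists (c : R) (f' : 'I_3 -> R -> R) (u' : R -> R),
       [/\ c ^+ 2 <= 9 / 2, S_soliton 1 c +oo%E f' u' &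
           equivalent_to rev a b f u f' u']) /\
  (* (ii) *)
  ((forall (T : \bar R) (f : 'I_3 -> R -> R) (u : R -> R),
      S_soliton 1 0 T f u ->
      [/\ T = +oo%E,
          trivial_soliton 0%E T f u,
          exists m : R, bryant_salamon m 0%E T f &
          asymptotic_to (@C_tf R) (- 4) f]) /\
   (forall k : 'I_3 -> R, (forall i, 0 < k i) ->
      (torsion_free 0%E +oo%E (cone k) <-> cone k = @C_tf R))) /\
  (* (iii) *)
  (forall (c : R) (T : \bar R) (f : 'I_3 -> R -> R) (u : R -> R),
     0 < c ^+ 2 -> c ^+ 2 < 9 / 2 -> S_soliton 1 c T f u ->
     [/\ T = +oo%E,
         ~ trivial_soliton 0%E T f u &
         asymptotic_to (@C_tf R) (- 1) f]) /\
  (* (iv) *)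
  (forall (c : R) (T : \bar R) (f : 'I_3 -> R -> R) (u : R -> R),
     c ^+ 2 = 9 / 2 -> S_soliton 1 c T f u ->
     [/\ T = +oo%E /\ complete_soliton 0%E T f u,
         ~ trivial_soliton 0%E T f u,
         exponential_volume_growth f,
         exists2 L : R, L < 0 & scalar_curvature f t @[t --> +oo] --> L &
         exists k : 'I_3,
           (exists2 l : R, 0 < l & f k t @[t --> +oo] --> l) /\
           forall i j : 'I_3, i != k -> j != k -> i != j ->
             grows_exponentially (fun t => (f i t)%:E) /\
             f i t / f j t @[t --> +oo] --> (1 : R)]).
Proof.
split; last split; last split; last split.
- by move=> c T f u; exact: completeness_dichotomy.
- by move=> rev a b f u; exact: complete_invariant_soliton_classification.
- split=> [T f u hS|k k0]; last exact: torsion_free_cone.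
  have [hT ht _ _] := S_soliton_zero hS; split => //.
    by exists 1; exact: S_soliton_bryant_salamon hS.
  exact: S_soliton_zero_asymptotic hS.
- by move=> c T f u; exact: noncritical_soliton.
- by move=> c T f u; exact: critical_soliton.
Qed.
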